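(* Let $k$ be a field and let $A$ be a noetherian locally finite $\mathbb N$-graded $k$-algebra. If $A$ is graded FBN, or $A$ has enough normal elements, then $\operatorname{GKdim}M=\operatorname{Kdim}M\in\mathbb N$ for every nonzero finitely generated left or right graded $A$-module $M$.
   Context: Algebras are associative with $1$ over $k$; noetherian means left and right noetherian. $A=\bigoplus_{n\ge0}A_n$ is locally finite if each $A_n$ has finite rank over $k$. $\operatorname{GKdim}$ is Gelfand-Kirillov dimension and $\operatorname{Kdim}$ is Krull dimension in the sense of Gabriel-Rentschler. $\mathbb N=\{0,1,2,\dots\}$. $A$ is graded FBN (graded fully bounded noetherian) if it is noetherian and for every graded prime ideal $\mathfrak p$, every essential graded left or right ideal of $A/\mathfrak p$ contains a nonzero graded two-sided ideal. An element $a$ of a ring $S$ is normal if $aS=Sa$. $A$ has enough normal elements if for every graded prime ideal $\mathfrak p$ of $A$ not containing $A_{\ge1}=\bigoplus_{n\ge1}A_n$, the factor $A/\mathfrak p$ has a nonzero homogeneous normal element of positive degree. (When $A_0=k$, the condition on $\mathfrak p$ just says $A/\mathfrak p\ne k$.) *)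

(* Defs.v *)
From HB Require Import structures.
From mathcomp Require Import all_boot all_order all_algebra.
From mathcomp Require Import ring_quotient.
From mathcomp Require Import all_classical all_reals all_analysis.

Set Implicit Arguments.
Unset Strict Implicit.
Unset Printing Implicit Defensive.

Import GRing.Theory.

Local Open Scope classical_set_scope.
Local Open Scope ring_scope.
Local Open Scope quotient_scope.

(* Left R-modules are [lmodType R]; right R-modules are [lmodType R^c]. In
   particular the left (resp. right) ideals of R are the submodules of R^o
   (resp. of (R^c)^o). Note that [nzRingType] and [algType] exclude the zero
   ring, all of whose modules are zero. *)

(* The opposite ring of a k-algebra is a k-algebra with the same scaling. *)
HB.instance Definition _ (k : pzRingType) (V : lmodType k) :=
  GRing.Lmodule.on V^c.

Section ConverseAlgebra.
Variables (k : pzRingType) (A : algType k).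

Fact converse_scalerAl (a : k) (u v : A^c) :
  a *: (u * v : A^c) = (a *: u : A^c) * v :> A^c.
Proof. exact: (@scalerAr k A a v u). Qed.

HB.instance Definition _ :=
  GRing.LSemiModule_isLSemiAlgebra.Build k A^c converse_scalerAl.

Fact converse_scalerAr (a : k) (u v : A^c) :
  a *: (u * v : A^c) = u * (a *: v : A^c) :> A^c.
Proof. exact: (@scalerAl k A a v u). Qed.

HB.instance Definition _ :=
  GRing.LSemiAlgebra_isSemiAlgebra.Build k A^c converse_scalerAr.

End ConverseAlgebra.

Section Modules.
Variables (R : pzRingType) (M : lmodType R).

Definition submodule (N : set M) : Prop := GRing.submod_closed [in N].

Definition lspan (s : seq M) : set M :=
  [set x | exists c : nat -> R, x = \sum_(i < size s) c i *: s`_i].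

Definition finitely_generated : Prop := exists s : seq M, lspan s = [set: M].

Definition nonzero_module : Prop := exists m : M, m != 0.

Definition noetherian_module : Prop :=
  forall N : nat -> set M, (forall i, submodule (N i)) ->
    (forall i, N i `<=` N i.+1) ->
    exists n, forall i, (n <= i)%N -> N i = N n.

Definition essential (L : set M) : Prop :=
  submodule L /\
  forall N : set M, submodule N -> N `&` L = [set 0] -> N = [set 0].

(* [Kdim_lt n N' N], for submodules N' `<=` N, means Kdim (N / N') < n. This is
   the Gabriel-Rentschler recursion (with Kdim 0 = -1) at finite ordinals; the
   submodules of N / N' are represented by the submodules between N' and N. *)
Fixpoint Kdim_lt (n : nat) (N' N : set M) : Prop :=
  if n is m.+1 then
    forall C : nat -> set M,
      (forall i, submodule (C i) /\ N' `<=` C i /\ C i `<=` N) ->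
      (forall i, C i.+1 `<=` C i) ->
      exists i0, forall i, (i0 <= i)%N -> Kdim_lt m (C i.+1) (C i)
  else N = N'.

(* Kdim M = n *)
Definition has_Kdim (n : nat) : Prop :=
  Kdim_lt n.+1 [set 0] [set: M] /\ ~ Kdim_lt n [set 0] [set: M].

End Modules.

Arguments finitely_generated {R} M.
Arguments nonzero_module {R} M.
Arguments noetherian_module {R} M.
Arguments has_Kdim {R} M n.

Section Dimension.
Variables (k : fieldType) (V : lmodType k).

Definition lin_independent (s : seq V) : Prop :=
  forall c : nat -> k, \sum_(i < size s) c i *: s`_i = 0 ->
    forall i, (i < size s)%N -> c i = 0.

Definition has_dim (W : set V) (n : nat) : Prop :=
  exists s : seq V, [/\ size s = n, lin_independent s & lspan s = W].

(* junk value 0 if W is infinite-dimensional *)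
Definition dim (W : set V) : nat := xget 0%N [set n | has_dim W n].

End Dimension.

Definition restrict_scalars (k : fieldType) (A : algType k) (M : lmodType A)
  : Type := M.

Section RestrictScalars.
Variables (k : fieldType) (A : algType k) (M : lmodType A).

Local Notation Mk := (restrict_scalars M).

HB.instance Definition _ := GRing.Zmodule.on Mk.

Definition rscale (c : k) (m : Mk) : Mk := (c%:A : A) *: (m : M).

Fact rscaleA a b v : rscale a (rscale b v) = rscale (a * b) v.
Proof. by rewrite /rscale scalerA mulr_algl scalerA. Qed.

Fact rscale1 : left_id 1 rscale.
Proof. by move=> v; rewrite /rscale scale1r; exact: (@scale1r A M). Qed.

Fact rscaleDr : right_distributive rscale +%R.
Proof. by move=> a u v; exact: (@scalerDr A M). Qed.

Fact rscaleDl v : {morph rscale^~ v : a b / a + b}.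
Proof. by move=> a b; rewrite /rscale scalerDl; exact: (@scalerDl A M). Qed.

HB.instance Definition _ :=
  GRing.Zmodule_isLmodule.Build k Mk rscaleA rscale1 rscaleDr rscaleDl.

End RestrictScalars.

Section GelfandKirillov.
Variables (R : realType) (k : fieldType) (A : algType k) (M : lmodType A).

(* With V and F the k-spans of v and f, these elements span
   F + V F + ... + V^n F over k. *)
Fixpoint words (v : seq A) (f : seq M) (n : nat) : seq M :=
  if n is m.+1 then f ++ [seq a *: x | a <- v, x <- words v f m] else f.

Definition growth (v : seq A) (f : seq M) (n : nat) : nat :=
  dim (lspan (words v f n : seq (restrict_scalars M))).

(* sup over finite-dimensional V, F of limsup_n log_n dim (\sum_(i <= n) V^i F);
   as [ln 0 = 0] here, GKdim 0 = 0. *)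
Definition GKdim : \bar R :=
  ereal_sup [set limn_esup (fun n : nat =>
                   (ln (growth vf.1 vf.2 n)%:R / ln n%:R : R)%:E)
            | vf in [set: seq A * seq M]].

End GelfandKirillov.

Definition direct_sum (I : choiceType) (V : zmodType) (V_ : I -> set V) : Prop :=
  (forall x : V, exists (s : seq I) (c : I -> V),
     [/\ uniq s, forall i, V_ i (c i) & x = \sum_(i <- s) c i]) /\
  (forall (s : seq I) (c : I -> V), uniq s -> (forall i, V_ i (c i)) ->
     \sum_(i <- s) c i = 0 -> forall i, i \in s -> c i = 0).

Definition algebra_grading (k : fieldType) (A : algType k) (grA : nat -> set A)
    : Prop :=
  [/\ forall n, submodule (grA n),
      direct_sum grA,
      grA 0%N 1 &
      forall i j a b, grA i a -> grA j b -> grA (i + j)%N (a * b)].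

Definition locally_finite (k : fieldType) (A : algType k) (grA : nat -> set A)
    : Prop :=
  forall n, exists s : seq A, grA n = lspan s.

(* For a right module (A replaced by A^c) the action condition reads
   M_j A_i `<=` M_(i + j). *)
Definition module_grading (A : pzRingType) (grA : nat -> set A)
    (M : lmodType A) (grM : int -> set M) : Prop :=
  [/\ forall n, GRing.zmod_closed [in grM n],
      direct_sum grM &
      forall (i : nat) (j : int) a m,
        grA i a -> grM j m -> grM (i%:Z + j) (a *: m)].

Section Ideals.
Variable R : nzRingType.

Definition left_ideal (I : set R) : Prop := submodule (I : set R^o).
Definition right_ideal (I : set R) : Prop := submodule (I : set (R^c)^o).
Definition twosided_ideal (I : set R) : Prop := left_ideal I /\ right_ideal I.

Definition essential_left_ideal (I : set R) : Prop := essential (I : set R^o).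
Definition essential_right_ideal (I : set R) : Prop :=
  essential (I : set (R^c)^o).

Definition noetherian : Prop :=
  noetherian_module (R^o : lmodType R) /\
  noetherian_module ((R^c)^o : lmodType R^c).

Definition normal_element (a : R) : Prop :=
  [set a * x | x in [set: R]] = [set x * a | x in [set: R]].

(* every element of I is a sum of homogeneous elements of I *)
Definition homogeneous (gr : nat -> set R) (I : set R) : Prop :=
  forall x, I x -> exists (s : seq nat) (c : nat -> R),
    (forall n, gr n (c n) /\ I (c n)) /\ x = \sum_(n <- s) c n.

(* \bigoplus_(n >= 1) R_n *)
Definition irrelevant_ideal (gr : nat -> set R) : set R :=
  [set x | exists (s : seq nat) (c : nat -> R),
     (forall n, gr n (c n)) /\ x = \sum_(n <- s | (0 < n)%N) c n].

End Ideals.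

Arguments noetherian R : clear implicits.

(* MathComp's [idealr] is a proper ideal closed under left multiplication, and
   its ring quotients are only for commutative rings; hence the following
   structure of proper two-sided ideal, with its quotient ring. *)
HB.mixin Record isRightStable (R : nzRingType) (S : R -> bool) := {
  ideal_mulr : forall a u : R, u \in S -> u * a \in S
}.

#[short(type="proper2ideal")]
HB.structure Definition Proper2Ideal (R : nzRingType) :=
  {S of Idealr R S & isRightStable R S}.

Definition set_of_ideal (R : nzRingType) (p : proper2ideal R) : set R :=
  [set x | x \in (p : pred R)].

Section QuotientRing.
Variables (R : nzRingType) (p : proper2ideal R).

Definition quotient_ring : Type := {ideal_quot p}.

Local Notation Q := quotient_ring.

HB.instance Definition _ := GRing.Zmodule.on Q.
HB.instance Definition _ := EqQuotient.on Q.

Definition qone : Q := \pi_Q 1.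
Definition qmul (x y : Q) : Q := \pi_Q (repr x * repr y).

Lemma qpiE (x y : R) : (\pi_Q x = \pi_Q y) <-> (x - y \in (p : pred R)).
Proof. by rewrite Quotient.idealrBE; split=> [->|/eqP]. Qed.

Lemma qmulE (x y : R) : qmul (\pi_Q x) (\pi_Q y) = \pi_Q (x * y).
Proof.
have H z : repr (\pi_Q z) - z \in (p : pred R) by apply/qpiE; rewrite reprK.
apply/qpiE; set x' := repr _; set y' := repr _.
have -> : x' * y' - x * y = x' * (y' - y) + (x' - x) * y.
  by rewrite mulrBr mulrBl addrA subrK.
by apply: rpredD; [apply: idealMr | apply: ideal_mulr]; exact: H.
Qed.

Lemma qaddE (x y : R) : \pi_Q x + \pi_Q y = \pi_Q (x + y).
Proof. by symmetry; exact: (@Quotient.pi_add R p x y). Qed.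

Fact qmulA : associative qmul.
Proof.
move=> x y z; rewrite -[x]reprK -[y]reprK -[z]reprK.
rewrite (qmulE (repr y) (repr z)) (qmulE (repr x) (repr y)).
by rewrite (qmulE (repr x)) (qmulE _ (repr z)) mulrA.
Qed.

Fact qmul1 : left_id qone qmul.
Proof. by move=> x; rewrite -[x]reprK (qmulE 1) mul1r. Qed.

Fact qmulr1 : right_id qone qmul.
Proof. by move=> x; rewrite -[x]reprK (qmulE _ 1) mulr1. Qed.

Fact qmulDl : left_distributive qmul +%R.
Proof.
move=> x y z; rewrite -[x]reprK -[y]reprK -[z]reprK.
rewrite (qaddE (repr x) (repr y)) (qmulE (repr x) (repr z)).
rewrite (qmulE (repr y) (repr z)) (qmulE _ (repr z)).
by rewrite (qaddE (repr x * repr z)) mulrDl.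
Qed.

Fact qmulDr : right_distributive qmul +%R.
Proof.
move=> x y z; rewrite -[x]reprK -[y]reprK -[z]reprK.
rewrite (qaddE (repr y) (repr z)) (qmulE (repr x) (repr y)).
rewrite (qmulE (repr x) (repr z)) (qmulE (repr x)).
by rewrite (qaddE (repr x * repr y)) mulrDr.
Qed.

Fact qone_neq0 : qone != 0.
Proof.
apply/eqP; have -> : 0 = \pi_Q 0 by exact: (esym (@pi_zeror _ _ _ _ _ {ideal_quot p})).
by move/qpiE; rewrite subr0 idealr1.
Qed.

HB.instance Definition _ := GRing.Zmodule_isNzRing.Build Q
  qmulA qmul1 qmulr1 qmulDl qmulDr qone_neq0.

Definition quotient_map (x : R) : Q := \pi_Q x.

Definition quotient_grading (gr : nat -> set R) (n : nat) : set Q :=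
  quotient_map @` gr n.

End QuotientRing.

Section GradedPrimes.
Variable R : nzRingType.

Definition prime_ideal (p : proper2ideal R) : Prop :=
  forall I J : set R, twosided_ideal I -> twosided_ideal J ->
    (forall x y, I x -> J y -> set_of_ideal p (x * y)) ->
    I `<=` set_of_ideal p \/ J `<=` set_of_ideal p.

Definition graded_prime (gr : nat -> set R) (p : proper2ideal R) : Prop :=
  prime_ideal p /\ homogeneous gr (set_of_ideal p).

Definition graded_bounded (gr : nat -> set R) : Prop :=
  forall L : set R, homogeneous gr L ->
    essential_left_ideal L \/ essential_right_ideal L ->
    exists J : set R,
      [/\ twosided_ideal J, homogeneous gr J, J <> [set 0] & J `<=` L].

End GradedPrimes.

Definition graded_FBN (R : nzRingType) (gr : nat -> set R) : Prop :=
  noetherian R /\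
  forall p : proper2ideal R, graded_prime gr p ->
    graded_bounded (quotient_grading (p := p) gr).

Definition enough_normal_elements (R : nzRingType) (gr : nat -> set R) : Prop :=
  forall p : proper2ideal R, graded_prime gr p ->
    ~ irrelevant_ideal gr `<=` set_of_ideal p ->
    exists (n : nat) (a : quotient_ring p),
      [/\ (0 < n)%N, quotient_grading gr n a, a != 0 & normal_element a].

(* Main.v *)
(* Write GK for the exponent of growth of the Hilbert function. By noetherian
   induction on the annihilator one reduces to modules which are faithful over
   A / I with I graded prime, and then one exhibits an injective self-map f of
   positive degree, semilinear enough to act on the lattice of submodules, with
   N / f(N) annihilated by an ideal larger than I. Summing Hilbert functions
   gives GK N = GK (N / f(N)) + 1, and the chain of the f^i(N) gives
   Kdim N >= Kdim (N / f(N)) + 1. With enough normal elements, f is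
   multiplication by a normal element, and Kdim N <= Kdim (N / f(N)) + 1 by the
   usual argument on preimages under powers of f. In the FBN case N is a uniform
   graded left ideal U modulo I and f is right multiplication by an element
   of U; every proper quotient U / K is annihilated by a larger ideal and, as K
   contains a shifted copy of U, has GK at most GK U - 1, whence the bound on
   Kdim U. Ungraded submodules are handled through their leading components:
   N |-> lead N is a strictly increasing map to graded submodules. *)
From HB Require Import structures.
Require Import Defs.
From mathcomp Require Import all_boot all_order all_algebra.
From mathcomp Require Import ring_quotient zify.
From mathcomp Require Import all_classical all_reals all_analysis.
Set Implicit Arguments.
Unset Strict Implicit.
Unset Printing Implicit Defensive.
Import GRing.Theory.
Local Open Scope classical_set_scope.
Local Open Scope ring_scope.
Local Open Scope quotient_scope.

(** * Deviation of preorders *)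

(** The induction forms no quotient module or quotient ring: a subquotient is a pair of submodules
    N' and N of a fixed module, dimension and injectivity are taken modulo N', and conditions on A /
    I are read in A modulo I. Krull dimension is the deviation of a preorder, so one comparison
    lemma serves all submodules, graded submodules, pairs (for extensions) and sequences (for
    preimages under powers of f). The invariant is that the Hilbert function lies between two
    multiples of n^d and that the Krull dimension is the same d. It passes to extensions, where both
    become a maximum, and in the FBN case it turns an estimate of Hilbert functions into a bound on
    Kdim (U / K). Upper bounds on Krull dimension are proved with homogeneous elements, so they are
    kept for graded submodules only and transferred once, at the end. A finitely generated graded
    module is bounded below, hence degrees can be moved into [nat], where induction on the degree is
    available. Right modules are left modules over [A^c], and the hypotheses are symmetric enough to
    be carried over. *)

Section Deviation.
Variables (T : Type) (P : T -> Prop) (le : T -> T -> Prop).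

(** The recursion of [Kdim_lt] for the members [P] of a preorder. The base case asks [le b a]
    instead of an equality, so that pairs and sequences of sets need no extensionality. *)
Fixpoint dev_lt (n : nat) (a b : T) : Prop :=
  if n is m.+1 then
    forall C : nat -> T, (forall i, P (C i) /\ le a (C i) /\ le (C i) b) ->
      (forall i, le (C i.+1) (C i)) ->
      exists i0, forall i, (i0 <= i)%N -> dev_lt m (C i.+1) (C i)
  else le b a.

Hypothesis le_trans : forall x y z, le x y -> le y z -> le x z.

Lemma dev_ltW n a b : dev_lt n a b -> dev_lt n.+1 a b.
Proof.
elim: n a b => [|n IH] a b.
  move=> ba C CP _; exists 0%N => i _ /=.
  have [_ [_ h1]] := CP i; have [_ [h2 _]] := CP i.+1.
  exact: le_trans (le_trans h1 ba) h2.
move=> H C CP Cd; have [i0 Hi0] := H C CP Cd.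
by exists i0 => i /Hi0; apply: IH.
Qed.

Lemma dev_lt_leq n m a b : (n <= m)%N -> dev_lt n a b -> dev_lt m a b.
Proof.
move=> /subnKC <-; elim: (m - n)%N => [|j IH]; first by rewrite addn0.
by move=> /IH; rewrite addnS; apply: dev_ltW.
Qed.

Lemma dev_lt_eq n a b : le b a -> dev_lt n a b.
Proof. by move=> ba; apply: (@dev_lt_leq 0). Qed.

Lemma dev_lt_sub n a b a' b' :
  le a a' -> le b' b -> dev_lt n a b -> dev_lt n a' b'.
Proof.
case: n => [|n] aa' bb' /=.
  by move=> ba; apply: le_trans bb' (le_trans ba aa').
move=> H C CP Cd; apply: H => // i; have [h1 [h2 h3]] := CP i.
by split=> //; split; [exact: le_trans h2|exact: le_trans bb'].
Qed.

Lemma le_chain (C : nat -> T) :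
  (forall x, le x x) ->
  (forall i, le (C i) (C i.+1)) -> forall i j, (i <= j)%N -> le (C i) (C j).
Proof.
move=> le_refl Cd i j /subnKC <-; elim: (j - i)%N => [|n IH].
  by rewrite addn0.
by rewrite addnS; apply: le_trans IH _.
Qed.

End Deviation.

Section DevMap.
Variables (T T' : Type) (P : T -> Prop) (P' : T' -> Prop).
Variables (le : T -> T -> Prop) (le' : T' -> T' -> Prop) (f : T -> T').
Hypothesis le_refl : forall x, le x x.
Hypothesis le_trans : forall x y z, le x y -> le y z -> le x z.
Hypothesis le_trans' : forall x y z, le' x y -> le' y z -> le' x z.

(** A strictly increasing map cannot lower the deviation. Order has to be reflected only between
    comparable elements, which is all that leading submodules, or the pair of an intersection and a
    sum, provide. *)
Lemma dev_lt_map n a b a' b' : P a -> P b -> le a b ->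
  (forall x, P x -> le a x -> le x b ->
     [/\ P' (f x), le' a' (f x) & le' (f x) b']) ->
  (forall x y, P x -> P y -> le a x -> le x y -> le y b -> le' (f x) (f y)) ->
  (forall x y, P x -> P y -> le a x -> le x y -> le y b -> le' (f y) (f x) ->
     le y x) ->
  dev_lt P' le' n a' b' -> dev_lt P le n a b.
Proof.
elim: n a b a' b' => [|n IH] a b a' b' Pa Pb ab Hf Hm Hr.
  move=> /= ba.
  have [_ h1 _] := Hf a Pa (le_refl a) ab.
  have [_ _ h2] := Hf b Pb ab (le_refl b).
  apply: (Hr a b) => //; exact: le_trans' h2 (le_trans' ba h1).
move=> H C CP Cd.
have [|i|i0 Hi0] := H (f \o C).
- by move=> i /=; have [h1 [h2 h3]] := CP i; have [? ? ?] := Hf _ h1 h2 h3.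
- have [h1 [h2 h3]] := CP i; have [h1' [h2' h3']] := CP i.+1.
  exact: Hm.
exists i0 => i /Hi0 /= Hi.
have [h1 [h2 h3]] := CP i; have [h1' [h2' h3']] := CP i.+1.
apply: IH Hi => //.
- move=> x Px x1 x2; have ax := le_trans h2' x1; have xb := le_trans x2 h3.
  by have [? _ _] := Hf _ Px ax xb; split=> //; apply: Hm.
- move=> x y Px Py x1 xy y2; apply: Hm => //; first exact: le_trans x1.
  exact: le_trans h3.
- move=> x y Px Py x1 xy y2; apply: Hr => //; first exact: le_trans x1.
  exact: le_trans h3.
Qed.

(** The deviation of a product is the larger of the two: beyond the larger of the two indices, both
    coordinate chains have small factors. *)
Lemma dev_lt_prod n a b a' b' : dev_lt P le n a b -> dev_lt P' le' n a' b' ->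
  dev_lt (fun x : T * T' => P x.1 /\ P' x.2)
    (fun x y => le x.1 y.1 /\ le' x.2 y.2) n (a, a') (b, b').
Proof.
elim: n a b a' b' => [|n IH] a b a' b' //= H H' C CP Cd.
have [|i|i0 Hi0] := H (fun i => (C i).1).
- by move=> i; have [[? ?] [[? ?] [? ?]]] := CP i.
- by have [] := Cd i.
have [|i|i1 Hi1] := H' (fun i => (C i).2).
- by move=> i; have [[? ?] [[? ?] [? ?]]] := CP i.
- by have [] := Cd i.
exists (maxn i0 i1) => i; rewrite geq_max => /andP[/Hi0 h0 /Hi1 h1].
by rewrite [C i.+1]surjective_pairing [C i]surjective_pairing; apply: IH.
Qed.

End DevMap.

(** * Increasing stationary sequences: the lattice form of passing from L to L[t] *)

Section StableSequences.
Variables (T : Type) (P : T -> Prop) (le : T -> T -> Prop).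
Hypothesis le_refl : forall x, le x x.
Hypothesis le_trans : forall x y z, le x y -> le y z -> le x z.

(** For a noetherian module L and the submodules of L, these are the graded submodules of L[t]: the
    coefficients at t^j form an increasing sequence of submodules, which becomes stationary. *)
Definition stable_seq (s : nat -> T) : Prop :=
  [/\ forall j, P (s j), forall j, le (s j) (s j.+1) &
      exists J, forall j, le (s j) (s J)].

Definition le_seq (s t : nat -> T) : Prop := forall j, le (s j) (t j).

Let leS_refl s : le_seq s s. Proof. by []. Qed.
Let leS_trans s t u : le_seq s t -> le_seq t u -> le_seq s u.
Proof. by move=> st tu j; apply: le_trans (st j) (tu j). Qed.

(** Induction on J. Splitting off the first term embeds the sequences into pairs of a head, whose
    deviation is below m between p and q, and a tail that enters the range from p' to q' one step
    earlier. *)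
Lemma dev_lt_stable_seq_tail m p q p' q' :
  (forall u v, stable_seq u -> stable_seq v -> le_seq u v ->
     (forall j, le p' (u j)) -> (forall j, le (v j) q') ->
     dev_lt stable_seq le_seq m u v) ->
  dev_lt P le m p q ->
  forall J u v, stable_seq u -> stable_seq v -> le_seq u v ->
    (forall j, le p (u j)) -> (forall j, le (v j) q) ->
    (forall j, (J <= j)%N -> le p' (u j)) ->
    (forall j, (J <= j)%N -> le (v j) q') ->
    dev_lt stable_seq le_seq m u v.
Proof.
move=> IH pq; elim=> [|J IHJ] u v Su Sv uv pu vq p'u vq'.
  by apply: IH => // j; [apply: p'u|apply: vq'].
pose sh (s : nat -> T) := fun j => s j.+1.
have Ssh s : stable_seq s -> stable_seq (sh s).
  case=> h1 h2 [K hK]; split=> [j|j|]; [exact: h1|exact: h2|].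
  by exists K => j; apply: le_trans (hK _) (h2 _).
pose f (s : nat -> T) := (s 0%N, sh s).
apply: (@dev_lt_map _ _ _ (fun x : T * (nat -> T) => P x.1 /\ stable_seq x.2)
  _ (fun x y => le x.1 y.1 /\ le_seq x.2 y.2) f _ _ _ m u v
  (u 0%N, sh u) (v 0%N, sh v)) => //.
- move=> x y z [h1 h2] [h3 h4]; split; first exact: le_trans h1 h3.
  exact: leS_trans h2 h4.
- move=> x Sx ux xv; split=> /=.
  + by split; [case: Sx|apply: Ssh].
  + by split=> // j; apply: ux.
  + by split=> // j; apply: xv.
- by move=> x y Sx Sy ux xy yv; split=> [|j]; apply: xy.
- move=> x y Sx Sy ux xy yv [h1 h2] [|j] //; exact: h2.
apply: dev_lt_prod.
  by apply: dev_lt_sub pq => //.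
apply: IHJ; try exact: Ssh.
- by move=> j; apply: uv.
- by move=> j; apply: pu.
- by move=> j; apply: vq.
- by move=> j Jj; apply: p'u.
- by move=> j Jj; apply: vq'.
Qed.

(** The lattice form of Kdim L[t] <= Kdim L + 1. Along a descending chain of sequences the
    stationary values descend too, so the factors between them eventually have smaller deviation and
    the induction hypothesis covers the tails; the finitely many earlier terms stay between p and
    q. *)
Lemma dev_lt_stable_seq m p q u v :
  dev_lt P le m p q -> stable_seq u -> stable_seq v -> le_seq u v ->
  (forall j, le p (u j)) -> (forall j, le (v j) q) ->
  dev_lt stable_seq le_seq m.+1 u v.
Proof.
elim: m p q u v => [|m IH] p q u v pq Su Sv uv pu vq.
  apply: dev_lt_eq => // j; apply: le_trans (vq j) _.
  exact: le_trans pq (pu j).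
move=> C CP Cd.
have /choice[J HJ] i : exists J, forall j, le (C i j) (C i J).
  by have [[_ _ ?] _] := CP i.
have Cmono i j j' : (j <= j')%N -> le (C i j) (C i j').
  by have [[_ h _] _] := CP i; apply: (le_chain le_trans le_refl h).
pose l i := C i (J i).
have [i|i|i0 Hi0] := pq l.
- have [[h1 _ _] [h2 h3]] := CP i; split; [exact: h1|split].
    exact: le_trans (pu _) (h2 _).
  exact: le_trans (h3 _) (vq _).
- exact: le_trans (Cd i (J i.+1)) (HJ i _).
exists i0 => i /Hi0 Hi.
have [S1 [h2 h3]] := CP i; have [S1' [h2' h3']] := CP i.+1.
(* From [J i.+1] on, [C i.+1] has reached its stationary value, and [C i] never exceeds its own. *)
apply: (@dev_lt_stable_seq_tail m.+1 p q (l i.+1) (l i) _ _ (J i.+1)) => //.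
- by move=> u' v' Su' Sv' uv' pu' vq'; exact: (IH _ _ _ _ Hi Su' Sv' uv' pu' vq').
- by move=> j; apply: le_trans (pu _) (h2' _).
- by move=> j; apply: le_trans (h3 _) (vq _).
- by move=> j Jj; apply: Cmono.
Qed.

End StableSequences.

(** * Submodules *)

Section Submodules.
Variables (R : pzRingType) (M : lmodType R).
Implicit Types N P Q : set M.

Lemma submoduleP N : submodule N <->
  N 0 /\ forall a x y, N x -> N y -> N (a *: x + y).
Proof.
split=> [[h0 h]|[h0 h]].
  by split=> [|a x y Nx Ny]; apply/set_mem; [|apply: h; apply: mem_set].
split; first exact: mem_set.
by move=> a x y /set_mem Nx /set_mem Ny; apply/mem_set/h.
Qed.

Lemma submod0 N : submodule N -> N 0.
Proof. by case/submoduleP. Qed.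

Lemma submodD N x y : submodule N -> N x -> N y -> N (x + y).
Proof. by case/submoduleP=> _ h Nx Ny; rewrite -[x]scale1r; apply: h. Qed.

Lemma submodZ N a x : submodule N -> N x -> N (a *: x).
Proof. by case/submoduleP=> h0 h Nx; rewrite -[_ *: _]addr0; apply: h. Qed.

Lemma submodN N x : submodule N -> N x -> N (- x).
Proof. by move=> sN Nx; rewrite -scaleN1r; apply: submodZ. Qed.

Lemma submodB N x y : submodule N -> N x -> N y -> N (x - y).
Proof. by move=> sN Nx Ny; apply: submodD => //; apply: submodN. Qed.

Lemma submod_sum N (I : Type) (r : seq I) (P : pred I) (F : I -> M) :
  submodule N -> (forall i, P i -> N (F i)) -> N (\sum_(i <- r | P i) F i).
Proof.
move=> sN NF; apply: (big_ind N) => //; first exact: submod0.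
by move=> x y; apply: submodD.
Qed.

Lemma submoduleI N Q : submodule N -> submodule Q -> submodule (N `&` Q).
Proof.
move=> sN sQ; apply/submoduleP; split; first by split; apply: submod0.
by move=> a x y [? ?] [? ?]; split; apply: submodD => //; apply: submodZ.
Qed.

Definition sum_set N Q : set M := [set x + y | x in N & y in Q].

Lemma submodule_sum N Q : submodule N -> submodule Q -> submodule (sum_set N Q).
Proof.
move=> sN sQ; apply/submoduleP; split.
  by exists 0; [exact: submod0|exists 0; [exact: submod0|rewrite addr0]].
move=> a _ _ [x Nx [y Qy <-]] [x' Nx' [y' Qy' <-]].
exists (a *: x + x'); first by apply: submodD => //; apply: submodZ.
exists (a *: y + y'); first by apply: submodD => //; apply: submodZ.
by rewrite scalerDr addrACA.
Qed.

Lemma sum_setl N Q : submodule Q -> N `<=` sum_set N Q.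
Proof.
by move=> sQ x Nx; exists x => //; exists 0; [exact: submod0|rewrite addr0].
Qed.

Lemma sum_setr N Q : submodule N -> Q `<=` sum_set N Q.
Proof.
by move=> sQ x Nx; exists 0; [exact: submod0|exists x => //; rewrite add0r].
Qed.

Lemma submodule_set0 : submodule [set (0 : M)].
Proof. by apply/submoduleP; split=> // a x y -> ->; rewrite scaler0 addr0. Qed.

Lemma submodule_setT : submodule [set: M].
Proof. by apply/submoduleP. Qed.

Lemma Kdim_lt_dev n N' N : N' `<=` N ->
  Kdim_lt n N' N <-> dev_lt (@submodule R M) subset n N' N.
Proof.
elim: n N' N => [|n IH] N' N N'N /=.
  by split=> [-> //|NN']; apply/seteqP; split.
split=> H C CP Cd; have [i0 Hi0] := H C CP Cd; exists i0 => i /Hi0;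
  by move/(IH _ _ (Cd i)).
Qed.

Lemma noetherian_max (F : set M -> Prop) : noetherian_module M ->
  (forall N, F N -> submodule N) -> (exists N, F N) ->
  exists2 N, F N & forall Q, F Q -> N `<=` Q -> Q `<=` N.
Proof.
move=> noeM FS [N0 FN0]; apply: contrapT => nomax.
have step N : exists Q, F N -> [/\ F Q, N `<=` Q & ~ Q `<=` N].
  case: (pselect (F N)) => FN; last by exists N.
  apply: contrapT => h; apply: nomax; exists N => // Q FQ NQ.
  by apply: contrapT => nQN; apply: h; exists Q.
have [nx Hnx] := choice step.
pose C n := iter n nx N0.
have FC n : F (C n).
  by elim: n => //= n /Hnx[].
have SC i : submodule (C i) by exact: FS.
have incC i : C i `<=` C i.+1 by have [] := Hnx _ (FC i).
have [n Hn] := noeM C SC incC.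
have [_ _ nC] := Hnx _ (FC n); apply: nC.
by have : C n.+1 `<=` C n by rewrite Hn.
Qed.

End Submodules.

Lemma lspan_cons (R : pzRingType) (M : lmodType R) (x : M) (s : seq M) y :
  lspan (x :: s) y <-> exists a z, lspan s z /\ y = a *: x + z.
Proof.
split=> [[c ->]|[a [z [[c ->] ->]]]].
  exists (c 0%N), (\sum_(i < size s) c i.+1 *: s`_i); split.
    by exists (fun i => c i.+1).
  by rewrite /= big_ord_recl.
by exists (fun i => if i is j.+1 then c j else a); rewrite /= big_ord_recl.
Qed.

Lemma lspan_sub (R : pzRingType) (M : lmodType R) (s : seq M) :
  submodule (lspan s).
Proof.
apply/submoduleP; split.
  by exists (fun=> 0); rewrite big1 // => i _; rewrite scale0r.
move=> a _ _ [c ->] [d ->]; exists (fun i => a * c i + d i).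
rewrite scaler_sumr -big_split; apply: eq_bigr => i _.
by rewrite scalerDl scalerA.
Qed.

Lemma lspan_mem (R : pzRingType) (M : lmodType R) (s : seq M) x :
  x \in s -> lspan s x.
Proof.
elim: s => // y s IH; rewrite inE lspan_cons => /orP[/eqP ->|/IH sx].
  exists 1, 0; split; last by rewrite scale1r addr0.
  exact: submod0 (lspan_sub s).
by exists 0, x; split=> //; rewrite scale0r add0r.
Qed.

Lemma lspan_min (R : pzRingType) (M : lmodType R) (s : seq M) N :
  submodule N -> (forall x, x \in s -> N x) -> lspan s `<=` N.
Proof.
move=> sN sub _ [c ->]; apply: submod_sum => // i _.
by apply: submodZ => //; apply/sub/mem_nth.
Qed.

(** Induction on the generators: among nested submodules, each is determined by its intersection
    with the span of s and by the left ideal of the coefficients at x. *)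
Lemma noetherian_fg (R : nzRingType) (M : lmodType R) :
  noetherian_module (R^o : lmodType R) -> finitely_generated M ->
  noetherian_module M.
Proof.
move=> noeR [s sM].
suff H : forall N : nat -> set M, (forall i, submodule (N i)) ->
    (forall i, N i `<=` N i.+1) -> (forall i, N i `<=` lspan s) ->
    exists n, forall i, (n <= i)%N -> N i = N n.
  by move=> N sN incN; apply: H => // i x _; rewrite sM.
elim: s {sM} => [|x s IH] N sN incN Ns.
  exists 0%N => i _; apply/seteqP; split=> y /Ns [c ->]; rewrite /= big_ord0;
  exact: submod0.
have lsN i : submodule ((N i) `&` lspan s).
  by apply: submoduleI => //; apply: lspan_sub.
have [i y [Ny sy]|i y []|n1 Hn1] := IH (fun i => N i `&` lspan s) lsN; rewrite //.
  by split=> //; apply: incN.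
pose L i : set R^o := [set a | exists2 z, lspan s z & N i (a *: x + z)].
have sL i : submodule (L i).
  apply/submoduleP; split.
    exists 0; first exact: submod0 (lspan_sub s).
    by rewrite scale0r addr0; apply: submod0.
  move=> a b c [z sz Nz] [w sw Nw]; exists (a *: z + w).
    by apply: submodD => //; [exact: lspan_sub|apply: submodZ => //; exact: lspan_sub].
  suff -> : (a *: b + c) *: x + (a *: z + w) = a *: (b *: x + z) + (c *: x + w).
    by apply: submodD => //; apply: submodZ.
  by rewrite scalerDr scalerDl scalerA addrACA.
have [|n2 Hn2] := noeR L sL.
  by move=> i a [z sz Nz]; exists z => //; apply: incN.
exists (maxn n1 n2) => i; rewrite geq_max => /andP[n1i n2i].
set n := maxn _ _.
have Nmono a b : (a <= b)%N -> N a `<=` N b.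
  apply: (@le_chain _ (@subset M)) incN a b.
    by move=> X Y Z XY YZ w /XY /YZ.
  by move=> X w.
have E1 : N i `&` lspan s = N n `&` lspan s.
  by rewrite (Hn1 i) // (Hn1 n) // leq_maxl.
have E2 : L i = L n by rewrite (Hn2 i) // (Hn2 n) // leq_maxr.
have key u v : N u `&` lspan s = N v `&` lspan s -> L u = L v ->
    (v <= u)%N -> N u `<=` N v.
  move=> e1 e2 vu y Ny; have [a [z [sz yE]]] := (lspan_cons x s y).1 (Ns u y Ny).
  have : L u a by exists z; rewrite -?yE.
  rewrite e2 => -[w sw Nw]; rewrite yE -[a *: x + z](subrK (a *: x + w)).
  apply: submodD => //.
  have : (N u `&` lspan s) (a *: x + z - (a *: x + w)).
    split; first by apply: submodB => //; rewrite -?yE //; apply: Nmono Nw.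
    rewrite opprD addrACA subrr add0r; apply: submodB => //; exact: lspan_sub.
  by rewrite e1 => -[].
have [ni|/ltnW ni] := leqP n i.
  by apply/seteqP; split; [exact: key|exact: Nmono].
by apply/seteqP; split; [exact: Nmono|exact: key].
Qed.

(** * Relative dimension *)

Section RelativeDimension.
Variables (k : fieldType) (V : lmodType k).
Implicit Types (W : set V) (s t : nat -> V).

Definition rindep W' n s : Prop :=
  forall c : nat -> k, W' (\sum_(i < n) c i *: s i) ->
  forall i, (i < n)%N -> c i = 0.

Definition rspan W' n s W : Prop :=
  forall x, W x -> exists c : nat -> k, W' (x - \sum_(i < n) c i *: s i).

(** For subspaces, the dimension of W modulo its intersection with W', taken without a quotient
    space. *)
Definition has_rdim W' W n : Prop :=
  exists s, [/\ forall i, (i < n)%N -> W (s i), rindep W' n s & rspan W' n s W].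

(** Steinitz by rank: a row of the left kernel of the coefficient matrix is a linear relation
    between the [t i] modulo W', hence zero, so the matrix has full row rank. *)
Lemma rindep_leq_rspan W' W n m s t : submodule W' -> rindep W' n t ->
  (forall i, (i < n)%N -> W (t i)) -> rspan W' m s W -> (n <= m)%N.
Proof.
move=> sW' It Wt Ss.
have /choice[c Hc] (i : 'I_n) := Ss _ (Wt i (ltn_ord i)).
pose B := \matrix_(i < n, j < m) c i j.
suff : row_free B by move/eqP <-; apply: rank_leq_col.
rewrite -kermx_eq0; apply/eqP/row_matrixP => r; rewrite row0.
set u := row r _.
have uB : u *m B = 0 by rewrite /u -row_mul mulmx_ker row0.
pose d j : k := if insub j is Some i then u 0 i else 0.
have dE (i : 'I_n) : d i = u 0 i by rewrite /d valK.
have : W' (\sum_(i < n) d i *: t i).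
  have -> : \sum_(i < n) d i *: t i =
      \sum_(i < n) d i *: (t i - \sum_(j < m) c i j *: s j).
    under [RHS]eq_bigr do rewrite scalerBr scaler_sumr.
    rewrite sumrB exchange_big /= [X in _ - X]big1 ?subr0 // => j _.
    under eq_bigr do rewrite scalerA.
    rewrite -scaler_suml; move/matrixP/(_ 0 j): uB; rewrite mxE [RHS]mxE.
    under eq_bigr do rewrite [B _ _]mxE -dE.
    by move=> ->; rewrite scale0r.
  by apply: submod_sum => // i _; apply: submodZ.
move=> /It d0; apply/rowP => i; rewrite [RHS]mxE -dE; exact: d0.
Qed.

Lemma has_rdim_uniq W' W n m : submodule W' ->
  has_rdim W' W n -> has_rdim W' W m -> n = m.
Proof.
move=> sW' [s [h1 h2 h3]] [t [h1' h2' h3']]; apply/eqP; rewrite eqn_leq.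
by rewrite (rindep_leq_rspan sW' h2 h1 h3') (rindep_leq_rspan sW' h2' h1' h3).
Qed.

(** A largest independent family works: its size is bounded by m, and an element outside its span
    would enlarge it. *)
Lemma has_rdim_exists W' W m s : submodule W' -> submodule W ->
  rspan W' m s W -> exists2 n, (n <= m)%N & has_rdim W' W n.
Proof.
move=> sW' sW Ss.
pose Q n := `[< exists t, rindep W' n t /\ forall i, (i < n)%N -> W (t i) >].
have Q0 : exists n, Q n by exists 0%N; apply/asboolP; exists (fun=> 0).
have Qm n : Q n -> (n <= m)%N.
  by case/asboolP=> t [It Wt]; exact: (rindep_leq_rspan sW' It Wt Ss).
case: (ex_maxnP Q0 Qm) => n Qn maxn; exists n; first exact: Qm.
move/asboolP: Qn => [t [It Wt]]; exists t; split=> // x Wx.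
apply: contrapT => nx.
suff /maxn : Q n.+1 by rewrite ltnn.
apply/asboolP; exists (fun i => if (i < n)%N then t i else x); split.
  move=> c; rewrite big_ord_recr /= ltnn.
  under eq_bigr do rewrite ltn_ord.
  move=> H; have cn0 : c n = 0.
    apply: contrapT => /eqP cn; apply: nx.
    exists (fun i => - (c n)^-1 * c i).
    under eq_bigr do rewrite -scalerA.
    rewrite -scaler_sumr scaleNr opprK addrC.
    rewrite -[x in _ + x]scale1r -(mulVf cn) -scalerA -scalerDr.
    exact: submodZ.
  move=> i; rewrite ltnS leq_eqVlt => /orP[/eqP -> //|]; apply: It.
  by move: H; rewrite cn0 scale0r addr0.
by move=> i _; case: ifP => // /Wt.
Qed.

Lemma has_rdim_add W0 W1 W2 n m : submodule W1 -> W0 `<=` W1 -> W1 `<=` W2 ->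
  has_rdim W0 W1 n -> has_rdim W1 W2 m -> has_rdim W0 W2 (n + m).
Proof.
move=> sW1 W01 W12 [s [Ws Is Ss]] [t [Wt It St]].
pose r i := if (i < n)%N then s i else t (i - n)%N.
have rE (c : nat -> k) : \sum_(i < n + m) c i *: r i =
    \sum_(i < n) c i *: s i + \sum_(i < m) c (n + i)%N *: t i.
  rewrite big_split_ord /=; congr (_ + _); apply: eq_bigr => i _.
    by rewrite /r ltn_ord.
  by rewrite /r ltnNge leq_addr /= addKn.
exists r; split.
- move=> i inm; rewrite /r; case: ltnP => ni; first by apply/W12/Ws.
  by apply: Wt; lia.
- move=> c; rewrite rE => H.
  have W1s : W1 (\sum_(i < n) c i *: s i).
    by apply: submod_sum => // i _; apply: submodZ => //; apply: Ws.
  have ct0 : forall i, (i < m)%N -> c (n + i)%N = 0.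
    apply: (It (fun i => c (n + i)%N)).
    rewrite -[X in W1 X](addKr (\sum_(i < n) c i *: s i)) addrC.
    by apply: submodB => //; apply: W01.
  move: H; rewrite [X in _ + X]big1 => [|i _]; last first.
    by rewrite ct0 // scale0r.
  rewrite addr0 => /Is cs0 i inm; case: (ltnP i n) => ni; first exact: cs0.
  by rewrite -(subnKC ni) ct0 //; lia.
- move=> x /St[c W1x]; have [d Hd] := Ss _ W1x.
  pose e i := if (i < n)%N then d i else c (i - n)%N; exists e; rewrite rE.
  have -> : \sum_(i < n) e i *: s i = \sum_(i < n) d i *: s i.
    by apply: eq_bigr => i _; rewrite /e ltn_ord.
  have -> : \sum_(i < m) e (n + i)%N *: t i = \sum_(i < m) c i *: t i.
    by apply: eq_bigr => i _; rewrite /e ltnNge leq_addr /= addKn.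
  by rewrite opprD addrA addrAC.
Qed.

End RelativeDimension.

(** The hypotheses make f an isomorphism from W / W' to Z / Z'. *)
Lemma has_rdim_map (k : fieldType) (V V' : lmodType k) (f : V -> V')
    (W' W : set V) (Z' Z : set V') n :
  (forall x y, f (x + y) = f x + f y) ->
  (forall c x, f (c *: x) = c *: f x) ->
  submodule W -> submodule Z' ->
  (forall x, W' x -> Z' (f x)) ->
  (forall x, W x -> Z' (f x) -> W' x) ->
  (forall x, W x -> Z (f x)) ->
  (forall z, Z z -> exists2 x, W x & Z' (z - f x)) ->
  has_rdim W' W n -> has_rdim Z' Z n.
Proof.
move=> fD fZ sW sZ' h1 h2 h3 h4 [s [Ws Is Ss]].
have f0 : f 0 = 0 by rewrite -[0](scale0r 0) fZ scale0r.
have fS m (c : nat -> k) :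
    f (\sum_(i < m) c i *: s i) = \sum_(i < m) c i *: f (s i).
  by elim/big_rec2: _ => // i y1 y2 _ <-; rewrite fD fZ.
exists (f \o s); split.
- by move=> i /Ws/h3.
- move=> c; rewrite -fS => /h2 H; apply: Is; apply: H.
  by apply: submod_sum => // i _; apply: submodZ => //; apply: Ws.
- move=> z /h4[x /Ss[c Hc] Zz]; exists c; rewrite -fS.
  rewrite -[z](subrK (f x)) -addrA; apply: submodD => //.
  have -> : f x - f (\sum_(i < n) c i *: s i) = f (x - \sum_(i < n) c i *: s i).
    by rewrite fD -[in RHS]scaleN1r fZ scaleN1r.
  exact: h1.
Qed.

Lemma has_dimE (k : fieldType) (V : lmodType k) (W : set V) n :
  submodule W -> has_dim W n <-> has_rdim [set 0] W n.
Proof.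
move=> sW; split=> [[s [<- Is <-]]|[s [Ws Is Ss]]].
  exists (fun i => s`_i); split.
  - by move=> i si; apply/lspan_mem/mem_nth.
  - exact: Is.
  - by move=> x [c ->]; exists c; rewrite subrr.
exists (mkseq s n); have sE (c : nat -> k) :
  \sum_(i < size (mkseq s n)) c i *: (mkseq s n)`_i = \sum_(i < n) c i *: s i.
  by rewrite size_mkseq; apply: eq_bigr => i _; rewrite nth_mkseq.
split; first by rewrite size_mkseq.
- by move=> c; rewrite sE size_mkseq => /Is.
- apply/seteqP; split=> x.
    case=> c ->; rewrite sE; apply: submod_sum => // i _.
    by apply: submodZ => //; apply: Ws.
  by case/Ss=> c /eqP; rewrite subr_eq0 => /eqP xE; exists c; rewrite sE.
Qed.

(** * Gradings given by projections *)

(** Projections turn homogeneity into closure under maps. Degrees lie in [nat]; a shift brings any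
    grading that is bounded below into this form. *)
Record graded_module (A : pzRingType) (prA : nat -> A -> A) (M : lmodType A)
    (pr : nat -> M -> M) : Prop := GradedModule {
  prD : forall n x y, pr n (x + y) = pr n x + pr n y;
  pr_pr : forall n m x, pr n (pr m x) = if n == m then pr m x else 0;
  pr_fin : forall x, exists b, x = \sum_(i < b) pr i x;
  pr_act : forall n i j a x,
    pr n (prA i a *: pr j x) = if n == (i + j)%N then prA i a *: pr j x else 0
}.

(** [pr_scalar] places the scalars in degree 0, which makes the projections of graded modules linear
    over k. *)
Record graded_algebra (k : fieldType) (A : algType k) (prA : nat -> A -> A)
    : Prop := GradedAlgebra {
  graded_regular :> graded_module prA (prA : nat -> A^o -> A^o);
  pr_scalar : forall c : k, prA 0%N (c%:A) = c%:A
}.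

Section Graded.
Variables (k : fieldType) (A : algType k) (prA : nat -> A -> A).
Hypothesis gA : graded_algebra prA.
Variables (M : lmodType A) (pr : nat -> M -> M).
Hypothesis gM : graded_module prA pr.
Local Notation Mk := (restrict_scalars M).
Implicit Types (N P Q X : set M).

Lemma pr0 n : pr n 0 = 0.
Proof. by apply: (addrI (pr n 0)); rewrite -(prD gM) !addr0. Qed.

Lemma prN n x : pr n (- x) = - pr n x.
Proof. by apply: (addrI (pr n x)); rewrite -(prD gM) !subrr pr0. Qed.

Lemma prB n x y : pr n (x - y) = pr n x - pr n y.
Proof. by rewrite (prD gM) prN. Qed.

Lemma pr_sum n (I : Type) (r : seq I) (P : pred I) (F : I -> M) :
  pr n (\sum_(i <- r | P i) F i) = \sum_(i <- r | P i) pr n (F i).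
Proof. by apply: (big_morph _ (prD gM n) (pr0 n)). Qed.

Lemma pr_id n x : pr n (pr n x) = pr n x.
Proof. by rewrite (pr_pr gM) eqxx. Qed.

Lemma pr_bound x : exists b, forall i, (b <= i)%N -> pr i x = 0.
Proof.
have [b xE] := pr_fin gM x; exists b => i bi.
rewrite xE pr_sum big1 // => j _; rewrite (pr_pr gM).
by case: eqP => // ij; move: bi; rewrite ij leqNgt ltn_ord.
Qed.

Lemma pr_expand b x : (forall i, (b <= i)%N -> pr i x = 0) ->
  x = \sum_(i < b) pr i x.
Proof.
move=> xb; have [c xE] := pr_fin gM x.
rewrite {1}xE -(big_mkord xpredT (pr^~ x)) -(big_mkord xpredT (pr^~ x)).
have [bc|/ltnW cb] := leqP b c.
  rewrite (big_cat_nat (leq0n _) bc) //=.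
  have -> : \sum_(b <= i < c) pr i x = 0; last by rewrite addr0.
  by rewrite big_nat_cond; apply: big1 => i; rewrite andbT => /andP[/xb].
rewrite [RHS](big_cat_nat (leq0n _) cb) //=.
have -> : \sum_(c <= i < b) pr i x = 0; last by rewrite addr0.
rewrite big_nat_cond; apply: big1 => i; rewrite andbT => /andP[ci _].
rewrite xE pr_sum big1 // => j _; rewrite (pr_pr gM).
by case: eqP => // ij; move: ci; rewrite ij leqNgt ltn_ord.
Qed.

Lemma pr_eq0 x : (forall n, pr n x = 0) -> x = 0.
Proof. by move=> x0; have [b ->] := pr_fin gM x; apply: big1. Qed.

Lemma pr_inj x y : (forall n, pr n x = pr n y) -> x = y.
Proof.
move=> xy; apply/subr0_eq/pr_eq0 => n.
by rewrite prB xy subrr.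
Qed.

Lemma pr_hom i a j : prA i a = a -> forall x, pr (i + j) (a *: x) = a *: pr j x.
Proof.
move=> ai x; have [b xE] := pr_fin gM x.
have [c [bc jc]] : exists c, (b <= c)%N /\ (j < c)%N.
  by exists (maxn b j.+1); rewrite leq_maxl leq_maxr.
have {xE}xE : x = \sum_(m < c) pr m x.
  apply: pr_expand => m cm; rewrite xE pr_sum big1 // => l _.
  rewrite (pr_pr gM); case: eqP => // ml.
  by move: (leq_trans bc cm); rewrite ml leqNgt ltn_ord.
rewrite {1}xE scaler_sumr pr_sum -{1}ai (bigD1 (Ordinal jc)) //=.
rewrite (pr_act gM) eqxx ai big1 ?addr0 // => l lj.
rewrite -ai (pr_act gM) eqn_add2l; case: eqP => // jl.
by move: lj; rewrite -val_eqE /= jl eqxx.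
Qed.

Lemma pr_hom_lt i a n : prA i a = a -> (n < i)%N -> forall x, pr n (a *: x) = 0.
Proof.
move=> ai ni x; have [b xE] := pr_fin gM x.
rewrite xE scaler_sumr pr_sum big1 // => l _.
by rewrite -ai (pr_act gM); case: eqP => // nil; move: ni; rewrite nil; lia.
Qed.

Definition gsub N : Prop := submodule N /\ forall n x, N x -> N (pr n x).

Lemma gsub_hom N X : gsub N -> submodule X ->
  (forall n x, N x -> pr n x = x -> X x) -> N `<=` X.
Proof.
move=> [sN gN] sX H x Nx; have [b ->] := pr_fin gM x.
by apply: submod_sum => // i _; apply: (H i); [exact: gN|exact: pr_id].
Qed.

Lemma submodule_hom N : N 0 -> (forall x y, N x -> N y -> N (x + y)) ->
  (forall i a x, prA i a = a -> N x -> N (a *: x)) -> submodule N.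
Proof.
move=> N0 ND NZ; apply/submoduleP; split=> // a x y Nx Ny.
apply: (ND _ _ _ Ny).
have [b ->] := pr_fin gA (a : A^o).
rewrite scaler_suml; apply: (big_ind N) => // i _.
apply: (NZ i) => //; by have := pr_pr gA i i (a : A^o); rewrite eqxx.
Qed.

Lemma gsubI N Q : gsub N -> gsub Q -> gsub (N `&` Q).
Proof.
move=> [sN gN] [sQ gQ]; split; first exact: submoduleI.
by move=> n x [Nx Qx]; split; [exact: gN|exact: gQ].
Qed.

Lemma gsub_sum N Q : gsub N -> gsub Q -> gsub (sum_set N Q).
Proof.
move=> [sN gN] [sQ gQ]; split; first exact: submodule_sum.
move=> n _ [x Nx [y Qy <-]]; rewrite (prD gM).
by exists (pr n x); [exact: gN|exists (pr n y) => //; exact: gQ].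
Qed.

Lemma gsub0 : gsub [set 0].
Proof. by split; [exact: submodule_set0|move=> n x ->; rewrite /= pr0]. Qed.

Lemma gsubT : gsub [set: M].
Proof. by split; [exact: submodule_setT|]. Qed.

Definition deg_le n : set M := [set x | forall i, (n < i)%N -> pr i x = 0].

Lemma deg_le_bound x : exists n, deg_le n x.
Proof. by have [b xb] := pr_bound x; exists b => i /ltnW; apply: xb. Qed.

Lemma deg_le_mono n m : (n <= m)%N -> deg_le n `<=` deg_le m.
Proof. by move=> nm x xn i mi; apply: xn; apply: leq_ltn_trans mi. Qed.

Lemma deg_leB n x y : deg_le n x -> deg_le n y -> deg_le n (x - y).
Proof. by move=> xn yn i ni; rewrite prB xn // yn // subrr. Qed.

Definition trunc n x : M := \sum_(i < n.+1) pr i x.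

Lemma pr_trunc n i x : pr i (trunc n x) = if (i <= n)%N then pr i x else 0.
Proof.
rewrite pr_sum; case: ifP => [|/negbT]; rewrite -?ltnNge => ni.
  rewrite (bigD1 (Ordinal (ni : (i < n.+1)%N))) //= pr_id big1 ?addr0 // => j ij.
  rewrite (pr_pr gM); case: eqP => // E.
  by move: ij; rewrite -val_eqE /= E eqxx.
rewrite big1 // => j _; rewrite (pr_pr gM); case: eqP => // E.
by move: (ltn_ord j); rewrite -E ltnNge ni.
Qed.

Lemma trunc_deg_le n x : deg_le n (trunc n x).
Proof. by move=> i ni; rewrite pr_trunc leqNgt ni. Qed.

Lemma trunc_id n x : deg_le n x -> trunc n x = x.
Proof.
move=> xn; apply: pr_inj => i; rewrite pr_trunc; case: leqP => // /xn.
by [].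
Qed.

Lemma truncD n x y : trunc n (x + y) = trunc n x + trunc n y.
Proof. by rewrite -big_split; apply: eq_bigr => i _; apply: (prD gM). Qed.

Lemma trunc_gsub N n x : gsub N -> N x -> N (trunc n x).
Proof. by move=> [sN gN] Nx; apply: submod_sum => // i _; apply: gN. Qed.

(* The associated graded submodule for the filtration by degree. *)
Definition lead N : set M :=
  [set x | forall n, exists y, [/\ N y, deg_le n y & pr n y = pr n x]].

Lemma lead_gsub N : submodule N -> gsub (lead N).
Proof.
move=> sN; have N0 := submod0 sN.
have F0 n : deg_le n 0 by move=> i _; rewrite pr0.
split.
  apply: submodule_hom.
  - by move=> n; exists 0.
  - move=> x y Lx Ly n; have [x' [? Fx' xE]] := Lx n.
    have [y' [? Fy' yE]] := Ly n; exists (x' + y').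
    split; [exact: submodD| |by rewrite !(prD gM) xE yE].
    by move=> i ni; rewrite (prD gM) Fx' // Fy' // addr0.
  - move=> i a x ai Lx n; have [ni|jn] := ltnP n i.
      by exists 0; rewrite (pr_hom_lt ai ni) pr0.
    have [y [Ny Fy yE]] := Lx (n - i)%N; exists (a *: y).
    rewrite -(subnKC jn) !(pr_hom _ ai) yE; split=> //; first exact: submodZ.
    move=> m nm; have im : (i <= m)%N by lia.
    by rewrite -(subnKC im) (pr_hom _ ai) Fy ?scaler0 //; lia.
move=> n x Lx m; have [y [Ny Fy yE]] := Lx m; rewrite (pr_pr gM).
case: eqP => [->|_]; last by exists 0; rewrite pr0.
by have [z [? ? zE]] := Lx n; exists z.
Qed.

Lemma lead_mono N Q : N `<=` Q -> lead N `<=` lead Q.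
Proof. by move=> NQ x Lx n; have [y [/NQ ? ? ?]] := Lx n; exists y. Qed.

(** Induction on a degree bound of x: some element of N within the same bound has the same top
    component, and subtracting it lowers the bound. *)
Lemma lead_strict N Q : submodule N -> submodule Q -> N `<=` Q ->
  lead Q `<=` lead N -> Q `<=` N.
Proof.
move=> sN sQ NQ LQN x Qx; have [n Fx] := deg_le_bound x.
elim: n x Qx Fx => [|n IH] x Qx Fx.
  have : lead Q (pr 0 x).
    move=> m; rewrite (pr_pr gM); case: eqP => [->|_]; first by exists x.
    by exists 0; rewrite pr0; split=> //; [exact: submod0|move=> i; rewrite pr0].
  move=> /LQN/(_ 0%N)[y [Ny Fy yE]]; suff -> : x = y by [].
  apply: pr_inj => -[|i]; last by rewrite Fx // Fy.
  by rewrite yE pr_id.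
have : lead Q (pr n.+1 x).
  move=> m; rewrite (pr_pr gM); case: eqP => [->|_]; first by exists x.
  by exists 0; rewrite pr0; split=> //; [exact: submod0|move=> i; rewrite pr0].
move=> /LQN/(_ n.+1)[y [Ny Fy yE]].
rewrite -(subrK y x); apply: submodD => //; apply: IH.
  by apply: submodB => //; apply: NQ.
move=> i; rewrite leq_eqVlt => /orP[/eqP <-|ni].
  by rewrite prB yE pr_id subrr.
by rewrite prB Fx // Fy // subrr.
Qed.

Definition gdev_lt n N' N : Prop := dev_lt gsub subset n N' N.

Let sub_refl (x : set M) : x `<=` x. Proof. by []. Qed.
Let sub_trans (x y z : set M) : x `<=` y -> y `<=` z -> x `<=` z.
Proof. by move=> xy yz w /xy/yz. Qed.

Lemma gdev_lt_Kdim_lt n N' N : gsub N' -> gsub N -> N' `<=` N ->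
  gdev_lt n N' N -> Kdim_lt n N' N.
Proof.
move=> [sN' gN'] [sN gN] N'N H; apply/Kdim_lt_dev => //.
apply: (@dev_lt_map _ _ _ gsub _ subset lead _ _ _ n N' N N' N) => //.
- move=> X sX N'X XN; split; first exact: lead_gsub.
    move=> x N'x n'; exists (pr n' x); split; [apply: N'X; exact: gN'| |].
      move=> i ni; rewrite (pr_pr gM); case: eqP => // E.
      by move: ni; rewrite E ltnn.
    exact: pr_id.
  move=> x Lx; have [b ->] := pr_fin gM x.
  apply: submod_sum => // i _; have [y [Xy _ <-]] := Lx i.
  exact/gN/XN.
- by move=> X Y _ _ _ XY _; apply: lead_mono.
- by move=> X Y sX sY _ XY _; apply: lead_strict.
Qed.

(** By the modular law, comparable submodules with the same intersection with P and the same sum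
    with P coincide; so X is mapped strictly into a product of two lattices. *)
Lemma gdev_lt_ext n N' P N : gsub N' -> gsub P -> gsub N -> N' `<=` P ->
  P `<=` N -> gdev_lt n N' P -> gdev_lt n P N -> gdev_lt n N' N.
Proof.
move=> gN' gP gN N'P PN H1 H2; rewrite /gdev_lt.
apply: (@dev_lt_map _ _ _ (fun X : set M * set M => gsub X.1 /\ gsub X.2) _
  (fun X Y : set M * set M => X.1 `<=` Y.1 /\ X.2 `<=` Y.2)
  (fun X : set M => (X `&` P, sum_set X P))
  sub_refl sub_trans _ n N' N (N', P) (P, N)) => //.
- by move=> x y z [h1 h2] [h3 h4]; split; [exact: sub_trans h3|exact: sub_trans h4].
- exact: sub_trans N'P PN.
- move=> X gX N'X XN; split; split => /=.
  + exact: gsubI.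
  + exact: gsub_sum.
  + by move=> x Nx; split; [exact: N'X|exact: N'P].
  + by apply: sum_setr; case: gX.
  + by move=> x [].
  + by move=> _ [x Xx [y Py <-]]; apply: submodD; [case: gN|exact: XN|exact: PN].
- move=> X Y _ _ _ XY _; split=> /=; first by move=> x [/XY].
  by move=> _ [x Xx [y Py <-]]; exists x; [exact: XY|exists y].
- move=> X Y [sX _] [sY _] _ XY _ [/= h1 h2] y Yy.
  have [x Xx [p Pp xpy]] : sum_set X P y by apply/h2/sum_setl => //; case: gP.
  rewrite -xpy; apply: submodD => //.
  suff [] : (X `&` P) p by [].
  apply: h1; split=> //; rewrite -(addKr x p) xpy addrC.
  by apply: submodB => //; apply: XY.
exact: dev_lt_prod.
Qed.

Lemma submodule_restrict N : submodule N -> submodule (N : set Mk).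
Proof.
move=> /submoduleP[N0 NZ]; apply/submoduleP; split=> // c x y Nx Ny.
exact: NZ.
Qed.

Lemma pr_rscale n c (x : Mk) : pr n (c *: x : Mk) = c *: (pr n x : Mk) :> Mk.
Proof. exact: (pr_hom n (pr_scalar gA c) (x : M)). Qed.

Lemma deg_le_submodule n : submodule (deg_le n : set Mk).
Proof.
apply/submoduleP; split=> [i _|c x y Fx Fy i ni]; first exact: pr0.
have := prD gM i (c *: (x : Mk) : Mk) y => /= ->.
rewrite (Fy _ ni) addr0.
by have /= -> := pr_rscale i c x; rewrite (Fx _ ni); apply: scaler0.
Qed.

Definition fin_graded : Prop := forall n, exists m (s : nat -> Mk),
  rspan [set 0] m s (deg_le n : set Mk).

Hypothesis fM : fin_graded.

(** The cumulative Hilbert function of N / N'. Counting all degrees up to n makes it nondecreasing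
    in n and comparable with the growth of a space of words. By [hilbP] the default 0 does not
    interfere for graded submodules. *)
Definition hilb N' N n : nat :=
  xget 0%N [set m | has_rdim ((N' `&` deg_le n) : set Mk) (N `&` deg_le n) m].

Let sNF N n : gsub N -> submodule ((N `&` deg_le n) : set Mk).
Proof.
case=> sN _; apply: submoduleI; first exact: submodule_restrict.
exact: deg_le_submodule.
Qed.

Lemma hilbP N' N n : gsub N' -> gsub N ->
  has_rdim ((N' `&` deg_le n) : set Mk) (N `&` deg_le n) (hilb N' N n).
Proof.
move=> gN' gN; suff [m Hm] : exists m,
    has_rdim ((N' `&` deg_le n) : set Mk) (N `&` deg_le n) m.
  by rewrite /hilb; case: xgetP => [m' _ //|/(_ m)].
have [m [s Hs]] := fM n.
have [|m' _ H] := @has_rdim_exists k Mk (N' `&` deg_le n) (N `&` deg_le n) m s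
  (sNF n gN') (sNF n gN); last by exists m'.
move=> x [_ Fx]; have [c Hc] := Hs x Fx; exists c; rewrite Hc.
exact: submod0 (sNF n gN').
Qed.

Lemma hilb_eq N' N n m : gsub N' -> gsub N ->
  has_rdim ((N' `&` deg_le n) : set Mk) (N `&` deg_le n) m -> hilb N' N n = m.
Proof.
move=> gN' gN; apply: has_rdim_uniq; first exact: sNF.
exact: hilbP.
Qed.

Lemma hilb_add N0 N1 N2 n : gsub N0 -> gsub N1 -> gsub N2 ->
  N0 `<=` N1 -> N1 `<=` N2 -> hilb N0 N2 n = (hilb N0 N1 n + hilb N1 N2 n)%N.
Proof.
move=> g0 g1 g2 N01 N12; apply: hilb_eq => //.
apply: (@has_rdim_add k Mk _ (N1 `&` deg_le n)) (hilbP n g0 g1) (hilbP n g1 g2).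
- exact: sNF.
- by move=> x [/N01].
- by move=> x [/N12].
Qed.

Lemma hilb_mono N' N n m : gsub N' -> gsub N -> N' `<=` N -> (n <= m)%N ->
  (hilb N' N n <= hilb N' N m)%N.
Proof.
move=> gN' gN N'N nm.
have [s [h1 h2 h3]] := hilbP n gN' gN; have [t [_ _ t3]] := hilbP m gN' gN.
apply: (rindep_leq_rspan (sNF m gN') _ _ t3 (t := s)).
  move=> c [N'c _]; apply: h2; split=> //.
  apply: (@submod_sum k Mk) => [|i _]; first exact: deg_le_submodule.
  have [_ Fs] := h1 i (ltn_ord i).
  exact: (submodZ (c i) (deg_le_submodule n) Fs).
by move=> i /h1[? ?]; split=> //; exact: (deg_le_mono nm).
Qed.

Lemma hilb_eq0 N' N n : gsub N' -> gsub N -> hilb N' N n = 0%N ->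
  N `&` deg_le n `<=` N'.
Proof.
move=> gN' gN H0; have [s [_ _ h3]] := hilbP n gN' gN.
by move=> x /h3[c]; rewrite H0 big_ord0 subr0 => -[].
Qed.

(** Bounds on both sides, rather than a limit superior, survive the addition of Hilbert functions; C
    is both the factor and the threshold. *)
Definition hilb_growth N' N d : Prop := exists2 C, (0 < C)%N &
  forall n, (C <= n)%N ->
    (n ^ d <= C * hilb N' N n)%N /\ (hilb N' N n <= C * n ^ d)%N.

(** Growth exponent and Krull dimension agree. The upper bound on the dimension concerns graded
    submodules, the lower bound all submodules: the former can be proved with homogeneous elements
    and transferred by [gdev_lt_Kdim_lt], the latter already has its final form. *)
Definition good N' N : Prop := N `<=` N' \/ exists d,
  [/\ hilb_growth N' N d, gdev_lt d.+1 N' N & ~ Kdim_lt d N' N].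

Lemma growth_ext N' P N d e : gsub N' -> gsub P -> gsub N -> N' `<=` P ->
  P `<=` N -> hilb_growth N' P d -> hilb_growth P N e -> hilb_growth N' N (maxn d e).
Proof.
move=> gN' gP gN N'P PN [C C0 HC] [D D0 HD]; exists (C + D)%N => [|n Cn]; first lia.
have [h1 h2] := HC n ltac:(lia); have [h3 h4] := HD n ltac:(lia).
rewrite (@hilb_add N' P N) //; set a := hilb N' P n in h1 h2 *.
set b := hilb P N n in h3 h4 *.
have n0 : (0 < n)%N by lia.
have hd : (n ^ d <= n ^ maxn d e)%N by rewrite leq_pexp2l // leq_maxl.
have he : (n ^ e <= n ^ maxn d e)%N by rewrite leq_pexp2l // leq_maxr.
split; last by nia.
by rewrite /maxn; case: ifP => _; nia.
Qed.

Lemma good_ext N' P N : gsub N' -> gsub P -> gsub N -> N' `<=` P ->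
  P `<=` N -> good N' P -> good P N -> good N' N.
Proof.
move=> gN' gP gN N'P PN [PN'|[d [d1 d2 d3]]].
  by have -> : N' = P by apply/seteqP.
case=> [NP|[e [e1 e2 e3]]].
  by have -> : N = P by [apply/seteqP]; right; exists d.
right; exists (maxn d e); split.
- exact: growth_ext d1 e1.
- apply: (gdev_lt_ext (P := P)) => //.
    by apply: dev_lt_leq d2 => //; rewrite ltnS leq_maxl.
  by apply: dev_lt_leq e2 => //; rewrite ltnS leq_maxr.
- move=> /Kdim_lt_dev H; have {}H := H (sub_trans N'P PN).
  rewrite /maxn in H; case: ifP H => _ H.
    by apply: e3; apply/Kdim_lt_dev => //; apply: dev_lt_sub H.
  by apply: d3; apply/Kdim_lt_dev => //; apply: dev_lt_sub H.
Qed.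

End Graded.

(** * Polynomial growth *)

Section PolynomialGrowth.
Local Open Scope nat_scope.
Implicit Types (h a b : nat -> nat).

Definition poly_growth h d : Prop := exists2 C, 0 < C &
  forall n, C <= n -> n ^ d <= C * h n /\ h n <= C * n ^ d.

Lemma leq_exp2rW m n e : m <= n -> m ^ e <= n ^ e.
Proof. by case: e => // e; rewrite leq_exp2r. Qed.

(** The mean value inequality for x^(e+1) over a step of length d; it drives the lower bound in
    [poly_growth_sum]. *)
Lemma expn_mean_value m d e :
  (m + d) ^ e.+1 <= m ^ e.+1 + e.+1 * d * (m + d) ^ e.
Proof.
elim: e => [|e IH]; first by rewrite !expn1 expn0; lia.
rewrite expnS [in X in _ <= X + _]expnS.
have : (m + d) * (m + d) ^ e.+1 <=
    m * (m ^ e.+1 + e.+1 * d * (m + d) ^ e) + d * (m + d) ^ e.+1.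
  by rewrite mulnDl leq_add2r leq_mul2l IH orbT.
move/leq_trans; apply; rewrite mulnDr -addnA leq_add2l.
have : m * (m + d) ^ e <= (m + d) ^ e.+1 by rewrite expnS leq_mul2r leq_addr orbT.
set u := _ ^ e; set v := _ ^ e.+1 => muv.
have : e.+1 * d * (m * u) <= e.+1 * d * v by rewrite leq_mul2l muv orbT.
by lia.
Qed.

Lemma expn_succ_leq n d : 0 < n -> n.+1 ^ d <= 2 ^ d * n ^ d.
Proof.
by move=> n0; rewrite -expnMn leq_exp2rW //; lia.
Qed.

Lemma poly_growth_ub h d : poly_growth h d ->
  exists K, forall n, h n <= K * n.+1 ^ d.
Proof.
case=> C C0 HC; exists (C + \sum_(i < C) h i) => n.
have [Cn|nC] := leqP C n.
  have [_ h2] := HC n Cn; apply: leq_trans h2 _; apply: leq_mul.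
    exact: leq_addr.
  by rewrite leq_exp2rW.
apply: (@leq_trans (C + \sum_(i < C) h i)); last first.
  by rewrite leq_pmulr // expn_gt0.
rewrite (bigD1 (Ordinal nC)) //=; lia.
Qed.

Lemma poly_growth_shift h h' d e : (forall n, h' (n + d) = h n) ->
  poly_growth h e -> poly_growth h' e.
Proof.
(* From n >= 2 d follows n <= 2 (n - d), whence the factor 2^e; the threshold also excludes the
   values of h' below d. *)
move=> hh' [C C0 HC]; exists (2 ^ e * C + 2 * d) => [|n Cn].
  by rewrite ltn_addr // muln_gt0 expn_gt0.
have C2 : C <= 2 ^ e * C by rewrite leq_pmull // expn_gt0.
have dn : d <= n by lia.
have [|h1 h2] := HC (n - d); first lia.
rewrite -(subnK dn) hh' (subnK dn); set c := h _ in h1 h2 *.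
have l1 : n ^ e <= 2 ^ e * (n - d) ^ e.
  by rewrite -expnMn leq_exp2rW //; lia.
have l2 : (n - d) ^ e <= n ^ e.
  by rewrite leq_exp2rW // leq_subr.
split.
  apply: leq_trans l1 _; apply: (@leq_trans (2 ^ e * (C * c))).
    by rewrite leq_mul2l h1 orbT.
  by rewrite mulnA leq_mul2r leq_addr orbT.
apply: leq_trans h2 _; apply: leq_mul => //; lia.
Qed.

Section Recurrence.
Variables (a b : nat -> nat) (d e : nat).
Hypothesis d_gt0 : 0 < d.
Hypothesis ab_rec : forall n, a (n + d) = a n + b (n + d).
Hypothesis ab_init : forall n, n < d -> a n = b n.
Hypothesis b_growth : poly_growth b e.

(** The generating series of a is that of b divided by 1 - t^d, and summation along steps of length
    d raises the exponent by one. *)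
Lemma poly_growth_sum : poly_growth a e.+1.
Proof.
have [K HK] := poly_growth_ub b_growth; case: b_growth => C C0 HC.
have ub n : a n <= K * n.+1 ^ e.+1.
  elim/ltn_ind: n => n IH; have [nd|dn] := ltnP n d.
    rewrite ab_init //; apply: leq_trans (HK n) _.
    by rewrite [in X in _ <= X]expnS leq_mul2l leq_pmull ?orbT.
  rewrite -(subnK dn) ab_rec (subnK dn).
  have h1 := IH (n - d) ltac:(lia); have h2 := HK n.
  have h3 : (n - d).+1 ^ e.+1 <= n * n.+1 ^ e.
    rewrite expnS; apply: leq_mul; first lia.
    by rewrite leq_exp2rW //; lia.
  have h4 : K * (n - d).+1 ^ e.+1 <= K * (n * n.+1 ^ e) by rewrite leq_mul2l h3 orbT.
  by rewrite expnS; lia.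
(* [C'] matches the increment of n^(e+1) with a multiple of b n; [B] covers the start, where n < C +
   d. *)
pose B := (C + d) ^ e.+1; pose C' := e.+1 * d * C.
have lb n : n ^ e.+1 <= C' * a n + B.
  elim/ltn_ind: n => n IH; have [nd|dn] := ltnP n (C + d).
    apply: leq_trans (leq_addl _ _).
    by rewrite leq_exp2rW // ltnW.
  have dn' : d <= n by lia.
  have h1 := IH (n - d) ltac:(lia); have [h2 _] := HC n ltac:(lia).
  have := expn_mean_value (n - d) d e; rewrite (subnK dn') => h3.
  have -> : a n = a (n - d) + b n by rewrite -{1}(subnK dn') ab_rec (subnK dn').
  have h4 : e.+1 * d * n ^ e <= C' * b n.
    by rewrite /C' -[X in _ <= X]mulnA leq_mul2l h2 orbT.
  by lia.
have ba n : b n <= a n.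
  have [nd|dn] := ltnP n d; first by rewrite ab_init.
  by rewrite -(subnK dn) ab_rec leq_addl.
exists (C + C' + B + K * 2 ^ e.+1) => [|n Cn]; first lia.
have n0 : 0 < n by lia.
have Cn' : C <= n by lia.
split.
  have a0 : 0 < a n.
    have [h2 _] := HC n Cn'; have : 0 < n ^ e by rewrite expn_gt0 n0.
    have := ba n; case: (b n) h2 => [|b']; rewrite ?muln0; lia.
  apply: leq_trans (lb n) _.
  have : B <= B * a n by rewrite leq_pmulr.
  by rewrite !mulnDl; lia.
apply: leq_trans (ub n) _.
have := expn_succ_leq e.+1 n0; set u := n.+1 ^ _; set v := n ^ _ => h.
have : K * u <= K * (2 ^ e.+1 * v) by rewrite leq_mul2l h orbT.
by rewrite !mulnDl mulnA; lia.
Qed.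

(** Increments of a over a fixed distance have exponent e, one less than a itself. This bounds the
    growth of U modulo a shifted copy of U. *)
Lemma poly_growth_diff d' : {homo a : n m / n <= m} ->
  exists K, forall n, a (n + d') <= a n + K * (n + d').+1 ^ e.
Proof.
move=> a_mono; have [K HK] := poly_growth_ub b_growth.
have step n : a n <= a (n - d) + K * n.+1 ^ e.
  have [nd|dn] := ltnP n d.
    by rewrite ab_init //; apply: leq_trans (HK n) (leq_addl _ _).
  by rewrite -{1}(subnK dn) ab_rec (subnK dn) leq_add2l.
have steps q n : a n <= a (n - q * d) + q * K * n.+1 ^ e.
  elim: q => [|q IH]; first by rewrite mul0n subn0 leq_addr.
  apply: leq_trans IH _; have := step (n - q * d).
  have -> : n - q * d - d = n - q.+1 * d by lia.
  have : (n - q * d).+1 ^ e <= n.+1 ^ e.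
    by rewrite leq_exp2rW //; lia.
  set u := _.+1 ^ e; set v := _.+1 ^ e => uv.
  have : K * u <= K * v by rewrite leq_mul2l uv orbT.
  by lia.
(* As d is positive, d' steps of length d go back by at least d'. *)
exists (d' * K) => n; apply: leq_trans (steps d' _) _.
by rewrite leq_add2r; apply: a_mono; nia.
Qed.

End Recurrence.

Lemma poly_growth_leq h d e K : poly_growth h d ->
  (forall n, K <= n -> h n <= K * n.+1 ^ e) -> d <= e.
Proof.
case=> C C0 HC HK; rewrite leqNgt; apply/negP => ed.
(* Past both thresholds and above C K 2^e; if e < d, the bounds would force n <= C K 2^e. *)
pose n := (C + K + C * (K * 2 ^ e)).+1.
have [h1 _] := HC n ltac:(lia); have h2 := HK n ltac:(lia).
have n0 : 0 < n by [].
have h3 : n * n ^ e <= n ^ d by rewrite -expnS leq_pexp2l.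
have h4 := expn_succ_leq e n0.
have : n * n ^ e <= C * (K * (2 ^ e * n ^ e)).
  apply: leq_trans h3 (leq_trans h1 _); rewrite leq_mul2l.
  by rewrite (leq_trans h2) ?orbT // leq_mul2l h4 orbT.
rewrite !mulnA leq_pmul2r ?expn_gt0 ?n0 //.
by rewrite /n !mulnA; lia.
Qed.

End PolynomialGrowth.

(** * Shifts of subquotients *)

(* f induces an injection N1 / N1' -> M2 / N2' of degree d which is linear over
   k, and semilinear over A in the weak sense that it maps submodules to
   submodules and pulls them back to submodules. *)
Record graded_shift (k : fieldType) (A : algType k) (M1 M2 : lmodType A)
  (pr1 : nat -> M1 -> M1) (pr2 : nat -> M2 -> M2) (f : M1 -> M2) (d : nat)
  (N1' N1 : set M1) (N2' : set M2) : Prop := Shift {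
  shD : forall x y, f (x + y) = f x + f y;
  shZ : forall (c : k) x, f (c%:A *: x) = c%:A *: f x;
  sh_pr : forall n x, pr2 (n + d)%N (f x) = f (pr1 n x);
  sh_pr0 : forall n x, (n < d)%N -> pr2 n (f x) = 0;
  sh_sub : forall x, N1' x -> N2' (f x);
  sh_inj : forall x, N1 x -> N2' (f x) -> N1' x;
  sh_push : forall a x, N1 x -> exists b, N2' (a *: f x - f (b *: x));
  sh_pull : forall a x, N1 x -> exists b, N2' (f (a *: x) - b *: f x)
}.

Section Shifts.
Variables (k : fieldType) (A : algType k) (prA : nat -> A -> A).
Hypothesis gA : graded_algebra prA.
Variables (M1 M2 : lmodType A) (pr1 : nat -> M1 -> M1) (pr2 : nat -> M2 -> M2).
Hypothesis gM1 : graded_module prA pr1.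
Hypothesis gM2 : graded_module prA pr2.
Hypothesis fM1 : fin_graded pr1.
Hypothesis fM2 : fin_graded pr2.
Variables (f : M1 -> M2) (d : nat) (N1' N1 : set M1) (N2' : set M2).
Hypothesis sf : graded_shift pr1 pr2 f d N1' N1 N2'.
Hypothesis gN1' : gsub pr1 N1'.
Hypothesis gN1 : gsub pr1 N1.
Hypothesis gN2' : gsub pr2 N2'.
Hypothesis N1'_N1 : N1' `<=` N1.

Definition shift_im (X : set M1) : set M2 := sum_set (f @` X) N2'.
Definition shift_pre (Z : set M2) : set M1 := [set x | N1 x /\ Z (f x)].

Let sN1 : submodule N1. Proof. by case: gN1. Qed.
Let sN2' : submodule N2'. Proof. by case: gN2'. Qed.

Lemma shift0 : f 0 = 0.
Proof. by apply: (addrI (f 0)); rewrite -(shD sf) !addr0. Qed.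

Lemma shiftB x y : f (x - y) = f x - f y.
Proof. by apply: (addIr (f y)); rewrite -(shD sf) !subrK. Qed.

Lemma shift_im_sub X : submodule X -> X `<=` N1 -> submodule (shift_im X).
Proof.
move=> sX XN; apply/submoduleP; split.
  exists (f 0); first by exists 0 => //; exact: submod0.
  by exists 0; [exact: submod0|rewrite shift0 addr0].
move=> a _ _ [_ [x Xx <-] [y Ny <-]] [_ [x' Xx' <-] [y' Ny' <-]].
have [b Hb] := sh_push sf a (XN _ Xx).
exists (f (b *: x + x')).
  by exists (b *: x + x') => //; apply: submodD => //; apply: submodZ.
exists ((a *: f x - f (b *: x)) + (a *: y + y')).
  by apply: submodD => //; apply: submodD => //; apply: submodZ.
rewrite (shD sf) scalerDr addrACA [f (b *: x) + _]addrC subrK.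
by rewrite [f x' + (_ + _)]addrCA addrA.
Qed.

Lemma shift_im_gsub X : gsub pr1 X -> X `<=` N1 -> gsub pr2 (shift_im X).
Proof.
move=> [sX gX] XN; split; first exact: shift_im_sub.
move=> n _ [_ [x Xx <-] [y Ny <-]]; rewrite (prD gM2).
exists (pr2 n (f x)); last by exists (pr2 n y) => //; case: gN2' => _; apply.
have [nd|dn] := ltnP n d.
  by exists 0; [exact: submod0|rewrite shift0 (sh_pr0 sf)].
by exists (pr1 (n - d) x); [exact: gX|rewrite -(sh_pr sf) subnK].
Qed.

Lemma shift_pre_sub Z : submodule Z -> N2' `<=` Z -> submodule (shift_pre Z).
Proof.
move=> sZ NZ; apply/submoduleP; split.
  by split; [exact: submod0|rewrite shift0; exact: submod0].
move=> a x y [Nx Zx] [Ny Zy]; split; first by apply: submodD => //; apply: submodZ.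
rewrite (shD sf); apply: submodD => //.
have [b Hb] := sh_pull sf a Nx; rewrite -(subrK (b *: f x) (f (a *: x))).
by apply: submodD => //; [exact: NZ|exact: submodZ].
Qed.

Lemma shift_pre_gsub Z : gsub pr2 Z -> N2' `<=` Z -> gsub pr1 (shift_pre Z).
Proof.
move=> [sZ gZ] NZ; split; first exact: shift_pre_sub.
move=> n x [Nx Zx]; split; first by case: gN1 => _; apply.
by rewrite -(sh_pr sf); apply: gZ.
Qed.

Lemma shift_im_mono X Y : X `<=` Y -> shift_im X `<=` shift_im Y.
Proof.
move=> XY _ [_ [x Xx <-] [y Ny <-]].
by exists (f x); [exists x => //; exact: XY|exists y].
Qed.

Lemma shift_im_reflect X Y : submodule X -> submodule Y ->
  N1' `<=` X -> X `<=` Y -> Y `<=` N1 ->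
  shift_im Y `<=` shift_im X -> Y `<=` X.
Proof.
move=> sX sY NX XY YN YX y Yy.
have [|_ [x Xx <-] [z Nz E]] := YX (f y).
  by exists (f y); [exists y|exists 0; [exact: submod0|rewrite addr0]].
rewrite -(subrK x y); apply: submodD => //; apply/NX/(sh_inj sf).
  by apply: submodB => //; [exact: YN|exact/YN/XY].
by rewrite shiftB -E addrAC subrr add0r.
Qed.

Lemma shift_im_min X : submodule X -> N2' `<=` shift_im X.
Proof.
move=> sX y Ny; exists 0; last by exists y => //; rewrite add0r.
by exists 0; [exact: submod0|exact: shift0].
Qed.

Lemma shift_im0 : shift_im N1' = N2'.
Proof.
apply/seteqP; split=> [_ [_ [x Nx <-] [y Ny <-]]|].
  by apply: submodD => //; apply: (sh_sub sf).
move=> y Ny; exists (f 0); last by exists y => //; rewrite shift0 add0r.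
by exists 0 => //; case: gN1' => ? _; exact: submod0.
Qed.

Local Notation M2k := (restrict_scalars M2).
Local Notation M1k := (restrict_scalars M1).

Lemma hilb_shift n : hilb pr2 N2' (shift_im N1) (n + d) = hilb pr1 N1' N1 n.
Proof.
have gI : gsub pr2 (shift_im N1) by apply: shift_im_gsub.
apply: (hilb_eq gA gM2) => //.
apply: (@has_rdim_map k M1k M2k f (N1' `&` deg_le pr1 n) (N1 `&` deg_le pr1 n)
  (N2' `&` deg_le pr2 (n + d)) (shift_im N1 `&` deg_le pr2 (n + d))).
- exact: (shD sf).
- exact: (shZ sf).
- apply: submoduleI; first exact: submodule_restrict.
  exact: (deg_le_submodule gA gM1).
- apply: submoduleI; first exact: submodule_restrict.
  exact: (deg_le_submodule gA gM2).
- move=> x [Nx Fx]; split; first exact: (sh_sub sf).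
  move=> i ni; have di : (d <= i)%N by lia.
  by rewrite -(subnK di) (sh_pr sf) Fx ?shift0 //; lia.
- by move=> x [Nx Fx] [Nfx _]; split=> //; exact: (sh_inj sf).
- move=> x [Nx Fx]; split.
    by exists (f x); [exists x|exists 0; [exact: submod0|rewrite addr0]].
  move=> i ni; have di : (d <= i)%N by lia.
  by rewrite -(subnK di) (sh_pr sf) Fx ?shift0 //; lia.
(* The sum f x + y has degree at most n + d, but x need not have degree at most n; cutting off x at
   n and y at n + d leaves the sum unchanged. *)
- move=> _ [[_ [x Nx <-] [y Ny <-]] Fz]; exists (trunc pr1 n x).
    by split; [exact: (trunc_gsub _ gN1)|exact: (trunc_deg_le gM1)].
  have E : f x + y - f (trunc pr1 n x) = trunc pr2 (n + d) y.
    apply/eqP; rewrite subr_eq -(trunc_id gM2 Fz) (truncD gM2) addrC; apply/eqP.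
    congr (_ + _); apply: (pr_inj gM2) => i; rewrite (pr_trunc gM2).
    have [id'|di] := ltnP i d.
      by rewrite !(sh_pr0 sf) // if_same.
    rewrite -(subnK di) !(sh_pr sf) (pr_trunc gM1) leq_add2r.
    by case: ifP => // _; rewrite shift0.
  rewrite [X in (_ `&` _) X]E; split; first exact: (trunc_gsub _ gN2').
  exact: (trunc_deg_le gM2).
- exact: (hilbP gA gM1).
Qed.

Lemma hilb_shift_lt n : (n < d)%N -> hilb pr2 N2' (shift_im N1) n = 0%N.
Proof.
move=> nd; have gI : gsub pr2 (shift_im N1) by apply: shift_im_gsub.
apply: (hilb_eq gA gM2) => //.
exists (fun=> 0); split=> // _ [[_ [x Nx <-] [y Ny <-]] Fz].
exists (fun=> 0); rewrite big_ord0 subr0; split=> //.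
rewrite -(trunc_id gM2 Fz) (truncD gM2).
have -> : trunc pr2 n (f x) = 0.
  by rewrite /trunc big1 // => i _; rewrite (sh_pr0 sf) //; have := ltn_ord i; lia.
by rewrite add0r; apply: (trunc_gsub _ gN2').
Qed.

Let sub_refl1 (x : set M1) : x `<=` x. Proof. by []. Qed.
Let sub_trans1 (x y z : set M1) : x `<=` y -> y `<=` z -> x `<=` z.
Proof. by move=> xy yz w /xy/yz. Qed.
Let sub_refl2 (x : set M2) : x `<=` x. Proof. by []. Qed.
Let sub_trans2 (x y z : set M2) : x `<=` y -> y `<=` z -> x `<=` z.
Proof. by move=> xy yz w /xy/yz. Qed.

(** Images of submodules ([sh_push]) carry lower bounds from N1 / N1' to its image; upper bounds
    travel the same way through preimages ([sh_pull]) in [gdev_lt_shift]. *)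
Lemma Kdim_lt_shift n X Y : submodule X -> submodule Y -> N1' `<=` X ->
  X `<=` Y -> Y `<=` N1 ->
  Kdim_lt n (shift_im X) (shift_im Y) -> Kdim_lt n X Y.
Proof.
move=> sX sY NX XY YN H; apply/Kdim_lt_dev => //.
move/Kdim_lt_dev: H => /(_ (shift_im_mono XY)) H.
apply: (@dev_lt_map _ _ _ _ _ subset shift_im sub_refl1 sub_trans1 sub_trans2
  n X Y _ _ _ _ _ _ _ _ H) => //.
- move=> Z sZ XZ ZY; split; try exact: shift_im_mono.
  by apply: shift_im_sub => //; apply: sub_trans1 YN.
- by move=> Z W _ _ _ ZW _; exact: shift_im_mono.
- move=> Z W sZ sW XZ ZW WY; apply: shift_im_reflect => //.
    exact: sub_trans1 XZ.
  exact: sub_trans1 YN.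
Qed.

Lemma gdev_lt_shift n : gdev_lt pr1 n N1' N1 -> gdev_lt pr2 n N2' (shift_im N1).
Proof.
move=> H; have gI : gsub pr2 (shift_im N1) by apply: shift_im_gsub.
apply: (@dev_lt_map _ _ _ _ _ subset shift_pre sub_refl2 sub_trans2 sub_trans1
  n _ _ _ _ _ _ _ _ _ _ H) => //.
- exact: shift_im_min.
- move=> Z gZ NZ ZN; split; first exact: shift_pre_gsub.
    by move=> x N'x; split; [exact: N1'_N1|apply/NZ/(sh_sub sf)].
  by move=> x [].
- by move=> Z W _ _ _ ZW _ x [Nx /ZW].
- move=> Z W [sZ _] [sW _] NZ ZW WN WZ w Ww.
  have [_ [x Nx <-] [y Ny E]] := WN w Ww; rewrite -E; apply: submodD => //.
    suff [] : shift_pre Z x by [].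
    apply: WZ; split=> //; rewrite -(addrK y (f x)) E; apply: submodB => //.
    exact/ZW/NZ.
  exact: NZ.
Qed.

Lemma good_shift : good pr1 N1' N1 -> good pr2 N2' (shift_im N1).
Proof.
case=> [NN|[e [e1 e2 e3]]].
  left; have E : N1 = N1' by apply/seteqP.
  by move: shift_im0; rewrite -E => ->.
right; exists e; split.
- exact: (poly_growth_shift hilb_shift).
- exact: gdev_lt_shift.
- rewrite -shift_im0 => H; apply: e3; apply: (Kdim_lt_shift _ _ _ _ _ H) => //.
  by case: gN1'.
Qed.

End Shifts.

(** * Injective self-maps of positive degree *)

Section SelfShift.
Variables (k : fieldType) (A : algType k) (prA : nat -> A -> A).
Hypothesis gA : graded_algebra prA.
Variables (M : lmodType A) (pr : nat -> M -> M).
Hypothesis gM : graded_module prA pr.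
Hypothesis fM : fin_graded pr.
Variables (f : M -> M) (d : nat) (N' N : set M).
Hypothesis sf : graded_shift pr pr f d N' N N'.
Hypothesis gN' : gsub pr N'.
Hypothesis gN : gsub pr N.
Hypothesis N'_N : N' `<=` N.
Hypothesis fN : forall x, N x -> N (f x).

Local Notation im := (shift_im f N').
Local Notation pre := (shift_pre f N).

Let sub_refl (x : set M) : x `<=` x. Proof. by []. Qed.
Let sub_trans (x y z : set M) : x `<=` y -> y `<=` z -> x `<=` z.
Proof. by move=> xy yz w /xy/yz. Qed.

Lemma self_shift_im_sub X : submodule X -> X `<=` N -> im X `<=` N.
Proof.
move=> sX XN _ [_ [x Xx <-] [y Ny <-]].
by apply: submodD; [case: gN|apply/fN/XN|exact: N'_N].
Qed.

Let sN : submodule N. Proof. by case: gN. Qed.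
Let imN_N : im N `<=` N. Proof. exact: self_shift_im_sub. Qed.
Let g_imN : gsub pr (im N). Proof. exact: (shift_im_gsub gM sf). Qed.
Let N'_imN : N' `<=` im N. Proof. exact: (shift_im_min sf). Qed.

Lemma growth_self_shift e : (0 < d)%N -> hilb_growth pr (im N) N e ->
  hilb_growth pr N' N e.+1.
Proof.
move=> d0; apply: (poly_growth_sum d0) => n; last first.
  move=> nd; rewrite (hilb_add gA gM fM n gN' g_imN gN) //.
  by rewrite (hilb_shift_lt gA gM fM sf).
rewrite (hilb_add gA gM fM _ gN' g_imN gN) //.
by rewrite (hilb_shift gA gM gM fM fM sf).
Qed.

Lemma Kdim_self_shift e : ~ Kdim_lt e (im N) N -> ~ Kdim_lt e.+1 N' N.
Proof.
move=> low H; pose C i := iter i im N.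
have gC i : [/\ gsub pr (C i), N' `<=` C i & C i `<=` N].
  elim: i => [|i [gC NC CN]] //=; split.
  - exact: (shift_im_gsub gM sf).
  - by apply: (shift_im_min sf) => //; case: gC.
  - by apply: self_shift_im_sub => //; case: gC.
have decC i : C i.+1 `<=` C i.
  by elim: i => [|i IH] //=; apply: (shift_im_mono (N2' := N')).
have [i|i0 /(_ i0 (leqnn _))] := H C _ decC.
  by have [[? _] ? ?] := gC i.
(* Each factor of the chain is the shifted copy of the factor before it, so a bound on any one of
   them descends to N / f(N). *)
elim: i0 => [|i IH] //= K; apply: IH.
have [[sC _] NC CN] := gC i; have [[sC' _] NC' CN'] := gC i.+1.
exact: (Kdim_lt_shift sf gN gN' sC' sC).
Qed.

(** A graded Nakayama lemma: modulo N', a homogeneous element is the image of one whose degree is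
    lower by d, and degrees are bounded below. *)
Lemma self_shift_proper : (0 < d)%N -> N `<=` im N -> N `<=` N'.
Proof.
move=> d0 NI; apply: (gsub_hom gM gN); first by case: gN'.
elim/ltn_ind => n IH x Nx xn; have [_ [z Nz <-] [w Nw E]] := NI x Nx.
have [sN' gN''] := gN'.
have {E} E : pr n (f z) + pr n w = x by rewrite -(prD gM) E.
rewrite -E; apply: submodD => //; last exact: gN''.
have [nd|dn] := ltnP n d; first by rewrite (sh_pr0 sf) //; exact: submod0.
rewrite -(subnK dn) (sh_pr sf); apply: (sh_sub sf).
apply: (IH (n - d)%N); first lia; first by case: gN => _; apply.
exact: (pr_id gM).
Qed.

Hypothesis fstable : forall X, submodule X -> forall x, X x -> X (f x).

(* The filtration of C by the preimages of C under the powers of f embeds the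
   lattice of C's into stable sequences of submodules of N / f(N). *)
Lemma gdev_self_shift n : (0 < d)%N -> noetherian_module M ->
  gdev_lt pr n (im N) N -> gdev_lt pr n.+1 N' N.
Proof.
move=> d0 noeM H.
have gpre C : gsub pr C -> N' `<=` C -> C `<=` N ->
    forall j, [/\ gsub pr (iter j pre C), N' `<=` iter j pre C & iter j pre C `<=` N].
  move=> gC NC CN; elim=> [|j [g1 g2 g3]] //=; split.
  - exact: (shift_pre_gsub sf).
  - by move=> x N'x; split; [exact: N'_N|apply/g2/(sh_sub sf)].
  - by move=> x [].
pose T (C : set M) j := sum_set (iter j pre C) (im N).
have gT C : gsub pr C -> N' `<=` C -> C `<=` N -> forall j, gsub pr (T C j).
  by move=> gC NC CN j; apply: (gsub_sum gM) => //; have [] := gpre C gC NC CN j.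
have sum_mono (X Y : set M) : X `<=` Y -> sum_set X (im N) `<=` sum_set Y (im N).
  by move=> XY _ [x Xx [y Yy <-]]; exists x; [exact: XY|exists y].
(* C lies in its own preimage because f preserves every submodule. *)
have Tinc C : gsub pr C -> N' `<=` C -> C `<=` N -> forall j, T C j `<=` T C j.+1.
  move=> gC NC CN j; apply: sum_mono; elim: j => [|j IH] /=.
    by move=> x Cx; split; [exact: CN|apply: fstable => //; case: gC].
  by move=> x [Nx /IH].
have sT C : gsub pr C -> N' `<=` C -> C `<=` N -> stable_seq (gsub pr) subset (T C).
  move=> gC NC CN; split; [exact: gT|exact: Tinc|].
  have [j|m Hm] := noeM (T C) _ (Tinc C gC NC CN).
    by have [] := gT C gC NC CN j.
  exists m => j; have [mj|/ltnW jm] := leqP m j; first by rewrite Hm.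
  exact: (le_chain sub_trans sub_refl (Tinc C gC NC CN)).
apply: (@dev_lt_map _ _ _ (stable_seq (gsub pr) subset) _ (le_seq subset) T
  sub_refl sub_trans _ n.+1 N' N (T N') (T N)) => //.
- by move=> x y z xy yz j; apply: sub_trans (xy j) (yz j).
- move=> C gC NC CN.
  have mono D E j : D `<=` E -> T D j `<=` T E j.
    move=> DE; apply: sum_mono; elim: j => [|j IH] //= x [Nx] /IH.
    by [].
  by split; [exact: sT|move=> j; exact: mono|move=> j; exact: mono].
- move=> C D gC gD NC CD DN j; apply: sum_mono.
  by elim: j => [|j IH] //= x [Nx /IH].
- move=> C D gC gD NC CD DN DC.
  have CN := sub_trans CD DN; have ND := sub_trans NC CD.
  (* Induction on the degree s, for all j at once. Modulo N', y is c + f z with c in the j-th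
     preimage of C and z of degree s - d; since f z differs from y by elements of the j-th preimage
     of D, z lies in the next one. *)
  suff main : forall s j y, pr s y = y -> iter j pre D y -> iter j pre C y.
    by apply: (gsub_hom gM gD) => [|s x Dx xs]; [case: gC|exact: (main s 0%N)].
  elim/ltn_ind => s IH j y ys Dy.
  have [g1 g2 g3] := gpre C gC NC CN j; have [g1' g2' g3'] := gpre D gD ND DN j.
  have [|c Cc [_ [_ [z Nz <-] [w Nw <-]] E]] := DC j y.
    by apply: sum_setl => //; case: g_imN.
  have Cc' : iter j pre C (pr s c + pr s w).
    apply: submodD; first by case: g1.
      by case: g1 => _; apply.
    by apply: g2; case: gN' => _; apply.
  have {}E : y = (pr s c + pr s w) + pr s (f z).
    by rewrite -ys -E !(prD gM) addrAC addrA.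
  rewrite E; apply: submodD => //; first by case: g1.
  have [sd|ds] := ltnP s d.
    by rewrite (sh_pr0 sf) //; apply: submod0; case: g1.
  rewrite -(subnK ds) (sh_pr sf).
  suff : iter j.+1 pre C (pr (s - d)%N z) by case.
  apply: (IH (s - d)%N); [lia|exact: (pr_id gM)|].
  split; first by case: gN => _; apply.
  rewrite -(sh_pr sf) (subnK ds).
  have -> : pr s (f z) = y - (pr s c + pr s w) by rewrite E addrC addKr.
  apply: submodB => //; first by case: g1'.
  have CDj i : iter i pre C `<=` iter i pre D.
    by elim: i => [|i IHi] //= x [Nx /IHi].
  exact: CDj.
apply: (dev_lt_stable_seq sub_refl sub_trans H).
- exact: sT.
- exact: sT.
- by move=> j; apply: sum_mono; elim: j => [|j IH] //= x [Nx /IH].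
- by move=> j; apply: sum_setr; have [[]] := gpre N' gN' (@sub_refl N') N'_N j.
- move=> j; have [_ _ h] := gpre N gN N'_N (@sub_refl N) j.
  by move=> _ [x /h Nx [y /imN_N Ny <-]]; apply: submodD.
Qed.

End SelfShift.

Lemma noninc_nat_stable (h : nat -> nat) : (forall i, h i.+1 <= h i)%N ->
  exists i0, forall i, (i0 <= i)%N -> h i = h i0.
Proof.
move=> hdec; have hmono i j : (i <= j)%N -> (h j <= h i)%N.
  move=> /subnKC <-; elim: (j - i)%N => [|n IH]; first by rewrite addn0.
  by rewrite addnS (leq_trans (hdec _)).
pose Q n := `[< exists i, h i = n >].
have exQ : exists n, Q n by exists (h 0%N); apply/asboolP; exists 0%N.
case: (ex_minnP exQ) => n /asboolP[i0 <-] nmin; exists i0 => i i0i.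
apply/eqP; rewrite eqn_leq hmono //=; apply: nmin.
by apply/asboolP; exists i.
Qed.

Lemma not_subset (T : Type) (X Y : set T) : ~ X `<=` Y -> exists2 x, X x & ~ Y x.
Proof.
move=> nXY; apply: contrapT => H; apply: nXY => x Xx.
by apply: contrapT => nYx; apply: H; exists x.
Qed.

Section Homogeneous.
Variables (k : fieldType) (A : algType k) (prA : nat -> A -> A).
Hypothesis gA : graded_algebra prA.
Variables (M : lmodType A) (pr : nat -> M -> M).
Hypothesis gM : graded_module prA pr.
Local Notation prAo := (prA : nat -> A^o -> A^o).

Lemma pr_hom_r i j x : pr i x = x -> forall a, pr (j + i) (a *: x) = prA j a *: x.
Proof.
move=> xi a; have [b0 Hb] := pr_bound gA (a : A^o).
have [b [bb jb]] : exists b, (b0 <= b)%N /\ (j < b)%N.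
  by exists (maxn b0 j.+1); rewrite leq_maxl leq_maxr.
have aE := @pr_expand _ _ _ _ _ gA b (a : A^o) (fun i bi => Hb i (leq_trans bb bi)).
rewrite [in LHS]aE scaler_suml (pr_sum gM) (bigD1 (Ordinal jb)) //=.
rewrite -{1}xi (pr_act gM) eqxx xi big1 ?addr0 // => l lj.
rewrite -{1}xi (pr_act gM) eqn_add2r; case: eqP => // jl.
by move: lj; rewrite -val_eqE /= jl eqxx.
Qed.

Lemma pr_hom_r_lt i n x : pr i x = x -> (n < i)%N -> forall a, pr n (a *: x) = 0.
Proof.
move=> xi ni a; have [b aE] := pr_fin gA (a : A^o).
rewrite [a]aE scaler_suml (pr_sum gM) big1 // => l _.
by rewrite -xi (pr_act gM); case: eqP => // E; move: ni; rewrite E; lia.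
Qed.

Lemma deg_le_scale i j a x : deg_le prAo i a -> deg_le pr j x ->
  deg_le pr (i + j) (a *: x).
Proof.
move=> Fa Fx n ijn; have aE := trunc_id gA Fa.
rewrite -[a]aE scaler_suml (pr_sum gM) big1 // => u _.
have hu : prA u (prA u a) = prA u a := pr_id gA u (a : A^o).
have ui := ltn_ord u; have un : (u <= n)%N by lia.
by rewrite -(subnKC un) (pr_hom gM _ hu) Fx ?scaler0 //; lia.
Qed.

Lemma pr_top_scale i j a x : deg_le prAo i a -> deg_le pr j x ->
  pr (i + j) (a *: x) = prA i a *: pr j x.
Proof.
move=> Fa Fx; have aE := trunc_id gA Fa.
rewrite -{1}[a]aE scaler_suml (pr_sum gM) big_ord_recr /=.
have hu u : prA u (prA u a) = prA u a := pr_id gA u (a : A^o).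
rewrite (pr_hom gM _ (hu i)) big1 ?add0r // => u _.
have ui := ltn_ord u; have -> : (i + j = u + (i - u + j))%N by lia.
by rewrite (pr_hom gM _ (hu u)) Fx ?scaler0 //; lia.
Qed.

(** The submodule N + A m, when N is a submodule. *)
Definition coset_cyclic (N : set M) (m : M) : set M :=
  [set q | exists a, N (q - a *: m)].

Lemma coset_cyclic_gsub N m i : gsub pr N -> pr i m = m ->
  gsub pr (coset_cyclic N m).
Proof.
move=> [sN gN] mi; split.
  apply/submoduleP; split; first by exists 0; rewrite scale0r subr0; exact: submod0.
  move=> a x y [b Hb] [c Hc]; exists (a * b + c).
  have -> : a *: x + y - (a * b + c) *: m = a *: (x - b *: m) + (y - c *: m).
    by rewrite scalerBr scalerDl opprD scalerA addrACA.
  by apply: submodD => //; exact: submodZ.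
move=> n q [a Ha]; have := gN n _ Ha; rewrite (prB gM).
have [ni|jn] := ltnP n i.
  by rewrite (pr_hom_r_lt mi ni) subr0 => Hq; exists 0; rewrite scale0r subr0.
by rewrite -{2}(subnK jn) (pr_hom_r _ mi) => Hq; exists (prA (n - i)%N a).
Qed.

Lemma coset_cyclic_sub N m : submodule N -> N `<=` coset_cyclic N m.
Proof. by move=> sN x Nx; exists 0; rewrite scale0r subr0. Qed.

Lemma coset_cyclic_gen N m : submodule N -> coset_cyclic N m m.
Proof. by move=> sN; exists 1; rewrite scale1r subrr; exact: submod0. Qed.

Lemma coset_cyclic_min N m X : submodule X -> N `<=` X -> X m ->
  coset_cyclic N m `<=` X.
Proof.
move=> sX NX Xm q [a Ha]; rewrite -(subrK (a *: m) q).
by apply: submodD => //; [exact: NX|exact: submodZ].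
Qed.

Lemma gsub_not_hom N X : gsub pr N -> submodule X -> ~ N `<=` X ->
  exists i m, [/\ N m, pr i m = m & ~ X m].
Proof.
move=> gN sX nNX; apply: contrapT => H; apply: nNX.
apply: (gsub_hom gM gN sX) => n x Nx xn; apply: contrapT => nXx.
by apply: H; exists n, x.
Qed.

End Homogeneous.

(** * Graded two-sided ideals and primeness *)

Section GradedIdeals.
Variables (k : fieldType) (A : algType k) (prA : nat -> A -> A).
Hypothesis gA : graded_algebra prA.
Local Notation prAo := (prA : nat -> A^o -> A^o).
Implicit Types (I J L : set A).

Definition gideal I : Prop := gsub prAo I /\ forall x a, I x -> I (x * a).

Definition prime_elt I : Prop :=
  forall x y, (forall a, I (x * a * y)) -> I x \/ I y.

Let sI I : gideal I -> submodule (I : set A^o). Proof. by case=> -[]. Qed.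

Lemma gideal_mull I a x : gideal I -> I x -> I (a * x).
Proof. by move=> gI; exact: (submodZ a (sI gI)). Qed.

Lemma gidealI I J : gideal I -> gideal J -> gideal (I `&` J).
Proof.
move=> [gI rI] [gJ rJ]; split; first exact: gsubI.
by move=> x a [? ?]; split; [exact: rI|exact: rJ].
Qed.

Lemma gideal_sum I J : gideal I -> gideal J ->
  gideal (sum_set (I : set A^o) (J : set A^o)).
Proof.
move=> [gI rI] [gJ rJ]; split; first exact: (gsub_sum gA).
move=> _ a [x Ix [y Jy <-]]; exists (x * a); first exact: rI.
by exists (y * a); [exact: rJ|rewrite -mulrDl].
Qed.

Lemma prA_id n x : prA n (prA n x) = prA n x.
Proof. exact: (pr_id gA n (x : A^o)). Qed.

Lemma hom_mul i j x y : prA i x = x -> prA j y = y -> prA (i + j) (x * y) = x * y.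
Proof. by move=> xi yj; have := pr_hom gA j xi (y : A^o); rewrite yj. Qed.

(* Over a graded ideal, primeness may be tested on homogeneous elements:
   compare the leading components modulo the ideal. *)
Lemma prime_elt_hom I : gideal I ->
  (forall i j x y, prA i x = x -> prA j y = y -> (forall a, I (x * a * y)) ->
     I x \/ I y) -> prime_elt I.
Proof.
move=> gI Ihom x y Ixy; apply: contrapT => /not_orP[nIx nIy].
have [[sIo gIo] rI] := gI.
(* i is the degree of z modulo I: all components of z above i lie in I. *)
have top z : ~ I z -> exists i, ~ I (prA i z) /\ I (z - trunc prAo i z).
  move=> nIz; pose Q i := `[< ~ I (prA i z) >].
  have [b Hb] := pr_bound gA (z : A^o).
  have exQ : exists i, Q i.
    apply: contrapT => H; apply: nIz; have [c zE] := pr_fin gA (z : A^o).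
    rewrite zE; apply: (@submod_sum _ A^o) => // i _; apply: contrapT => nI.
    by apply: H; exists i; apply/asboolP.
  have Qb i : Q i -> (i <= b)%N.
    move=> /asboolP nI; rewrite leqNgt; apply/negP => /ltnW/Hb E; apply: nI.
    by rewrite [prA i z]E; exact: submod0 sIo.
  case: (ex_maxnP exQ Qb) => i /asboolP nI imax; exists i; split=> //.
  have [c zE] := pr_fin gA (z - trunc prAo i z : A^o).
  rewrite zE; apply: (@submod_sum _ A^o) => // j _.
  rewrite (prB gA) (pr_trunc gA); case: leqP => ji.
    by rewrite subrr; exact: submod0.
  rewrite subr0; apply: contrapT => nIj.
  by have := imax j (introT (asboolP _) nIj); rewrite leqNgt ji.
have [i [nIi Ii]] := top x nIx; have [j [nIj Ij]] := top y nIy.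
suff H m a : prA m a = a -> I (prA i x * a * prA j y).
  have [] // := Ihom i j (prA i x) (prA j y) (prA_id _ _) (prA_id _ _).
  move=> a; have [b aE] := pr_fin gA (a : A^o).
  rewrite [a]aE mulr_sumr mulr_suml; apply: (@submod_sum _ A^o) => // m _.
  by apply: (H m); exact: prA_id.
move=> am; set tx := trunc prAo i x; set ty := trunc prAo j y.
(* Modulo I, x and y may be replaced by their truncations; the top component of the resulting
   product is the element wanted. *)
have It : I (tx * a * ty).
  have -> : tx * a * ty = x * a * y - ((x - tx) * (a * y) + tx * a * (y - ty)).
    by rewrite mulrBl mulrBr !mulrA addrA subrK opprB addrC subrK.
  apply: (submodB sIo) => //; apply: (submodD sIo); first exact: rI.
  exact: gideal_mull.
have Fa : deg_le prAo m a.
  move=> n mn; rewrite -am (pr_pr gA n m (a : A^o)).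
  by case: eqP => // E; move: mn; rewrite E ltnn.
have Fx : deg_le prAo i tx := trunc_deg_le gA (x : A^o).
have Fy : deg_le prAo j ty := trunc_deg_le gA (y : A^o).
have := gIo (i + (m + j))%N _ It; rewrite -mulrA.
have := pr_top_scale gA gA Fx
  (deg_le_scale gA gA Fa Fy : deg_le prAo (m + j) (a *: (ty : A^o))).
rewrite /= => ->.
have := pr_top_scale gA gA Fa Fy; rewrite /= => ->; rewrite am.
have -> : prA i tx = prA i x by have := pr_trunc gA i i (x : A^o); rewrite leqnn.
have -> : prA j ty = prA j y by have := pr_trunc gA j j (y : A^o); rewrite leqnn.
by rewrite [_ *: _]mulrA.
Qed.

Lemma prime_elt_witness I x y : gideal I -> prime_elt I -> ~ I x -> ~ I y ->
  exists i a, prA i a = a /\ ~ I (x * a * y).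
Proof.
move=> gI pI nIx nIy; apply: contrapT => H.
have [] // := pI x y; move=> a; have [b aE] := pr_fin gA (a : A^o).
rewrite [a]aE mulr_sumr mulr_suml; apply: (@submod_sum _ A^o); first exact: sI.
move=> i _; apply: contrapT => nI; apply: H; exists i, (prA i a).
by split; first exact: prA_id.
Qed.

End GradedIdeals.

(** * Noetherian induction on the annihilator *)

Section MainInduction.
Variables (k : fieldType) (A : algType k) (prA : nat -> A -> A).
Hypothesis gA : graded_algebra prA.
Local Notation prAo := (prA : nat -> A^o -> A^o).
Hypothesis fA : fin_graded prAo.
Hypothesis noeA : noetherian_module (A^o : lmodType A).
Implicit Types (I J L : set A).

(** L / I is essential in A / I, tested on homogeneous elements. This and the next two conditions
    are statements on A / I lifted to A. *)
Definition graded_essential_mod I L : Prop :=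
  forall i x, prA i x = x -> ~ I x -> exists a, L (a * x) /\ ~ I (a * x).

Definition bounded_mod I : Prop :=
  forall L, gsub prAo L -> I `<=` L -> graded_essential_mod I L ->
    exists J, [/\ gideal prA J, J `<=` L & ~ J `<=` I].

Definition normal_mod I : Prop :=
  exists i x, [/\ (0 < i)%N, prA i x = x, ~ I x,
    forall a, exists b, I (x * a - b * x) &
    forall a, exists b, I (a * x - x * b)].

Definition annihilated (M : lmodType A) J (N' N : set M) : Prop :=
  forall a x, J a -> N x -> N' (a *: x).

(** The module is quantified here because the induction hypothesis is applied both to the given
    module and to A itself, where the uniform left ideal lives. *)
Definition all_good I : Prop :=
  forall (M : lmodType A) (pr : nat -> M -> M), graded_module prA pr ->
    fin_graded pr -> noetherian_module M ->
    forall N' N, gsub pr N' -> gsub pr N -> N' `<=` N -> annihilated I N' N ->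
    good pr N' N.

(** If A / I lives in degree 0, then N / N' has bounded degrees, hence finite dimension over k, and
    both exponents are 0: dimensions stop decreasing along a descending chain. *)
Lemma good_finite I (M : lmodType A) (pr : nat -> M -> M) N' N :
  graded_module prA pr -> fin_graded pr -> noetherian_module M ->
  gsub pr N' -> gsub pr N -> N' `<=` N -> annihilated I N' N ->
  (forall i x, (0 < i)%N -> prA i x = x -> I x) -> good pr N' N.
Proof.
move=> gM fM noeM gN' gN N'N IN HI; case: (pselect (N `<=` N')) => NN'; [by left|right].
have [[sN' pN'] [sN pN]] := (gN', gN).
(* Submodules, because positive degrees of A send N into N'. Where they become stationary bounds the
   degrees of N / N'. *)
pose X n := sum_set N' (N `&` deg_le pr n).
have F0 n : deg_le pr n 0 by move=> i _; exact: (pr0 gM).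
have sX n : submodule (X n).
  apply: (submodule_hom gA).
  - exists 0; first exact: submod0.
    exists 0; last by rewrite addr0.
    by split; [exact: submod0|exact: F0].
  - move=> _ _ [x N'x [y [Ny Fy] <-]] [x' N'x' [y' [Ny' Fy'] <-]].
    exists (x + x'); first exact: submodD.
    exists (y + y'); last by rewrite addrACA.
    split; first exact: submodD.
    by move=> i ni; rewrite (prD gM) Fy // Fy' // addr0.
  - move=> [|i] a _ ai [x N'x [y [Ny Fy] <-]]; rewrite scalerDr.
      exists (a *: x); first exact: submodZ.
      exists (a *: y) => //; split; first exact: submodZ.
      by move=> j nj; rewrite -[j]add0n (pr_hom gM _ ai) Fy // scaler0.
    exists (a *: x + a *: y); last first.
      by exists 0; [split; [exact: submod0|exact: F0]|rewrite addr0].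
    by apply: submodD => //; [exact: submodZ|apply: IN => //; exact: (HI i.+1)].
have [|D HD] := noeM X sX.
  move=> n _ [x N'x [y [Ny Fy] <-]]; exists x => //; exists y => //; split=> //.
  exact: (deg_le_mono (leqnSn n)).
have high n x : (D < n)%N -> N x -> N' (pr n x).
  move=> Dn Nx; have [b Fb] := deg_le_bound gM x.
  have : X (maxn b D) x.
    exists 0; first exact: submod0.
    by exists x; [split=> //; exact: (deg_le_mono (leq_maxl b D))|rewrite add0r].
  rewrite (HD _ (leq_maxr b D)) => -[y N'y [z [Nz Fz] <-]].
  by rewrite (prD gM) Fz // addr0; exact: pN'.
have low n x : (D <= n)%N -> N x -> deg_le pr n x -> N' (x - trunc pr D x).
  move=> Dn Nx Fx; have [c zE] := pr_fin gM (x - trunc pr D x).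
  rewrite zE; apply: submod_sum => // i _; rewrite (prB gM) (pr_trunc gM).
  case: leqP => iD; first by rewrite subrr; exact: submod0.
  by rewrite subr0; exact: high.
have hD n Q : (D <= n)%N -> gsub pr Q -> N' `<=` Q -> Q `<=` N ->
    hilb pr N' Q n = hilb pr N' Q D.
  move=> Dn gQ NQ QN; apply: (hilb_eq gA gM) => //.
  apply: (@has_rdim_map k (restrict_scalars M) (restrict_scalars M) id
    (N' `&` deg_le pr D) (Q `&` deg_le pr D)) => //.
  - apply: submoduleI; first by apply: submodule_restrict; case: gQ.
    exact: (deg_le_submodule gA gM).
  - apply: submoduleI; first exact: submodule_restrict.
    exact: (deg_le_submodule gA gM).
  - by move=> x [N'x Fx]; split=> //; exact: (deg_le_mono Dn).
  - by move=> x [Qx Fx] [].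
  - by move=> x [N'x Fx]; split=> //; exact: (deg_le_mono Dn).
  - move=> x [Qx Fx]; exists (trunc pr D x).
      by split; [exact: (trunc_gsub _ gQ)|exact: (trunc_deg_le gM)].
    split; first by apply: (low n) => //; exact: QN.
    apply: (deg_leB gM) => //; apply: (deg_le_mono Dn).
    exact: (trunc_deg_le gM).
  - exact: (hilbP gA gM).
have sub_of_hilb P Q : gsub pr P -> gsub pr Q -> N' `<=` P -> P `<=` Q -> Q `<=` N ->
    hilb pr P Q D = 0%N -> Q `<=` P.
  move=> gP gQ N'P PQ QN /(hilb_eq0 gA gM fM gP gQ) QP.
  have [sP _] := gP; apply: (gsub_hom gM gQ sP) => n x Qx xn.
  have [Dn|nD] := ltnP D n; first by apply: N'P; rewrite -xn; apply/high/QN.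
  apply: QP; split=> // j nj; rewrite -xn (pr_pr gM); case: eqP => // E.
  by move: nj; rewrite E ltnNge nD.
exists 0%N; split=> //.
- have h0 : (0 < hilb pr N' N D)%N.
    by rewrite lt0n; apply/eqP => h0; apply: NN'; exact: sub_of_hilb.
  exists (hilb pr N' N D + D)%N => [|n Cn]; first by rewrite addn_gt0 h0.
  rewrite (hD n) ?expn0 ?muln1 //; [|lia].
  by split; [rewrite muln_gt0 h0 addn_gt0 h0|exact: leq_addr].
- move=> C CP Cd.
  have CN' i : [/\ gsub pr (C i), N' `<=` C i & C i `<=` N] by have [? []] := CP i.
  have add i : hilb pr N' (C i) D = (hilb pr N' (C i.+1) D + hilb pr (C i.+1) (C i) D)%N.
    have [g1 h1 l1] := CN' i; have [g2 h2 l2] := CN' i.+1.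
    exact: (hilb_add gA gM fM).
  have [i|i0 Hi0] := @noninc_nat_stable (fun i => hilb pr N' (C i) D).
    by rewrite [X in (_ <= X)%N]add leq_addr.
  exists i0 => i ii0 /=; have [g1 h1 l1] := CN' i; have [g2 h2 l2] := CN' i.+1.
  apply: sub_of_hilb => //; have := add i.
  by rewrite (Hi0 i) // (Hi0 i.+1) ?(leqW ii0) //; lia.
- by move=> H; apply: NN'; rewrite H.
Qed.

(** * The induction step at a fixed ideal I *)

Section Step.
Variable I : set A.
Hypothesis gI : gideal prA I.
Hypothesis IH : forall J, gideal prA J -> I `<=` J -> ~ J `<=` I -> all_good J.

Let sI : submodule (I : set A^o). Proof. by case: gI => -[]. Qed.
Let ggI : gsub prAo I. Proof. by case: gI. Qed.
Let rI x a : I x -> I (x * a). Proof. by case: gI => _; apply. Qed.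
Let lI a x : I x -> I (a * x). Proof. exact: (gideal_mull a gI). Qed.

(** No nonzero graded submodule of N / N' is annihilated by a graded ideal strictly above I: over A
    / I, the subquotient is fully faithful in the graded sense. *)
Definition faithful_mod (M : lmodType A) (pr : nat -> M -> M) (N' N : set M) :=
  forall Q, gsub pr Q -> N' `<=` Q -> Q `<=` N ->
  forall J, gideal prA J -> I `<=` J -> ~ J `<=` I -> annihilated J N' Q ->
  Q `<=` N'.

(** J1 and J2 both strictly contain I, by x and y respectively, and J1 J2 lies in I. For the
    submodule P of elements that J1 sends into N', the factors P / N' and N / P are annihilated by
    J1 and J2, so both are good by induction. *)
Lemma good_not_prime (M : lmodType A) (pr : nat -> M -> M) N' N i j x y :
  graded_module prA pr -> fin_graded pr -> noetherian_module M ->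
  gsub pr N' -> gsub pr N -> N' `<=` N -> annihilated I N' N ->
  prA i x = x -> prA j y = y -> (forall a, I (x * a * y)) -> ~ I x -> ~ I y ->
  good pr N' N.
Proof.
move=> gM fM noeM gN' gN N'N IN xi yj Ixy nIx nIy.
have [[sN' pN'] [sN pN]] := (gN', gN).
pose J1 := [set z | forall a, I (z * a * y)].
pose J2 := [set w | forall z, J1 z -> forall a, I (z * a * w)].
have gJ1 : gideal prA J1.
  split; first split.
  - apply/submoduleP; split=> [a|a z w Jz Jw b].
      by rewrite !mul0r; exact: submod0 sI.
    have -> : (a *: z + w) * b * y = a * (z * b * y) + w * b * y.
      by rewrite !mulrDl [a *: z]/(a * z) !mulrA.
    by apply: (submodD sI); [exact/lI/Jz|exact: Jw].
  - move=> n z Jz a; have [b aE] := pr_fin gA (a : A^o).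
    rewrite [a]aE mulr_sumr mulr_suml; apply: (@submod_sum _ A^o) => // u _.
    have hu := prA_id gA u a.
    have hy := hom_mul gA hu yj.
    have -> : prA n z * prA u a * y = prA (n + (u + j)) (z * (prA u a * y)).
      rewrite -mulrA; symmetry; exact: (pr_hom_r gA gA _ (hy : prAo _ (_ : A^o) = _)).
    by case: ggI => _; apply; rewrite mulrA; exact: Jz.
  - by move=> z c Jz a; rewrite -[z * c * a]mulrA; exact: Jz.
have gJ2 : gideal prA J2.
  split; first split.
  - apply/submoduleP; split=> [z _ a|c w w' Jw Jw' z Jz a].
      by rewrite mulr0; exact: submod0 sI.
    rewrite mulrDr; apply: (submodD sI); last exact: Jw'.
    by rewrite [c *: w]/(c * w) mulrA -[z * a * c]mulrA; exact: Jw.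
  - move=> n w Jw z Jz a; have [b aE] := pr_fin gA (a : A^o).
    have [c zE] := pr_fin gA (z : A^o).
    rewrite [z]zE !mulr_suml; apply: (@submod_sum _ A^o) => // v _.
    rewrite [a]aE mulr_sumr mulr_suml; apply: (@submod_sum _ A^o) => // u _.
    have hu := prA_id gA u a; have hv := prA_id gA v z.
    have hvu := hom_mul gA hv hu.
    have -> : prA v z * prA u a * prA n w = prA (v + u + n) (prA v z * prA u a * w).
      symmetry; exact: (pr_hom gA n hvu (w : A^o)).
    by case: ggI => _; apply; apply: Jw; case: gJ1 => -[_ h] _; exact: h.
  - by move=> w c Jw z Jz a; rewrite mulrA; apply: rI; exact: Jw.
have IJ1 : I `<=` J1 by move=> z Iz a; rewrite -mulrA; exact: rI.
have IJ2 : I `<=` J2 by move=> w Iw z _ a; exact: lI.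
have nJ1 : ~ J1 `<=` I by move=> /(_ x Ixy).
have nJ2 : ~ J2 `<=` I.
  by move=> H; apply: nIy; apply: H => z Jz a; exact: Jz.
have J12 z w : J1 z -> J2 w -> I (z * w).
  by move=> Jz Jw; rewrite -[z]mulr1; exact: Jw.
pose P := [set p | N p /\ forall z, J1 z -> N' (z *: p)].
have gP : gsub pr P.
  split.
    apply/submoduleP; split.
      by split=> [|z _]; [exact: submod0|rewrite scaler0; exact: submod0].
    move=> a p q [Np Hp] [Nq Hq]; split.
      by apply: submodD => //; exact: submodZ.
    move=> z Jz; rewrite scalerDr scalerA; apply: submodD => //; last exact: Hq.
    by apply: Hp; case: gJ1 => _; apply.
  move=> n p [Np Hp]; split; first exact: pN.
  move=> z Jz; have [c zE] := pr_fin gA (z : A^o).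
  rewrite [z]zE scaler_suml; apply: submod_sum => // u _.
  rewrite -(pr_hom gM n (prA_id gA u z)); apply: pN'; apply: Hp.
  by case: gJ1 => -[_ h] _; exact: h.
have N'P : N' `<=` P by move=> p N'p; split; [exact: N'N|move=> z _; exact: submodZ].
have PN : P `<=` N by move=> p [].
apply: (good_ext gA gM fM gN' gP gN) => //.
  by apply: (IH gJ1) => // z p Jz [_]; apply.
apply: (IH gJ2) => // w m Jw Nm; split; first exact: submodZ.
by move=> z Jz; rewrite scalerA; apply: IN => //; exact: J12.
Qed.

(** Normality makes I + A x two-sided and multiplication by x semilinear: moving x past a on one
    side gives [sh_pull], on the other [sh_push]. The cokernel is annihilated by the larger ideal I
    + A x. *)
Lemma good_normal (M : lmodType A) (pr : nat -> M -> M) N' N :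
  graded_module prA pr -> fin_graded pr -> noetherian_module M ->
  gsub pr N' -> gsub pr N -> N' `<=` N -> annihilated I N' N ->
  faithful_mod pr N' N -> normal_mod I -> good pr N' N.
Proof.
move=> gM fM noeM gN' gN N'N IN ff [i [x [i0 xi nIx xl xr]]].
have [[sN' pN'] [sN pN]] := (gN', gN).
case: (pselect (N `<=` N')) => NN'; first by left.
pose J : set A := coset_cyclic (I : set A^o) x.
have xio : prAo i (x : A^o) = x by [].
have gJ : gideal prA J.
  split; first exact: (coset_cyclic_gsub gA gA ggI xio).
  move=> z c [a Ha]; have [b Hb] := xl c; exists (a * b).
  have -> : z * c - (a * b) *: (x : A^o) = (z - a * x) * c + a * (x * c - b * x).
    by rewrite mulrBl mulrBr !mulrA addrA subrK.
  by apply: (submodD sI); [exact: rI|exact: lI].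
have IJ : I `<=` J by exact: (@coset_cyclic_sub k A A^o I x sI).
have Jx : J x := @coset_cyclic_gen k A A^o I x sI.
have nJI : ~ J `<=` I by move=> /(_ x Jx).
pose f (m : M) := x *: m.
have INs m z : N m -> I z -> N' (z *: m) by move=> Nm Iz; exact: IN.
have sf : graded_shift pr pr f i N' N N'.
  split.
  - by move=> u v; rewrite /f scalerDr.
  - by move=> c u; rewrite /f !scalerA mulr_algl mulr_algr.
  - by move=> n u; rewrite addnC; exact: (pr_hom gM).
  - by move=> n u ni; exact: (pr_hom_lt gM xi ni).
  - by move=> u; exact: submodZ.
  (* The kernel modulo N' is annihilated by I + A x, so faithfulness makes it vanish. *)
  - pose Q := [set u | N u /\ N' (x *: u)].
    suff QN' : Q `<=` N' by move=> u Nu fu; apply: QN'.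
    apply: (ff Q _ _ _ J) => //.
    + split.
        apply/submoduleP; split; first by split; [|rewrite scaler0]; exact: submod0.
        move=> a u v [Nu xu] [Nv xv]; split.
          by apply: submodD => //; exact: submodZ.
        rewrite scalerDr scalerA; apply: submodD => //.
        have [b Hb] := xl a; rewrite -[x * a](subrK (b * x)) scalerDl.
        by apply: submodD; [|exact: INs|rewrite -scalerA; exact: submodZ].
      move=> n u [Nu xu]; split; first exact: pN.
      by rewrite -(pr_hom gM n xi); exact: pN'.
    + by move=> u N'u; split; [exact: N'N|exact: submodZ].
    + by move=> u [].
    + move=> z u [a Ha] [Nu xu]; rewrite -[z](subrK (a * x)) scalerDl.
      by apply: submodD; [|exact: INs|rewrite -scalerA; exact: submodZ].
  - move=> a u Nu; have [b Hb] := xr a; exists b.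
    by rewrite /f !scalerA -scalerBl; exact: INs.
  - move=> a u Nu; have [b Hb] := xl a; exists b.
    by rewrite /f !scalerA -scalerBl; exact: INs.
have fN u : N u -> N (f u) by exact: submodZ.
have gim : gsub pr (shift_im f N' N) by exact: (shift_im_gsub gM sf).
have imN : shift_im f N' N `<=` N by exact: (self_shift_im_sub gN N'N fN sN).
have Jim : annihilated J (shift_im f N' N) N.
  have [sim _] := gim.
  move=> z u [a Ha] Nu; rewrite -[z](subrK (a * x)) scalerDl; apply: submodD => //.
    by apply: (shift_im_min sf sN); exact: INs.
  rewrite -scalerA; apply: submodZ => //.
  by exists (f u); [exists u|exists 0; [exact: submod0|rewrite addr0]].
have [Nim|[e [e1 e2 e3]]] := IH gJ IJ nJI gM fM noeM gim gN imN Jim.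
  by left; exact: (self_shift_proper gM sf gN' gN i0 Nim).
right; exists e.+1; split.
- exact: (growth_self_shift gA gM fM sf).
- apply: (gdev_self_shift gM sf) => // X sX u Xu; exact: submodZ.
- exact: (Kdim_self_shift gM sf).
Qed.

(** * The bounded prime case: uniform left ideals *)

Section Bounded.
Hypothesis pI : prime_elt I.
Hypothesis bI : bounded_mod I.

(** K is taken maximal among the left ideals in U0 that meet some nonzero Y trivially modulo I; such
    a Y is uniform. Indeed, if Y1 and Y2 in Y met trivially, then K + Y1 would meet Y2 trivially, so
    Y1 would lie in both K and Y. *)
Lemma uniform_exists U0 : gsub prAo U0 -> I `<=` U0 -> ~ U0 `<=` I ->
  exists U, [/\ gsub prAo U, I `<=` U, U `<=` U0, ~ U `<=` I &
    forall Y1 Y2, gsub prAo Y1 -> gsub prAo Y2 -> I `<=` Y1 -> I `<=` Y2 ->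
      Y1 `<=` U -> Y2 `<=` U -> ~ Y1 `<=` I -> ~ Y2 `<=` I ->
      ~ Y1 `&` Y2 `<=` I].
Proof.
move=> gU0 IU0 nU0.
pose F (K : set A^o) := [/\ gsub prAo K, I `<=` K, K `<=` U0 & exists Y,
  [/\ gsub prAo Y, I `<=` Y, Y `<=` U0, ~ Y `<=` I & K `&` Y `<=` I]].
have [||K [gK IK KU0 [Y [gY IY YU0 nY KY]]] Kmax] := @noetherian_max _ _ F noeA.
- by move=> N [[]].
- by exists I; split=> //; exists U0; split=> //; exact: subIsetl.
exists Y; split=> // Y1 Y2 gY1 gY2 IY1 IY2 Y1Y Y2Y nY1 nY2 Y12.
have [[sK _] [sY _] [sU0 _]] := And3 gK gY gU0.
have [[sY1 _] [sY2 _]] := (gY1, gY2).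
have Y1K : Y1 `<=` K.
  apply: (@subset_trans _ (sum_set (K : set A^o) Y1)); first exact: sum_setr.
  apply: Kmax; last exact: sum_setl.
  split.
  - exact: (gsub_sum gA).
  - by move=> x /IK; exact: sum_setl.
  - by move=> _ [x Kx [y Yy <-]]; apply: (submodD sU0); [exact: KU0|exact/YU0/Y1Y].
  - exists Y2; split=> //; first by move=> x /Y2Y/YU0.
    move=> _ [[x Kx [y Yy <-]] Y2xy].
    have Ix : I x.
      apply: KY; split=> //; rewrite -(addrK y x).
      by apply: (submodB sY); [exact: Y2Y|exact: Y1Y].
    apply: (submodD sI) => //; apply: Y12; split=> //.
    by rewrite -(addKr x y); apply: (submodD sY2) => //; apply: (submodN sY2); exact: IY2.
by apply: nY1 => x Y1x; apply: KY; split; [exact: Y1K|exact: Y1Y].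
Qed.

Section Uniform.
Variable U : set A.
Hypothesis gU : gsub prAo U.
Hypothesis IU : I `<=` U.
Hypothesis nU : ~ U `<=` I.
Hypothesis uU : forall Y1 Y2, gsub prAo Y1 -> gsub prAo Y2 -> I `<=` Y1 ->
  I `<=` Y2 -> Y1 `<=` U -> Y2 `<=` U -> ~ Y1 `<=` I -> ~ Y2 `<=` I ->
  ~ Y1 `&` Y2 `<=` I.
Let sU : submodule (U : set A^o). Proof. by case: gU. Qed.

(** Uniformity makes the left ideal of all a with a v in K essential modulo I: either x v already
    lies in I, or the left ideal I + A x v meets K outside I. Boundedness then provides J. *)
Lemma annihilator_elt K i (v : A) : gsub prAo K -> I `<=` K -> K `<=` U -> ~ K `<=` I ->
  prA i v = v -> U v ->
  exists J, [/\ gideal prA J, forall a, J a -> K (a * v) & ~ J `<=` I].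
Proof.
move=> gK IK KU nK vi Uv; have [sK pK] := gK.
pose L : set A := [set a | K (a * v)].
suff [J [gJ JL nJ]] : exists J, [/\ gideal prA J, J `<=` L & ~ J `<=` I] by exists J.
apply: bI.
- split.
    apply/submoduleP; split; first by rewrite /L /= mul0r; exact: submod0 sK.
    move=> a x y Lx Ly; rewrite /L /= mulrDl; apply: (submodD sK) => //.
    by rewrite [a *: x]/(a * x) -mulrA; exact: (submodZ a sK).
  move=> n a La; rewrite /L /=.
  rewrite -[prA n a * v](pr_hom_r gA gA n (vi : prAo i (v : A^o) = v) a).
  exact: pK.
- by move=> x Ix; exact/IK/rI.
- move=> j x xj nIx; case: (pselect (I (x * v))) => Ixv.
    by exists 1; rewrite mul1r; split=> //; exact: IK.
  have xvh : prAo (j + i) (x * v : A^o) = x * v by exact: hom_mul.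
  pose Y := coset_cyclic (I : set A^o) (x * v : A^o).
  have gY : gsub prAo Y := coset_cyclic_gsub gA gA ggI xvh.
  have /not_subset[y [[a Ha] Ky] nIy] : ~ Y `&` K `<=` I.
    apply: uU => //.
    - exact: (@coset_cyclic_sub k A A^o I (x * v) sI).
    - apply: (@coset_cyclic_min k A A^o I (x * v) U sU IU).
      exact: (submodZ x sU).
    - move=> H; apply/Ixv/H; exact: (@coset_cyclic_gen k A A^o I (x * v) sI).
  exists a; split.
    rewrite /L /= -mulrA -(subKr y (a * (x * v))).
    by apply: (submodB sK) => //; exact: IK.
  move=> Iax; apply: nIy; rewrite -(subrK (a * (x * v)) y).
  by apply: (submodD sI) => //; rewrite mulrA; exact: rI.
Qed.

(** The ideals of finitely many homogeneous generators of U are intersected; as I is prime and the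
    intersection contains their product, it stays outside I. The finiteness takes the form of a
    maximal W. *)
Lemma annihilator_quotient K : gsub prAo K -> I `<=` K -> K `<=` U -> ~ K `<=` I ->
  exists J, [/\ gideal prA J, I `<=` J, ~ J `<=` I &
    annihilated J (K : set A^o) (U : set A^o)].
Proof.
move=> gK IK KU nK; have [sK pK] := gK.
suff [J [gJ nJ JU]] : exists J, [/\ gideal prA J, ~ J `<=` I &
    annihilated J (K : set A^o) (U : set A^o)].
  have [[sJ _] _] := gJ.
  exists (sum_set (I : set A^o) (J : set A^o)); split.
  - exact: gideal_sum.
  - exact: (@sum_setl _ A^o I J sJ).
  - by move=> H; apply: nJ => x Jx; apply: H; exact: (@sum_setr _ A^o I J sI).
  - move=> _ u [x Ix [y Jy <-]] Uu; rewrite scalerDl; apply: (submodD sK).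
      exact/IK/rI.
    exact: JU.
pose F (W : set A^o) := [/\ gsub prAo W, W `<=` U & exists J,
  [/\ gideal prA J, ~ J `<=` I & annihilated J (K : set A^o) W]].
have [||W [gW WU [J [gJ nJ JW]]] Wmax] := @noetherian_max _ _ F noeA.
- by move=> N [[]].
- exists K; split=> //; exists [set: A]; split.
  + by split=> //; exact: gsubT.
  + by move=> H; apply: nU => x _; exact: H.
  + by move=> a x _ Kx; exact: (submodZ a sK).
have [sW _] := gW; exists J; split=> //.
suff UW : U `<=` W by move=> a x Ja /UW; exact: JW.
apply: contrapT => nUW.
have [i [v [Uv vi nWv]]] := gsub_not_hom gA gU sW nUW.
have [J' [gJ' JK nJ']] := annihilator_elt gK IK KU nK vi Uv.
apply: nWv; apply: (Wmax (coset_cyclic W v)).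
- split; first exact: (coset_cyclic_gsub gA gA gW vi).
    exact: coset_cyclic_min.
  exists (J `&` J'); split; first exact: gidealI.
    move=> H; have [j Jj nIj] := not_subset nJ.
    have [j' Jj' nIj'] := not_subset nJ'.
    have [_ [a [_ nI]]] := prime_elt_witness gA gI pI nIj nIj'.
    apply: nI; apply: H; split; last exact: (gideal_mull _ gJ').
    by rewrite -mulrA; case: gJ => _; apply.
  move=> z q [Jz Jz'] [a Ha]; rewrite -[q](subrK (a *: (v : A^o))) scalerDr.
  apply: (submodD sK); first exact: JW.
  by rewrite scalerA; apply: JK; case: gJ' => _; apply.
- exact: coset_cyclic_sub.
- exact: coset_cyclic_gen.
Qed.

(** Right multiplication commutes with the action of A; injectivity modulo I is the point. If the
    kernel K were nonzero, some J above I would send U into K, so J w c would lie in I, against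
    primeness since w c does not. *)
Lemma shift_right_mult i c w : prA i c = c -> U w -> ~ I (w * c) ->
  graded_shift prAo prAo (fun a => a * c) i I U I.
Proof.
move=> ci Uw nwc; split.
- by move=> x y; rewrite mulrDl.
- by move=> a x; rewrite [RHS]mulrA.
- by move=> n x; exact: (pr_hom_r gA gA n (ci : prAo i (c : A^o) = c) x).
- by move=> n x ni; exact: (pr_hom_r_lt gA gA (ci : prAo i (c : A^o) = c) ni x).
- by move=> x; exact: rI.
- pose K : set A := [set v | U v /\ I (v * c)].
  suff KI : K `<=` I by move=> x Ux Ixc; exact: KI.
  apply: contrapT => nK.
  have gK : gsub prAo K.
    split.
      apply/submoduleP; split.
        by split; rewrite ?mul0r; [exact: submod0 sU|exact: submod0 sI].
      move=> a x y [Ux Ix] [Uy Iy]; split.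
        by apply: (submodD sU) => //; exact: (submodZ a sU).
      rewrite mulrDl; apply: (submodD sI) => //.
      by rewrite [a *: x]/(a * x) -mulrA; exact: lI.
    move=> n x [Ux Ix]; split; first by case: gU => _; apply.
    rewrite -[prA n x * c](pr_hom_r gA gA n (ci : prAo i (c : A^o) = c) x).
    by case: ggI => _; apply.
  have [J [gJ IJ nJ JU]] : exists J, [/\ gideal prA J, I `<=` J, ~ J `<=` I &
      annihilated J (K : set A^o) (U : set A^o)].
    apply: annihilator_quotient => //; last by move=> x [].
    by move=> x Ix; split; [exact: IU|exact: rI].
  have [j Jj nIj] := not_subset nJ.
  have [_ [a [_ nI]]] := prime_elt_witness gA gI pI nIj nwc.
  apply: nI; rewrite mulrA.
  have Jja : J (j * a) by case: gJ => _; apply.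
  by have [] := JU _ _ Jja Uw.
- by move=> a x Ux; exists a; rewrite [a *: (_ * _)]mulrA subrr; exact: submod0 sI.
- by move=> a x Ux; exists a; rewrite [a *: (_ * _)]mulrA subrr; exact: submod0 sI.
Qed.

(* Multiplication on the right by a homogeneous u in U of positive degree
   embeds U into itself modulo I. *)
Lemma good_uniform i z : (0 < i)%N -> prA i z = z -> ~ I z ->
  good prAo (I : set A^o) (U : set A^o).
Proof.
move=> i0 zi nIz.
have [j [w [Uw wj nIw]]] := gsub_not_hom gA gU sI nU.
(* Every nonzero K contains homogeneous c with w c outside I. Primeness is used twice: to pass
   through x, which forces the degree up to m, and to attach w on the left. *)
have shiftK K : gsub prAo K -> K `<=` U -> ~ K `<=` I ->
    forall m x, prA m x = x -> ~ I x ->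
    exists l c, [/\ prA l c = c, K c, (m <= l)%N & ~ I (w * c)].
  move=> gK KU nK m x xm nIx; have [sK _] := gK.
  have [l [y [Ky yl nIy]]] := gsub_not_hom gA gK sI nK.
  have [n [a [an nI]]] := prime_elt_witness gA gI pI nIx nIy.
  have [n' [a' [an' nI']]] := prime_elt_witness gA gI pI nIw nI.
  exists (n' + ((m + n) + l))%N, (a' * (x * a * y)); split.
  - by apply: hom_mul => //; apply: hom_mul => //; exact: hom_mul.
  - by do 2!apply: (submodZ _ sK).
  - by lia.
  - by rewrite [w * _]mulrA.
have [d [u [ud Uu id nIwu]]] := shiftK U gU (@subset_refl _ U) nU i z zi nIz.
have d0 : (0 < d)%N by lia.
pose f (a : A^o) : A^o := a * u.
have sf : graded_shift prAo prAo f d I U I := shift_right_mult ud Uw nIwu.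
have fU x : U x -> U (f x) by move=> Ux; exact: (submodZ x sU).
have gim : gsub prAo (shift_im f I U) by exact: (shift_im_gsub gA sf).
have imU : shift_im f I U `<=` U by exact: (self_shift_im_sub gU IU fU sU).
have Iim : I `<=` shift_im f I U by exact: (shift_im_min sf).
have nim : ~ shift_im f I U `<=` I.
  move=> H; apply: nIwu; apply: H; exists (w * u); first by exists w.
  by exists 0; [exact: (submod0 sI)|rewrite addr0].
have [J [gJ IJ nJ JU]] := annihilator_quotient gim Iim imU nim.
have [Uim|[e [e1 e2 e3]]] := IH gJ IJ nJ gA fA noeA gim gU imU JU.
  by left; exact: (self_shift_proper gA sf ggI gU d0 Uim).
right; exists e.+1; split.
- exact: (growth_self_shift gA gA fA sf).
- have sub_tr (x y v : set A^o) : x `<=` y -> y `<=` v -> x `<=` v.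
    by move=> xy yv t /xy/yv.
  move=> C CP Cd.
  (* Once the chain meets I it is constant modulo I. Otherwise every term is nonzero modulo I, and
     it suffices to bound the dimension of U modulo each term. *)
  case: (pselect (exists i0, C i0 `<=` I)) => [[m Cm]|nC].
    exists m => l ml; apply: dev_lt_eq => //.
    have [_ [IC _]] := CP l.+1; apply: (sub_tr _ I) => //.
    by apply: (sub_tr _ (C m)) => //; elim: l ml {IC} => [|l IHl];
      [rewrite leqn0 => /eqP ->|rewrite leq_eqVlt => /orP[/eqP <- //|/IHl]; exact: sub_tr].
  exists 0%N => l _; have [gK [IK KU]] := CP l.+1; have [_ [_ CU]] := CP l.
  have nK : ~ C l.+1 `<=` I by move=> H; apply: nC; exists l.+1.
  suff H : gdev_lt prAo e.+1 (C l.+1) U by apply: dev_lt_sub H.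
  have [J' [gJ' IJ' nJ' JU']] := annihilator_quotient gK IK KU nK.
  have [UK|[d' [d1 d2 _]]] := IH gJ' IJ' nJ' gA fA noeA gK gU KU JU'.
    exact: dev_lt_eq.
  apply: dev_lt_leq d2 => //; rewrite ltnS.
  have [n [c [cn Kc _ nIwc]]] := shiftK (C l.+1) gK KU nK i z zi nIz.
  pose g (a : A^o) : A^o := a * c.
  have sg : graded_shift prAo prAo g n I U I := shift_right_mult cn Uw nIwc.
  have gimg : gsub prAo (shift_im g I U) by exact: (shift_im_gsub gA sg).
  have [sK _] := gK.
  have imK : shift_im g I U `<=` C l.+1.
    move=> _ [_ [x Ux <-] [y Iy <-]]; apply: submodD => //; last exact: IK.
    exact: (submodZ x sK).
  have Iimg : I `<=` shift_im g I U by exact: (shift_im_min sg).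
  (* U / K is a quotient of U / g(U), whose Hilbert function is a difference of values of that of U
     at distance n and so has exponent at most e. By induction the dimension of U / K is its growth
     exponent d', hence at most e. *)
  have [|||Kc' HKc'] := @poly_growth_diff (hilb prAo I U)
    (hilb prAo (shift_im f I U) U) d e d0 _ _ e1 n.
  + move=> m; rewrite (hilb_add gA gA fA _ ggI gim gU) //.
    by rewrite (hilb_shift gA gA gA fA fA sf).
  + move=> m md; rewrite (hilb_add gA gA fA _ ggI gim gU) //.
    by rewrite (hilb_shift_lt gA gA fA sf).
  + by move=> m m'; exact: (hilb_mono gA gA fA).
  apply: (@poly_growth_leq _ d' e (Kc' + n) d1) => m nm.
  have nm' : (n <= m)%N by lia.
  have := HKc' (m - n)%N; rewrite (subnK nm').
  rewrite (hilb_add gA gA fA m ggI gimg gU) //; last exact: sub_tr KU.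
  rewrite -{1}(subnK nm') (hilb_shift gA gA gA fA fA sg) // leq_add2l.
  rewrite (hilb_add gA gA fA m gimg gK gU) // => H.
  apply: leq_trans (leq_trans (leq_addl _ _) H) _.
  by rewrite leq_mul2r leq_addr orbT.
- exact: (Kdim_self_shift gA sf).
Qed.

End Uniform.

(** Let L be the annihilator of m modulo N'. If L were essential modulo I, boundedness would give an
    ideal above I annihilating A m, against faithfulness. So some left ideal I + A x meets L only in
    I, and acting on m embeds a uniform left ideal inside it into N / N'. *)
Lemma good_bounded (M : lmodType A) (pr : nat -> M -> M) N' N i z :
  graded_module prA pr -> fin_graded pr -> noetherian_module M ->
  gsub pr N' -> gsub pr N -> N' `<=` N -> ~ N `<=` N' -> annihilated I N' N ->
  faithful_mod pr N' N -> (0 < i)%N -> prA i z = z -> ~ I z ->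
  exists Q, [/\ gsub pr Q, N' `<=` Q, Q `<=` N, ~ Q `<=` N' & good pr N' Q].
Proof.
move=> gM fM noeM gN' gN N'N nNN' IN ff i0 zi nIz.
have [[sN' pN'] [sN pN]] := (gN', gN).
have [l [m [Nm ml nN'm]]] := gsub_not_hom gM gN sN' nNN'.
pose L : set A := [set a | N' (a *: m)].
have gL : gsub prAo L.
  split.
    apply/submoduleP; split; first by rewrite /L /= scale0r; exact: submod0.
    move=> a x y Lx Ly; rewrite /L /= scalerDl; apply: submodD => //.
    by rewrite [a *: x]/(a * x) -scalerA; exact: submodZ.
  by move=> n a La; rewrite /L /= -(pr_hom_r gA gM n ml); exact: pN'.
have IL : I `<=` L by move=> x Ix; exact: IN.
case: (pselect (graded_essential_mod I L)) => [/(bI gL IL)[J [gJ JL nJ]]|ness].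
  case: nN'm.
  have [[sJ _] rJ] := gJ.
  apply: (ff (coset_cyclic N' m) _ _ _ (sum_set (I : set A^o) (J : set A^o))).
  - exact: (coset_cyclic_gsub gA gM gN' ml).
  - exact: coset_cyclic_sub.
  - exact: coset_cyclic_min.
  - exact: gideal_sum.
  - exact: (@sum_setl _ A^o I J sJ).
  - by move=> H; apply: nJ => x Jx; apply: H; exact: (@sum_setr _ A^o I J sI).
  - move=> _ q [x Ix [y Jy <-]] [a Ha].
    have Nq : N q.
      by rewrite -(subrK (a *: m) q); apply: submodD => //; [exact: N'N|exact: submodZ].
    rewrite scalerDl; apply: submodD => //; first exact: IN.
    rewrite -(subrK (a *: m) q) scalerDr; apply: submodD => //; first exact: submodZ.
    by rewrite scalerA; apply: JL; exact: rJ.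
  - exact: coset_cyclic_gen.
have [j [x [xj nIx xL]]] : exists j x, [/\ prA j x = x, ~ I x &
    forall a, L (a * x) -> I (a * x)].
  apply: contrapT => H; apply: ness => j x xj nIx; apply: contrapT => H'.
  apply: H; exists j, x; split=> // a Lax; apply: contrapT => nI.
  by apply: H'; exists a.
have xjo : prAo j (x : A^o) = x by [].
pose U0 := coset_cyclic (I : set A^o) (x : A^o).
have [U [gU IU UU0 nU uU]] : exists U, [/\ gsub prAo U, I `<=` U, U `<=` U0, ~ U `<=` I &
    forall Y1 Y2, gsub prAo Y1 -> gsub prAo Y2 -> I `<=` Y1 -> I `<=` Y2 ->
      Y1 `<=` U -> Y2 `<=` U -> ~ Y1 `<=` I -> ~ Y2 `<=` I ->
      ~ Y1 `&` Y2 `<=` I].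
  apply: uniform_exists; first exact: (coset_cyclic_gsub gA gA ggI xjo).
    exact: (@coset_cyclic_sub k A A^o I x sI).
  by move=> H; apply/nIx/H; exact: (@coset_cyclic_gen k A A^o I x sI).
pose f (a : A^o) : M := (a : A) *: m.
have sf : graded_shift prAo pr f l I U N'.
  split.
  - by move=> u v; rewrite /f scalerDl.
  - by move=> c u; rewrite /f scalerA.
  - by move=> n u; exact: (pr_hom_r gA gM).
  - by move=> n u nl; exact: (pr_hom_r_lt gA gM ml nl).
  - by move=> u Iu; exact: IN.
  - move=> u /UU0[a Ha] N'u; rewrite -(subrK (a * x) u); apply: (submodD sI) => //.
    apply: xL; have [sL _] := gL; rewrite -(subKr u (a * x)).
    by apply: (submodB sL) => //; exact: IL.
  - by move=> a u Uu; exists a; rewrite /f scalerA subrr; exact: submod0.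
  - by move=> a u Uu; exists a; rewrite /f scalerA subrr; exact: submod0.
have [sU _] := gU.
exists (shift_im f N' U); split.
- exact: (shift_im_gsub gM sf).
- exact: (shift_im_min sf).
- by move=> _ [_ [a _ <-] [y N'y <-]]; apply: submodD; [|exact: submodZ|exact: N'N].
- move=> H; apply: nU => u Uu; apply: (sh_inj sf) => //; apply: H.
  by exists (f u); [exists u|exists 0; [exact: submod0|rewrite addr0]].
- apply: (good_shift gA gA gM fA fM sf) => //.
  exact: (good_uniform gU IU nU uU i0 zi nIz).
Qed.

End Bounded.
End Step.

(** A maximal bad ideal I can only be proper and prime with A / I nonzero in positive degree; all
    other cases are settled without [H]. *)
Theorem all_gideals_good :
  (forall I, gideal prA I -> ~ I 1 -> prime_elt I ->
     (exists i x, [/\ (0 < i)%N, prA i x = x & ~ I x]) ->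
     bounded_mod I \/ normal_mod I) ->
  forall I, gideal prA I -> all_good I.
Proof.
move=> H I0 gI0; apply: contrapT => bad.
pose F (J : set A^o) := gideal prA J /\ ~ all_good J.
have [||I [gI nI] Imax] := @noetherian_max _ _ F noeA.
- by move=> N [[[]]].
- by exists I0.
have IH J : gideal prA J -> I `<=` J -> ~ J `<=` I -> all_good J.
  by move=> gJ IJ nJI; apply: contrapT => nJ; apply/nJI/Imax.
apply: nI => M pr gM fM noeM N' N gN' gN N'N IN.
case: (pselect (I 1)) => I1.
  by left => x Nx; rewrite -[x]scale1r; exact: IN.
case: (pselect (forall i j x y, prA i x = x -> prA j y = y ->
    (forall a, I (x * a * y)) -> I x \/ I y)) => [pI|npI]; last first.
  apply: contrapT => ng; apply: npI => i j x y xi yj Ixy.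
  apply: contrapT => /not_orP[nIx nIy]; apply: ng.
  exact: (good_not_prime gI IH gM fM noeM gN' gN N'N IN xi yj Ixy).
have {}pI := prime_elt_hom gA gI pI.
case: (pselect (exists i x, [/\ (0 < i)%N, prA i x = x & ~ I x])) => [pos|npos]; last first.
  apply: (good_finite gM fM noeM gN' gN N'N IN) => i x i0 xi.
  by apply: contrapT => nIx; apply: npos; exists i, x.
have := H I gI I1 pI pos; case: pos => i [z [i0 zi nIz]] cond.
(* P is a largest submodule with P / N' good. It is all of N as soon as every nonzero N / P contains
   a nonzero good submodule; if N / P is not faithful, the induction hypothesis supplies one. *)
pose G P := [/\ gsub pr P, N' `<=` P, P `<=` N & good pr N' P].
have [||P [gP N'P PN goodP] Pmax] := @noetherian_max _ _ G noeM.
- by move=> P [[]].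
- by exists N'; split=> //; left.
case: (pselect (N `<=` P)) => NP.
  by have -> : N = P by apply/seteqP.
suff [Q [gQ PQ QN nQP goodQ]] : exists Q, [/\ gsub pr Q, P `<=` Q, Q `<=` N, ~ Q `<=` P &
    good pr P Q].
  case: nQP; apply: Pmax => //; split=> //; first exact: subset_trans PQ.
  exact: (good_ext gA gM fM gN' gP gQ).
have IP : annihilated I P N by move=> a x Ia Nx; apply/N'P/IN.
case: (pselect (faithful_mod I pr P N)) => [ff|nff]; last first.
  apply: contrapT => nQ; apply: nff => Q gQ PQ QN J gJ IJ nJI JQ.
  apply: contrapT => nQP; apply: nQ; exists Q; split=> //.
  exact: (IH J gJ IJ nJI _ pr).
case: cond => [bI|nI].
  exact: (good_bounded gI IH pI bI gM fM noeM gP gN PN NP IP ff i0 zi nIz).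
exists N; split=> //; exact: (good_normal gI IH gM fM noeM gP gN PN IP ff nI).
Qed.

End MainInduction.

(** * Projections of direct sums *)

Section DirectSum.
Variables (I : choiceType) (V : zmodType) (V_ : I -> set V).
Hypothesis V_zmod : forall i, GRing.zmod_closed [in V_ i].
Hypothesis V_sum : direct_sum V_.

Lemma dsum0 i : V_ i 0.
Proof. by apply/set_mem; case: (V_zmod i). Qed.

Lemma dsumB i x y : V_ i x -> V_ i y -> V_ i (x - y).
Proof.
move=> Vx Vy; apply/set_mem; case: (V_zmod i) => _; apply; exact: mem_set.
Qed.

Lemma dsumD i x y : V_ i x -> V_ i y -> V_ i (x + y).
Proof.
move=> Vx Vy; rewrite -[y]opprK; apply: dsumB => //.
by rewrite -[- y]add0r; apply: dsumB => //; exact: dsum0.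
Qed.

Lemma sum_widen (s u : seq I) (c : I -> V) : uniq s -> uniq u ->
  {subset s <= u} ->
  \sum_(i <- s) c i = \sum_(i <- u) (if i \in s then c i else 0).
Proof.
move=> us uu su; rewrite -big_mkcond -big_filter; apply: perm_big.
apply: uniq_perm => //; first exact: filter_uniq.
by move=> i; rewrite mem_filter; case: (boolP (i \in s)) => //= /su ->.
Qed.

Lemma dsum_uniq (s t : seq I) (c d : I -> V) : uniq s -> uniq t ->
  (forall i, V_ i (c i)) -> (forall i, V_ i (d i)) ->
  \sum_(i <- s) c i = \sum_(i <- t) d i ->
  forall i, (if i \in s then c i else 0) = (if i \in t then d i else 0).
Proof.
move=> us ut Vc Vd E i; have uu := undup_uniq (s ++ t).
have [_ inj] := V_sum.
pose e j := (if j \in s then c j else 0) - (if j \in t then d j else 0).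
have Ve j : V_ j (e j).
  by apply: dsumB; case: ifP => // _; exact: dsum0.
have sum0 : \sum_(j <- undup (s ++ t)) e j = 0.
  rewrite sumrB -!sum_widen ?E ?subrr // => j.
    by rewrite mem_undup mem_cat => ->; rewrite orbT.
  by rewrite mem_undup mem_cat => ->.
have := inj _ _ uu Ve sum0 i; rewrite mem_undup mem_cat.
case: (boolP (i \in s)) => is_; case: (boolP (i \in t)) => it_ //= /(_ isT);
  by rewrite /e ?(negbTE is_) ?(negbTE it_) ?is_ ?it_ => /subr0_eq.
Qed.

Definition dsum_decomposition (x : V) (sc : seq I * (I -> V)) : Prop :=
  [/\ uniq sc.1, forall i, V_ i (sc.2 i) & x = \sum_(i <- sc.1) sc.2 i].

Lemma dsum_decomposition_exists x : exists sc, dsum_decomposition x sc.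
Proof. by have [ex _] := V_sum; have [s [c Hc]] := ex x; exists (s, c). Qed.

Definition dsum_choice x : seq I * (I -> V) :=
  projT1 (cid (dsum_decomposition_exists x)).

(** In a decomposition the family c is total, but only its values on the list count. *)
Definition dsum_pr (i : I) (x : V) : V :=
  if i \in (dsum_choice x).1 then (dsum_choice x).2 i else 0.

Lemma dsum_choiceP x : dsum_decomposition x (dsum_choice x).
Proof. by rewrite /dsum_choice; case: cid. Qed.

Lemma dsum_pr_in i x : V_ i (dsum_pr i x).
Proof.
have [_ h _] := dsum_choiceP x; rewrite /dsum_pr.
by case: ifP => // _; exact: dsum0.
Qed.

Lemma dsum_pr_uniq (s : seq I) (c : I -> V) : uniq s -> (forall i, V_ i (c i)) ->
  forall i, dsum_pr i (\sum_(i <- s) c i) = if i \in s then c i else 0.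
Proof.
move=> us Vc i; have [h1 h2 h3] := dsum_choiceP (\sum_(i <- s) c i).
by rewrite /dsum_pr; apply: dsum_uniq.
Qed.

Lemma dsum_pr_sum x : exists s : seq I, [/\ uniq s, x = \sum_(i <- s) dsum_pr i x &
  forall i, i \notin s -> dsum_pr i x = 0].
Proof.
have [h1 h2 h3] := dsum_choiceP x; exists (dsum_choice x).1; split=> //.
  rewrite {1}h3 big_seq [RHS]big_seq; apply: eq_bigr => i i_s.
  by rewrite /dsum_pr i_s.
by move=> i /negbTE; rewrite /dsum_pr => ->.
Qed.

Lemma dsum_prD i x y : dsum_pr i (x + y) = dsum_pr i x + dsum_pr i y.
Proof.
have [s [us xE s0]] := dsum_pr_sum x; have [t [ut yE t0]] := dsum_pr_sum y.
have uu := undup_uniq (s ++ t).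
have wide z (r : seq I) : uniq r -> z = \sum_(i <- r) dsum_pr i z ->
    (forall i, i \notin r -> dsum_pr i z = 0) -> {subset r <= undup (s ++ t)} ->
    z = \sum_(i <- undup (s ++ t)) dsum_pr i z.
  move=> ur zE r0 ru; rewrite {1}zE (sum_widen _ ur uu ru); apply: eq_bigr => j _.
  by case: (boolP (j \in r)) => // /r0.
have xE' : x = \sum_(i <- undup (s ++ t)) dsum_pr i x.
  by apply: (wide _ s) => // j js; rewrite mem_undup mem_cat js.
have yE' : y = \sum_(i <- undup (s ++ t)) dsum_pr i y.
  by apply: (wide _ t) => // j js; rewrite mem_undup mem_cat js orbT.
have Vxy j : V_ j (dsum_pr j x + dsum_pr j y).
  by apply: dsumD; exact: dsum_pr_in.
rewrite {1}xE' {1}yE' -big_split /= dsum_pr_uniq //.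
rewrite mem_undup mem_cat; case: ifP => // /negbT; rewrite negb_or.
by case/andP=> /s0 -> /t0 ->; rewrite addr0.
Qed.

Lemma dsum_pr_hom i j x : V_ i x -> dsum_pr j x = if j == i then x else 0.
Proof.
move=> Vx; pose c l := if l == i then x else 0.
have Vc l : V_ l (c l) by rewrite /c; case: eqP => [->|_] //; exact: dsum0.
have xE : x = \sum_(l <- [:: i]) c l by rewrite big_seq1 /c eqxx.
by rewrite {1}xE dsum_pr_uniq // inE /c; case: eqP.
Qed.

Lemma dsum_pr0 i : dsum_pr i 0 = 0.
Proof. by rewrite (dsum_pr_hom i (dsum0 i)) if_same. Qed.

Lemma dsum_prN i x : dsum_pr i (- x) = - dsum_pr i x.
Proof. by apply: (addrI (dsum_pr i x)); rewrite -dsum_prD !subrr dsum_pr0. Qed.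

Lemma dsum_pr_big i (J : Type) (r : seq J) (F : J -> V) :
  dsum_pr i (\sum_(j <- r) F j) = \sum_(j <- r) dsum_pr i (F j).
Proof. by apply: (big_morph _ (dsum_prD i) (dsum_pr0 i)). Qed.

Lemma dsum_pr_inj x y : (forall i, dsum_pr i x = dsum_pr i y) -> x = y.
Proof.
move=> xy; apply/subr0_eq; have [s [_ -> _]] := dsum_pr_sum (x - y).
by apply: big1 => i _; rewrite dsum_prD dsum_prN xy subrr.
Qed.

End DirectSum.

Lemma submodule_zmod_closed (R : pzRingType) (M : lmodType R) (N : set M) :
  submodule N -> GRing.zmod_closed [in N].
Proof.
move=> sN; split; first by apply: mem_set; exact: submod0.
by move=> x y /set_mem Nx /set_mem Ny; apply: mem_set; exact: submodB.
Qed.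

Section AlgebraGrading.
Variables (k : fieldType) (A : algType k) (grA : nat -> set A).
Hypothesis grading_A : algebra_grading grA.

Lemma algebra_grading_zmod i : GRing.zmod_closed [in grA i].
Proof. by case: grading_A => h _ _ _; exact: (@submodule_zmod_closed k A). Qed.

Lemma algebra_grading_sum : direct_sum grA.
Proof. by case: grading_A. Qed.

Definition algebra_pr : nat -> A -> A := dsum_pr algebra_grading_sum.

Lemma algebra_pr_in i x : grA i (algebra_pr i x).
Proof. exact: (dsum_pr_in algebra_grading_zmod). Qed.

Lemma algebra_pr_hom i j x : grA i x -> algebra_pr j x = if j == i then x else 0.
Proof. exact: (dsum_pr_hom algebra_grading_zmod). Qed.

Lemma graded_algebra_pr : graded_algebra algebra_pr.
Proof.
have [gS gD g1 gM] := grading_A.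
split.
  split.
  - exact: (dsum_prD algebra_grading_zmod).
  - move=> n m x; rewrite (algebra_pr_hom n (algebra_pr_in m x)).
    by [].
  - move=> x; have [s [us xE s0]] := dsum_pr_sum algebra_grading_sum x.
    exists (\max_(i <- s) i).+1; rewrite -(big_mkord xpredT (algebra_pr^~ x)).
    rewrite {1}xE (@sum_widen _ _ s (index_iota 0 (\max_(i <- s) i).+1)) ?iota_uniq //.
      by apply: eq_bigr => i _; case: (boolP (i \in s)) => // /s0.
    by move=> i is_; rewrite mem_index_iota ltnS /= leq_bigmax_seq.
  - move=> n i j a x; rewrite (algebra_pr_hom n (gM i j _ _ _ _)) //;
    exact: algebra_pr_in.
move=> c; rewrite (@algebra_pr_hom 0) //.
by apply: (submodZ c (gS 0%N)).
Qed.

Lemma algebra_grading_converse : algebra_grading (A := A^c) grA.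
Proof.
have [gS gD g1 gM] := grading_A; split=> // i j a b Aa Ab.
by rewrite addnC; exact: gM.
Qed.

End AlgebraGrading.

Section ModuleGrading.
Variables (k : fieldType) (A : algType k) (grA : nat -> set A).
Hypothesis grading_A : algebra_grading grA.
Variables (M : lmodType A) (grM : int -> set M).
Hypothesis grading_M : module_grading grA grM.
Hypothesis fgM : finitely_generated M.

Lemma module_grading_zmod i : GRing.zmod_closed [in grM i].
Proof. by case: grading_M. Qed.

Lemma module_grading_sum : direct_sum grM.
Proof. by case: grading_M. Qed.

Local Notation prZ := (dsum_pr module_grading_sum).

Lemma module_prZ_hom i j a x : grA i a -> prZ (i%:Z + j) (a *: x) = a *: prZ j x.
Proof.
move=> Aa; have [s [us xE s0]] := dsum_pr_sum module_grading_sum x.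
have [_ _ gM] := grading_M.
rewrite {1}xE scaler_sumr (dsum_pr_big module_grading_zmod).
rewrite (eq_bigr (fun l => if l == j then a *: prZ j x else 0)) => [|l _].
  rewrite -big_mkcond /=; case: (boolP (j \in s)) => js.
    by rewrite -big_filter filter_pred1_uniq // big_seq1.
  rewrite (s0 _ js) scaler0 big1 //.
rewrite (dsum_pr_hom module_grading_zmod _ _ (gM i l a _ Aa (dsum_pr_in module_grading_zmod _ _ _))).
by rewrite (inj_eq (addrI _)) [j == l]eq_sym; case: eqP => // ->.
Qed.

(** The finitely many generators have finitely many components, and the action of A does not lower
    degrees. *)
Lemma module_grading_bounded : exists b : nat, forall x j, (j < - b%:Z) -> prZ j x = 0.
Proof.
have [s sM] := fgM.
suff [b Hb] : exists b : nat, forall x, x \in s -> forall j, (j < - b%:Z) -> prZ j x = 0.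
  exists b => x j jb; have : lspan s x by rewrite sM.
  case=> c ->; rewrite (dsum_pr_big module_grading_zmod) big1 // => i _.
  have sx := Hb _ (mem_nth 0 (ltn_ord i)).
  have [t [ut cE _]] := dsum_pr_sum (algebra_grading_sum grading_A) (c i).
  rewrite cE scaler_suml (dsum_pr_big module_grading_zmod) big1 // => l _.
  have Al := algebra_pr_in grading_A l (c i).
  have -> : j = l%:Z + (j - l%:Z) by rewrite addrC subrK.
  rewrite module_prZ_hom // sx ?scaler0 //; lia.
elim: s {sM} => [|y s [b Hb]]; first by exists 0%N.
have [t [ut yE t0]] := dsum_pr_sum module_grading_sum y.
exists (b + \sum_(i <- t) `|i|)%N => x; rewrite inE => /orP[/eqP ->|xs] j jb; last first.
  by apply: Hb => //; lia.
apply: t0; apply/negP => jt.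
have : (`|j| <= \sum_(i <- t) `|i|)%N.
  by rewrite (big_rem j jt) /= leq_addr.
by lia.
Qed.

Lemma graded_module_exists : exists pr : nat -> M -> M,
  graded_module (algebra_pr grading_A) pr.
Proof.
have [b Hb] := module_grading_bounded.
have [_ _ gM] := grading_M.
(* Degree -b becomes degree 0; nothing is lost, since the components below -b vanish. *)
pose pr (n : nat) (x : M) := prZ (n%:Z - b%:Z) x.
have pr_prE n i x : pr n (prZ i x) = if n%:Z - b%:Z == i then prZ i x else 0.
  exact: (dsum_pr_hom module_grading_zmod _ _ (dsum_pr_in module_grading_zmod _ i x)).
exists pr; split.
- by move=> n x y; exact: (dsum_prD module_grading_zmod).
- by move=> n m x; rewrite pr_prE (inj_eq (addIr _)) eqz_nat.
- move=> x; have [s [us xE s0]] := dsum_pr_sum module_grading_sum x.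
  pose c := (\sum_(i <- s) `|i| + b).+1; exists c.
  suff H (j : int) : prZ j x = prZ j (\sum_(i < c) pr i x).
    exact: (dsum_pr_inj module_grading_zmod H).
  rewrite (dsum_pr_big module_grading_zmod).
  have E i : prZ j (pr i x) = if j == i%:Z - b%:Z then prZ j x else 0.
    rewrite (dsum_pr_hom module_grading_zmod _ _ (dsum_pr_in module_grading_zmod _ _ x)).
    by case: eqP => // ->.
  have [jb|bj] := boolP (j < - b%:Z).
    rewrite Hb // big1 // => i _; rewrite E; case: eqP => // ji.
    by move: jb; rewrite ji; lia.
  have jE : j = (absz (j + b%:Z))%:Z - b%:Z by lia.
  have [ic|ci] := ltnP (absz (j + b%:Z)) c.
    rewrite (bigD1 (Ordinal ic)) //= E {2}jE eqxx big1 ?addr0 // => i ij.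
    rewrite E; case: eqP => // ji; move: ij.
    by rewrite -val_eqE /= -eqz_nat; lia.
  have js : j \notin s.
    apply/negP => js; move: ci; rewrite /c.
    have : (`|j| <= \sum_(i <- s) `|i|)%N by rewrite (big_rem j js) /= leq_addr.
    by lia.
  by rewrite (s0 j js) big1 // => i _; rewrite E (s0 j js) if_same.
- move=> n i j a x; have Aa := algebra_pr_in grading_A i a.
  have := gM i (j%:Z - b%:Z) _ _ Aa (dsum_pr_in module_grading_zmod module_grading_sum (j%:Z - b%:Z) x).
  move=> h; rewrite /pr (dsum_pr_hom module_grading_zmod _ _ h).
  by rewrite addrA (inj_eq (addIr _)) -PoszD eqz_nat.
Qed.

End ModuleGrading.

(** * Gelfand-Kirillov dimension *)

Section LogGrowth.
Import Order.TTheory Num.Theory numFieldNormedType.Exports.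
Variable R : realType.
Implicit Types u : nat -> nat.

Lemma cvg_inv_ln (c : R) : c / ln n%:R @[n --> \oo] --> (0 : R).
Proof.
rewrite -[0](mulr0 c); apply: cvgMr.
apply/gtr0_cvgV0.
  near=> n; apply: ln_gt0; rewrite ltr1n; near: n; exact: nbhs_infty_gt.
apply/cvgryPge => B; near=> n; rewrite -[B]expRK ler_ln ?posrE ?expR_gt0 //.
  near: n; apply: nbhs_infty_ger.
rewrite ltr0n; near: n; exact: nbhs_infty_gt.
Unshelve. all: by end_near. Qed.

Lemma cvg_log_growth u d C : (0 < C)%N ->
  (forall n, (C <= n)%N -> (n ^ d <= C * u n)%N /\ (u n <= C * n ^ d)%N) ->
  (ln (u n)%:R / ln n%:R : R) @[n --> \oo] --> (d%:R : R).
Proof.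
move=> C0 HC; have Cpos : (C%:R : R) \is Num.pos by rewrite posrE ltr0n.
apply: (@squeeze_cvgr _ _ _ _ (fun n => d%:R - ln C%:R / ln n%:R)
  (fun n => d%:R + ln C%:R / ln n%:R)).
- near=> n.
  have Cn : (C <= n)%N by near: n; exact: nbhs_infty_ge.
  have n1 : (1 < n)%N by near: n; exact: nbhs_infty_gt.
  have n0 : (0 < n)%N := ltnW n1.
  have ln0 : 0 < ln (n%:R : R) by rewrite ln_gt0 // ltr1n.
  have [h1 h2] := HC n Cn.
  have nd0 : (0 < n ^ d)%N by rewrite expn_gt0 n0.
  have u0 : (0 < u n)%N by case: (u n) h1 => //; rewrite muln0 leqNgt nd0.
  have lnd : ln (n ^ d)%N%:R = d%:R * ln n%:R :> R.
    by rewrite natrX lnXn ?ltr0n // mulr_natl.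
  have e1 : d%:R * ln n%:R <= ln C%:R + ln (u n)%:R :> R.
    rewrite -lnd -lnM ?posrE ?ltr0n // ler_ln ?posrE ?mulr_gt0 ?ltr0n //.
    by rewrite -natrM ler_nat.
  have e2 : ln (u n)%:R <= ln C%:R + d%:R * ln n%:R :> R.
    rewrite -lnd -lnM ?posrE ?ltr0n // ler_ln ?posrE ?mulr_gt0 ?ltr0n //.
    by rewrite -natrM ler_nat.
  rewrite lerBlDr -mulrDl ler_pdivlMr // [X in _ <= X]addrC e1 /=.
  by rewrite ler_pdivrMr // mulrDl divfK ?gt_eqF // addrC.
- rewrite -[X in _ --> X]subr0; apply: cvgB; [exact: cvg_cst|exact: cvg_inv_ln].
- rewrite -[X in _ --> X]addr0; apply: cvgD; [exact: cvg_cst|exact: cvg_inv_ln].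
Unshelve. all: by end_near. Qed.

Lemma limn_esup_log_growth u d : poly_growth u d ->
  limn_esup (fun n => (ln (u n)%:R / ln n%:R : R)%:E) = (d%:R)%:E.
Proof.
case=> C C0 HC; apply: (cvg_limn_einf_sup _).2.
apply: cvg_EFin; first by near=> n.
exact: cvg_log_growth HC.
Unshelve. all: by end_near. Qed.

(** Replacing u by its maximum with n^d gives exact growth d, so the limit is known; this also
    covers values u n = 0, where [ln] takes its default. *)
Lemma limn_esup_log_growth_le u d C :
  (forall n, (C <= n)%N -> (u n <= C * n ^ d)%N) ->
  (limn_esup (fun n => (ln (u n)%:R / ln n%:R : R)%:E) <= (d%:R)%:E)%E.
Proof.
move=> HC; pose w n := maxn (u n) (n ^ d).
have Hw : poly_growth w d.
  exists C.+1 => // n Cn; split.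
    by rewrite (leq_trans (leq_maxr (u n) _)) // leq_pmull.
  rewrite geq_max; apply/andP; split; last by rewrite leq_pmull.
  by rewrite (leq_trans (HC n (ltnW Cn))) // leq_mul2r leqnSn orbT.
rewrite -(limn_esup_log_growth Hw) !limn_esup_lim.
apply: lee_lim; [exact: is_cvg_esups|exact: is_cvg_esups|].
apply: nearW => n; apply: ge_ereal_sup => _ [m nm <-].
apply: (@le_trans _ _ (ln (w m)%:R / ln m%:R : R)%:E); last first.
  by apply: ereal_sup_ubound; exists m.
rewrite lee_fin; apply: ler_wpM2r.
  rewrite invr_ge0; case: m {nm} => [|m]; first by rewrite ln0.
  by rewrite ln_ge0 // ler1n.
have [->|u0] := posnP (u m).
  rewrite ln0 //; case: (posnP (w m)) => [->|w0]; first by rewrite ln0.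
  by rewrite ln_ge0 // ler1n.
have w0 : (0 < w m)%N by rewrite (leq_trans u0) // leq_maxl.
by rewrite ler_ln ?posrE ?ltr0n // ler_nat leq_maxl.
Qed.

End LogGrowth.

Lemma lspan_subset (R : pzRingType) (M : lmodType R) (s t : seq M) :
  {subset s <= t} -> lspan s `<=` lspan t.
Proof. by move=> st; apply: lspan_min (lspan_sub t) _ => x /st; exact: lspan_mem. Qed.

Lemma rspan_lspan (k : fieldType) (V : lmodType k) (s : seq V) (W : set V) :
  W `<=` lspan s -> rspan [set 0] (size s) (nth 0 s) W.
Proof. by move=> Ws x /Ws[c ->]; exists c; rewrite subrr. Qed.

Lemma has_rdim_dim (k : fieldType) (V : lmodType k) (s : seq V) :
  has_rdim [set 0] (lspan s) (Defs.dim (lspan s)).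
Proof.
have sl := lspan_sub s.
have [n _ Hn] := has_rdim_exists (submodule_set0 V) sl (rspan_lspan (@subset_refl _ _)).
rewrite /Defs.dim; case: xgetP => [m _ /(has_dimE _ sl)|/(_ n)] //.
by move/(has_dimE _ sl): Hn.
Qed.

Section FiniteGenerators.
Variables (k : fieldType) (A : algType k) (prA : nat -> A -> A).
Hypothesis gA : graded_algebra prA.
Variables (M : lmodType A) (pr : nat -> M -> M).
Hypothesis gM : graded_module prA pr.

(** A largest submodule of N spanned by finitely many homogeneous elements contains every
    homogeneous element of N. *)
Lemma gsub_fg N : noetherian_module M -> gsub pr N ->
  exists2 s : seq M, N = lspan s & forall x, x \in s -> exists i, pr i x = x.
Proof.
move=> noeM gN; have [sN _] := gN.
pose F (X : set M) := exists s : seq M,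
  [/\ X = lspan s, X `<=` N & forall x, x \in s -> exists i, pr i x = x].
have [||X [s [XE XN hs]] Xmax] := @noetherian_max _ _ F noeM.
- by move=> X [s [-> _ _]]; exact: lspan_sub.
- exists (lspan [::]), [::]; split=> // _ [c ->].
  by rewrite big_ord0; exact: submod0.
exists s => //; rewrite -XE; apply/seteqP; split=> //.
apply: (gsub_hom gM gN); first by rewrite XE; exact: lspan_sub.
move=> i x Nx xi; apply: (Xmax (lspan (x :: s))).
- exists (x :: s); split=> //.
    apply: lspan_min => // y; rewrite inE => /orP[/eqP -> //|ys].
    by apply: XN; rewrite XE; exact: lspan_mem.
  move=> y; rewrite inE => /orP[/eqP ->|]; first by exists i.
  exact: hs.
- by rewrite XE; apply: lspan_subset => y ys; rewrite inE ys orbT.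
- by apply: lspan_mem; rewrite inE eqxx.
Qed.

End FiniteGenerators.

Section GelfandKirillovGraded.
Variables (k : fieldType) (A : algType k) (prA : nat -> A -> A).
Hypothesis gA : graded_algebra prA.
Local Notation prAo := (prA : nat -> A^o -> A^o).
Hypothesis lfA : forall n, exists s : seq A, deg_le prAo n `<=` lspan s.
Hypothesis noeA : noetherian_module (A^o : lmodType A).

Section FinGraded.
Variables (M : lmodType A) (pr : nat -> M -> M).
Hypothesis gM : graded_module prA pr.
Local Notation Mk := (restrict_scalars M).

Lemma rscale_action (c : k) (a : A) (m : M) :
  (c *: a) *: m = c *: (a *: m : Mk) :> Mk.
Proof.
have -> : c *: (a *: m : Mk) = (c%:A * a) *: m :> Mk by exact: (@scalerA A M).
by rewrite mulr_algl.
Qed.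

Lemma trunc_rscale n c (x : Mk) : trunc pr n (c *: x : Mk) = c *: (trunc pr n x : Mk) :> Mk.
Proof.
have -> : c *: (trunc pr n x : Mk) = \sum_(i < n.+1) (c *: (pr i x : Mk) : Mk).
  exact: (@scaler_sumr k Mk).
by apply: eq_bigr => i _; exact: (pr_rscale gA gM).
Qed.

Lemma action_preim_submodule (f : Mk -> Mk) (W : set Mk) (x : M) :
  (forall u v, f (u + v) = f u + f v) -> (forall c u, f (c *: u) = c *: f u) ->
  submodule W -> submodule [set a : A | W (f (a *: x : M))].
Proof.
move=> fD fZ sW; apply/submoduleP; split.
  rewrite /= scale0r.
  have -> : f 0 = 0 by apply: (addrI (f 0)); rewrite -fD !addr0.
  exact: submod0.
move=> c a b Wa Wb; rewrite /= scalerDl rscale_action fD fZ.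
by apply: submodD => //; exact: submodZ.
Qed.

Lemma fin_graded_fg : finitely_generated M -> fin_graded pr.
Proof.
move=> [g gT] n; have [s sF] := lfA n.
pose t : seq Mk := [seq trunc pr n (a *: y) | a <- s, y <- g].
exists (size t), (nth 0 t); apply: rspan_lspan => x Fx.
have : lspan g x by rewrite gT.
case=> c xE; rewrite -(trunc_id gM Fx) xE.
have -> : trunc pr n (\sum_(i < size g) c i *: g`_i) =
    \sum_(i < size g) trunc pr n (c i *: g`_i).
  apply: (big_morph (trunc pr n)); first exact: (truncD gM).
  by rewrite /trunc big1 // => i _; exact: (pr0 gM).
apply: (@submod_sum k Mk) => [|i _]; first exact: lspan_sub.
set y := g`_i; have yg : y \in g by exact: mem_nth.
(* Since M lives in nonnegative degrees, components of [c i] above degree n contribute nothing up to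
   degree n. *)
have -> : trunc pr n (c i *: y) = trunc pr n (trunc prAo n (c i) *: y).
  apply: eq_bigr => m _; apply/eqP; rewrite -subr_eq0 -(prB gM) -scalerBl.
  have [b zE] := pr_fin gA (c i - trunc prAo n (c i) : A^o).
  rewrite zE scaler_suml (pr_sum gM) big1 // => u _.
  rewrite (prB gA) (pr_trunc gA); case: leqP => un.
    by rewrite subrr scale0r; exact: (pr0 gM).
  rewrite subr0 (pr_hom_lt gM (prA_id gA u (c i))) //.
  by have := ltn_ord m; lia.
have sP : submodule [set a : A | lspan t (trunc pr n (a *: y) : Mk)].
  apply: (@action_preim_submodule (trunc pr n : Mk -> Mk) (lspan t)).
  - exact: (truncD gM).
  - exact: trunc_rscale.
  - exact: lspan_sub.
have sub : forall a, a \in s -> lspan t (trunc pr n (a *: y) : Mk).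
  by move=> a as_; apply: lspan_mem; apply/allpairsP; exists (a, y).
apply: (lspan_min sP sub); apply: sF; exact: (trunc_deg_le gA).
Qed.

End FinGraded.

Section Words.
Variables (M : lmodType A) (pr : nat -> M -> M).
Hypothesis gM : graded_module prA pr.
Local Notation Mk := (restrict_scalars M).
Implicit Types (v : seq A) (f : seq M).

Local Notation wspan v f n := (lspan (words v f n : seq Mk)).

Lemma words_subset v f n m : (n <= m)%N -> {subset words v f n <= words v f m}.
Proof.
move=> /subnKC <-; elim: (m - n)%N => [|j IH]; first by rewrite addn0.
rewrite addnS => x /IH {IH}; move: (n + j)%N => {n j}n.
elim: n x => [|n IH] x /=; first by rewrite mem_cat => ->.
rewrite !mem_cat => /orP[->//|/allpairsP[[a y] /= [av yw ->]]].
by apply/orP; right; apply/allpairsP; exists (a, y); split=> //; exact: IH.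
Qed.

Lemma wspan_mono v f n m : (n <= m)%N -> wspan v f n `<=` wspan v f m.
Proof. by move=> nm; apply: lspan_subset; exact: words_subset. Qed.

Lemma wspan_step v f n a y : a \in v -> wspan v f n y -> wspan v f n.+1 (a *: y : M).
Proof.
move=> av; have sW : submodule ([set z | wspan v f n.+1 (a *: (z : M) : M)] : set Mk).
  have sl := lspan_sub (words v f n.+1 : seq Mk).
  apply/submoduleP; split=> [|c z w Hz Hw]; rewrite /=.
    by rewrite (@scaler0 A M); exact: (submod0 sl).
  have -> : a *: (c *: z + w : M) = c *: (a *: (z : M) : Mk) + (a *: (w : M) : Mk) :> Mk.
    rewrite (@scalerDr A M); congr (_ + _).
    have -> : a *: (c *: z : M) = (a * c%:A) *: (z : M) by exact: (@scalerA A M).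
    rewrite mulr_algr -mulr_algl; symmetry; exact: (@scalerA A M).
  by apply: (submodD sl) => //; exact: (submodZ c sl).
apply: (lspan_min sW) => z zw; apply: lspan_mem => /=; rewrite mem_cat.
by apply/orP; right; apply/allpairsP; exists (a, z).
Qed.

Lemma words_deg_le v f : exists D, forall n x, x \in words v f n ->
  deg_le pr (D * n.+1)%N x.
Proof.
have [Dv HDv] : exists D, forall a, a \in v -> deg_le prAo D a.
  elim: v => [|a v [D HD]]; first by exists 0%N.
  have [D' HD'] := deg_le_bound gA (a : A^o); exists (maxn D D') => b.
  rewrite inE => /orP[/eqP ->|/HD h].
    exact: (deg_le_mono (leq_maxr D D')).
  exact: (deg_le_mono (leq_maxl D D')).
have [Df HDf] : exists D, forall x, x \in f -> deg_le pr D x.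
  elim: f => [|a f [D HD]]; first by exists 0%N.
  have [D' HD'] := deg_le_bound gM a; exists (maxn D D') => b.
  rewrite inE => /orP[/eqP ->|/HD h].
    exact: (deg_le_mono (leq_maxr D D')).
  exact: (deg_le_mono (leq_maxl D D')).
exists (Dv + Df)%N; elim=> [|n IH] x /=.
  by move=> /HDf h; apply: (deg_le_mono _ h); lia.
rewrite mem_cat => /orP[/HDf h|/allpairsP[[a y] /= [/HDv av /IH yw ->]]].
  by apply: (deg_le_mono _ h); nia.
by apply: (deg_le_mono _ (deg_le_scale gA gM av yw)); nia.
Qed.

Lemma wspan_deg_le v f : exists D, forall n,
  wspan v f n `<=` (deg_le pr (D * n.+1) : set Mk).
Proof.
have [D HD] := words_deg_le v f; exists D => n.
apply: lspan_min; first exact: (deg_le_submodule gA gM).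
exact: HD.
Qed.

(* A is generated by its part of degree 0 and by homogeneous generators of the
   left ideal of elements without component of degree 0. *)
Lemma deg_le_wspan : finitely_generated M -> noetherian_module M ->
  exists v f, forall n, (deg_le pr n : set Mk) `<=` wspan v f n.+1.
Proof.
move=> fgM noeM; have [s0 Hs0] := lfA 0.
pose Ap : set A^o := [set a | prA 0%N a = 0].
have gAp : gsub prAo Ap.
  split.
    apply: (submodule_hom gA).
    - exact: (pr0 gA).
    - by move=> x y Ax Ay; rewrite /Ap /= (prD gA 0%N (x : A^o) y) Ax Ay addr0.
    - move=> [|i] a x ai Ax; rewrite /Ap /=; last exact: (pr_hom_lt gA ai).
      by have /= -> := pr_hom gA 0 ai x; rewrite Ax scaler0.
  by move=> n x Ax; rewrite /Ap /= (pr_pr gA 0%N n (x : A^o)); case: eqP => [<-|].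
have [X ApX Xhom] := gsub_fg gA noeA gAp.
have [f fT fhom] := gsub_fg gM noeM (@gsubT _ _ _ pr).
pose v := s0 ++ (X : seq A); exists v, f.
(* Each generator of positive degree costs one letter, so degree n costs at most n letters; the one
   extra letter pays for the remaining factor of degree 0. *)
have act n : forall a m y, prA n a = a -> wspan v f m y -> wspan v f (m + n).+1 (a *: y : M).
  elim/ltn_ind: n => -[|n] IH a m y an wy.
    rewrite addn0.
    have sW := action_preim_submodule (f := id) (W := wspan v f m.+1) y
      (fun _ _ => erefl) (fun _ _ => erefl) (lspan_sub _).
    apply: (lspan_min sW (s := s0)).
      by move=> b bs; apply: wspan_step wy; rewrite mem_cat bs.
    apply: Hs0 => -[|i] // _.
    by rewrite -an (pr_pr gA i.+1 0%N (a : A^o)).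
  have : lspan X a.
    rewrite -ApX /Ap /= -an; exact: (pr_pr gA 0%N n.+1 (a : A^o)).
  case=> c aE; rewrite -an aE.
  have -> : prA n.+1 (\sum_(i < size X) c i *: X`_i) =
      \sum_(i < size X) prA n.+1 (c i *: X`_i).
    exact: (pr_sum gA n.+1 _ _ (fun i : 'I_(size X) => c i *: X`_i : A^o)).
  rewrite scaler_suml; apply: (@submod_sum k Mk) => [|i _]; first exact: lspan_sub.
  have Xi : X`_i \in X by exact: mem_nth.
  have [d di] := Xhom _ Xi.
  have Xv : (X`_i : A) \in v by rewrite mem_cat Xi orbT.
  have z0 : wspan v f (m + n.+1).+1 (0 : M) := submod0 (lspan_sub _).
  have [dn|nd] := ltnP n.+1 d.
    by have /= -> := pr_hom_r_lt gA gA di dn (c i); rewrite scale0r.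
  (* The recursion needs generators of positive degree: one of degree 0 is zero, as elements of [Ap]
     have no component there. *)
  case: d di nd => [|d] di nd.
    have : Ap X`_i by rewrite ApX; exact: lspan_mem.
    rewrite /Ap /= => X0; rewrite -di X0 (@scaler0 A A^o).
    by have -> : prA n.+1 0 = 0 := pr0 gA n.+1; rewrite scale0r.
  have E : prA n.+1 (c i *: X`_i) = prA (n - d)%N (c i) * X`_i.
    have := pr_hom_r gA gA (n - d) di (c i); rewrite /=.
    by have -> : (n - d + d.+1 = n.+1)%N by lia.
  rewrite E -scalerA.
  have w1 := wspan_step Xv wy.
  have nd' : (n - d < n.+1)%N by lia.
  have := IH _ nd' _ m.+1 _ (prA_id gA (n - d)%N (c i)) w1.
  by apply: wspan_mono; lia.
move=> n x Fx; have : lspan f x by rewrite -fT.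
case=> c xE; rewrite -(trunc_id gM Fx) /trunc.
apply: (@submod_sum k Mk) => [|l _]; first exact: lspan_sub.
rewrite xE (pr_sum gM); apply: (@submod_sum k Mk) => [|i _]; first exact: lspan_sub.
have fi : f`_i \in f by exact: mem_nth.
have [d di] := fhom _ fi.
have [dn|nd] := ltnP l d.
  by rewrite (pr_hom_r_lt gA gM di dn); exact: submod0 (lspan_sub _).
rewrite -(subnK nd) (pr_hom_r gA gM _ di).
have w0 : wspan v f 0 (f`_i) by exact: lspan_mem.
have := act _ _ 0%N _ (prA_id gA (l - d)%N (c i)) w0.
by apply: wspan_mono; have := ltn_ord l; lia.
Qed.

(** Words of length n have degree linear in n, so no choice of v and f exceeds the exponent d; the
    generators from [deg_le_wspan] attain it, since their words exhaust each degree after a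
    comparable length. *)
Lemma GKdim_hilb_growth (R : realType) d : finitely_generated M ->
  noetherian_module M -> hilb_growth pr [set 0] [set: M] d ->
  GKdim R M = (d%:R)%:E.
Proof.
move=> fgM noeM hg; have fM := fin_graded_fg gM fgM.
have g0 := gsub0 gM; have gT := @gsubT _ _ _ pr.
have hP n : has_rdim [set 0] (deg_le pr n : set Mk) (hilb pr [set 0] [set: M] n).
  have := hilbP gA gM fM n g0 gT; rewrite setTI.
  have -> // : [set 0] `&` deg_le pr n = [set 0].
  by apply/seteqP; split=> [x []//|x ->]; split=> // i _; exact: (pr0 gM).
have dim_leq (W1 W2 : set Mk) n m : W1 `<=` W2 -> has_rdim [set 0] W1 n ->
    has_rdim [set 0] W2 m -> (n <= m)%N.
  move=> W12 [s [h1 h2 _]] [t [_ _ h3]].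
  by apply: (rindep_leq_rspan (submodule_set0 Mk) h2 _ h3) => i /h1/W12.
pose h := hilb pr [set 0] [set: M].
have [C C0 HC] : poly_growth h d := hg.
have ub v f : exists K, forall n, (K <= n)%N -> (Defs.growth v f n <= K * n ^ d)%N.
  have [D HD] := wspan_deg_le v f.
  (* For n >= 1, (D + 1)(n + 1) is at most 2 (D + 1) n; the summand C places the argument of h past
     its threshold. *)
  exists (C * (D.+1 * 2) ^ d + C)%N => n Kn.
  have n0 : (0 < n)%N by lia.
  have h1 : (Defs.growth v f n <= h (D.+1 * n.+1))%N.
    apply: dim_leq (has_rdim_dim _) (hP _).
    by move=> x /HD; apply: deg_le_mono; nia.
  apply: leq_trans h1 _.
  have [_ h2] := HC (D.+1 * n.+1)%N ltac:(nia).
  apply: leq_trans h2 _.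
  apply: (@leq_trans (C * (D.+1 * 2) ^ d * n ^ d)%N); last by rewrite leq_mul2r leq_addr orbT.
  by rewrite -mulnA -expnMn leq_mul2l leq_exp2rW ?orbT //; nia.
apply/eqP; rewrite Order.POrderTheory.eq_le; apply/andP; split.
  apply: ge_ereal_sup => _ [[v f] _ <-] /=.
  have [K HK] := ub v f; exact: (limn_esup_log_growth_le R HK).
have [v [f Hvf]] := deg_le_wspan fgM noeM.
have [K HK] := ub v f.
apply: ereal_sup_ubound; exists (v, f) => //=.
(* Words of length n span all degrees up to n - 1, and n <= 2 (n - 1) accounts for the factor
   2^d. *)
apply: limn_esup_log_growth; exists (C * 2 ^ d + K + 2)%N => [|n Kn]; first lia.
split; last first.
  apply: leq_trans (HK n _) _; first lia.
  by rewrite leq_mul2r; apply/orP; right; lia.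
have n1 : (1 < n)%N by lia.
have h1 : (h n.-1 <= Defs.growth v f n)%N.
  apply: dim_leq (hP _) (has_rdim_dim _).
  by have := Hvf n.-1; rewrite prednK // ltnW.
have Cn : (C <= n.-1)%N.
  have : (C <= C * 2 ^ d)%N by rewrite leq_pmulr // expn_gt0.
  by lia.
have [h2 _] := HC _ Cn.
have h3 : (n ^ d <= 2 ^ d * n.-1 ^ d)%N by rewrite -expnMn leq_exp2rW //; lia.
apply: leq_trans h3 _; apply: (@leq_trans (2 ^ d * (C * Defs.growth v f n))%N).
  by rewrite leq_mul2l (leq_trans h2) ?orbT // leq_mul2l h1 orbT.
by rewrite mulnA leq_mul2r [(2 ^ d * C)%N]mulnC -addnA leq_addr orbT.
Qed.

End Words.
End GelfandKirillovGraded.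

(** * Quotients by graded primes *)

Lemma proper2ideal_exists (R : nzRingType) (I : set R) :
  submodule (I : set R^o) -> (forall x a, I x -> I (x * a)) -> ~ I 1 ->
  exists p : proper2ideal R, set_of_ideal p = I.
Proof.
move=> sI rI nI1; pose S : R -> bool := fun x => `[< I x >].
have SE x : (x \in S) = `[< I x >] by [].
have zS : GRing.zmod_closed S.
  split; first by rewrite SE; apply/asboolP; exact: submod0 sI.
  by move=> x y /asboolP Ix /asboolP Iy; apply/asboolP; exact: (submodB sI).
have pS : ring_quotient.proper_ideal S.
  split; first by rewrite SE; apply/asboolP.
  by move=> a x /asboolP Ix; apply/asboolP; exact: (submodZ a sI).
have rS : forall a u : R, u \in S -> u * a \in S.
  by move=> a u /asboolP Iu; apply/asboolP; exact: rI.
pose z := GRing.isZmodClosed.Build R S zS.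
pose i := isProperIdeal.Build R S pS.
pose r := isRightStable.Build R S rS.
pose p : proper2ideal R := HB.pack S z i r.
exists p; apply/seteqP; split=> x; first by move/asboolP.
by move=> Ix; apply/asboolP.
Qed.

Section QuotientMap.
Variables (R : nzRingType) (p : proper2ideal R).
Local Notation I := (set_of_ideal p).
Local Notation q := (@quotient_map R p).

Lemma quotient_map_eq x y : q x = q y <-> I (x - y).
Proof. exact: qpiE. Qed.

Lemma quotient_mapD x y : q (x + y) = q x + q y.
Proof. by rewrite /quotient_map qaddE. Qed.

Lemma quotient_mapM x y : q (x * y) = q x * q y.
Proof. by symmetry; exact: qmulE. Qed.

Lemma quotient_map0 : q 0 = 0.
Proof. by apply: (addrI (q 0)); rewrite -quotient_mapD !addr0. Qed.

Lemma quotient_map_sum (J : Type) (r : seq J) (F : J -> R) :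
  q (\sum_(j <- r) F j) = \sum_(j <- r) q (F j).
Proof. exact: (big_morph q quotient_mapD quotient_map0). Qed.

Lemma quotient_map_surj y : exists x, y = q x.
Proof. by exists (repr y); rewrite /quotient_map reprK. Qed.

Lemma quotient_map_eq0 x : q x = 0 <-> I x.
Proof. by rewrite -quotient_map0 quotient_map_eq subr0. Qed.

End QuotientMap.

(** * Passage to the opposite algebra *)

Section Converse.
Variables (k : fieldType) (A : algType k) (prA : nat -> A -> A).

Lemma gideal_converse (I : set A) : gideal (A := A^c) prA I <-> gideal prA I.
Proof.
split=> -[[/submoduleP[I0 IL] pI] rI].
  split; first split=> //.
    apply/submoduleP; split=> // a x y Ix Iy.
    have := IL (1 : A^c) (a *: x : A^o) y (rI x a Ix) Iy.
    by rewrite [_ *: _](@mulr1 A).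
  move=> x a Ix; have := IL (a : A^c) x 0 Ix I0; rewrite addr0.
  by [].
split; first split=> //.
  apply/submoduleP; split=> // a x y Ix Iy.
  have := IL (1 : A) ((x : A) * (a : A)) y (rI x a Ix) Iy.
  by rewrite [_ *: _](@mul1r A).
move=> x a Ix; have := IL (a : A) x 0 Ix I0; rewrite addr0.
by [].
Qed.

Lemma prime_elt_converse (I : set A) : prime_elt (A := A^c) I -> prime_elt I.
Proof.
move=> pI x y H; apply/or_comm; apply: (pI y x) => a.
rewrite /=; have := H a; by rewrite -mulrA.
Qed.

End Converse.

Section GradedEssential.
Variables (k : fieldType) (A : algType k) (prA : nat -> A -> A).
Hypothesis gA : graded_algebra prA.
Local Notation prAo := (prA : nat -> A^o -> A^o).
Variables (I L : set A).
Hypothesis gI : gideal prA I.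
Hypothesis gL : gsub prAo L.
Hypothesis IL : I `<=` L.
Hypothesis essL : graded_essential_mod prA I L.

(* The leading component of x is moved into L first; then the other components,
   of which there are fewer, are treated by induction. *)
Lemma graded_essential_mod_all x : ~ I x -> exists a, L (a * x) /\ ~ I (a * x).
Proof.
have [[sI pI] rI] := gI; have [sL pL] := gL.
have lI a y : I y -> I (a * y) by exact: (submodZ a sI).
have lL a y : L y -> L (a * y) by exact: (submodZ a sL).
(* The components of x lie in a window of b degrees starting at e. A homogeneous multiplier moves
   the window without widening it, so the induction is on b. *)
suff H b : forall e x, (forall j, (j < e)%N || (e + b <= j)%N -> prA j x = 0) ->
    ~ I x -> exists i a, [/\ prA i a = a, L (a * x) & ~ I (a * x)].
  move=> nIx; have [b Hb] := pr_bound gA (x : A^o).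
  have [j|i [a [_ h1 h2]]] := H b 0%N x _ nIx; last by exists a.
  by rewrite ltn0 => /Hb.
elim: b => [|b IH] e {}x Hx nIx.
  case: nIx; suff -> : x = 0 by exact: (submod0 sI).
  apply: (pr_eq0 gA) => j; apply: Hx.
  by rewrite addn0; case: ltnP.
set t := prA (e + b)%N x; set x' := x - t.
have tt : prA (e + b) t = t by exact: prA_id.
have prt j : prA j t = if j == (e + b)%N then t else 0.
  by rewrite -{1}tt (pr_pr gA j (e + b)%N (t : A^o)) tt.
have x'E j : prA j x' = if j == (e + b)%N then 0 else prA j x.
  have := prB gA j (x : A^o) (t : A^o); rewrite -/x' => ->.
  by rewrite prt; case: eqP => [->|_]; rewrite ?subrr ?subr0.
have Hx' j : (j < e)%N || (e + b <= j)%N -> prA j x' = 0.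
  rewrite x'E; case: eqP => // ne h; apply: Hx.
  by case/orP: h => [->//|h]; apply/orP; right; lia.
have xE : x = x' + t by rewrite subrK.
case: (pselect (I t)) => It.
  have [|i [a [ai La nIa]]] := IH e x' Hx'.
    by move=> Ix'; apply: nIx; rewrite xE; exact: (submodD sI).
  exists i, a; split=> //; rewrite xE mulrDr.
    by apply: (submodD sL) => //; exact/IL/lI.
  by move=> H; apply: nIa; rewrite -(addrK (a * t) (a * x')); apply: (submodB sI) => //; exact: lI.
have [a0 [La0 nIa0]] := essL tt It.
have [i nIi] : exists i, ~ I (prA i a0 * t).
  apply: contrapT => H; apply: nIa0; have [c aE] := pr_fin gA (a0 : A^o).
  rewrite [a0]aE mulr_suml; apply: (@submod_sum _ A^o) => // i _.
  by apply: contrapT => nI; apply: H; exists i.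
set a := prA i a0; have ai : prA i a = a by exact: prA_id.
have Lat : L (a * t).
  have := pL (i + (e + b))%N _ La0.
  by have := pr_hom_r gA gA i (tt : prAo _ (t : A^o) = _) a0; rewrite /= => ->.
have shift_pr d c y : prA d c = c -> forall j, (d <= j)%N -> prA j (c * y) = c * prA (j - d)%N y.
  move=> cd j dj; have := pr_hom gA (j - d) cd (y : A^o).
  by rewrite (subnKC dj).
case: (pselect (I (a * x'))) => Iax'.
  exists i, a; split=> //; rewrite xE mulrDr.
    by apply: (submodD sL) => //; exact: IL.
  by move=> H; apply: nIi; rewrite -(addKr (a * x') (a * t)) addrC; apply: (submodB sI).
have [j|i' [a' [ai' La' nIa']]] := IH (i + e)%N (a * x') _ Iax'.
  move=> h; have [ij|ji] := leqP i j; last by have := pr_hom_lt gA ai ji (x' : A^o).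
  rewrite (shift_pr _ _ _ ai _ ij) Hx' ?mulr0 //.
  by case/orP: h => h; apply/orP; [left|right]; lia.
exists (i' + i)%N, (a' * a); split; first exact: hom_mul.
  by rewrite xE mulrDr -!mulrA; apply: (submodD sL) => //; exact: lL.
(* Each component of a' a x' is either zero or a component of a' a x, so it lies in I. *)
move=> H; apply: nIa'; have [c yE] := pr_fin gA (a' * (a * x') : A^o).
rewrite yE; apply: (@submod_sum _ A^o) => // j _.
have aa := hom_mul gA ai' ai.
have [jlt|jge] := ltnP j (i' + i).
  rewrite mulrA; have := pr_hom_lt gA aa jlt (x' : A^o) => /= ->.
  exact: (submod0 sI).
rewrite mulrA (shift_pr _ _ _ aa _ jge) x'E; case: eqP => [_|ne].
  by rewrite mulr0; exact: (submod0 sI).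
by rewrite -(shift_pr _ _ _ aa _ jge); exact: pI.
Qed.

End GradedEssential.

(** * The hypotheses on A / p, read modulo I *)

Section FrozenConditions.
Variables (k : fieldType) (A : algType k) (grA : nat -> set A).
Hypothesis grading_A : algebra_grading grA.
Local Notation prA := (algebra_pr grading_A).
Local Notation prAo := (prA : nat -> A^o -> A^o).
Let gA : graded_algebra prA := graded_algebra_pr grading_A.
Variable p : proper2ideal A.
Local Notation I := (set_of_ideal p).
Local Notation q := (@quotient_map A p).
Hypothesis gI : gideal prA I.
Hypothesis pI : prime_elt I.

Lemma homogeneous_pr (L : set A) : (forall n x, L x -> L (prA n x)) -> homogeneous grA L.
Proof.
move=> pL x Lx; have [b xE] := pr_fin gA (x : A^o).
exists (index_iota 0 b), (fun n => prA n x); split; last by rewrite big_mkord.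
by move=> n; split; [exact: algebra_pr_in|exact: pL].
Qed.

Lemma graded_prime_elt : graded_prime grA p.
Proof.
split; last by apply: homogeneous_pr; case: gI => -[].
move=> X Y [_ rX] [lY _] XY; apply: contrapT => /not_orP[nX nY].
have [x Xx nIx] := not_subset nX; have [y Yy nIy] := not_subset nY.
have [] // := pI (x := x) (y := y); move=> a; apply: XY => //.
exact: (@submodZ A^c (A^c)^o X a x rX Xx).
Qed.

Lemma quotient_image_homogeneous (L : set A) : (forall n x, L x -> L (prA n x)) ->
  homogeneous (quotient_grading (p := p) grA) (q @` L).
Proof.
move=> pL _ [x Lx <-]; have [b xE] := pr_fin gA (x : A^o).
exists (index_iota 0 b), (fun n => q (prA n x)); split.
  move=> n; split; exists (prA n x) => //; [exact: algebra_pr_in|exact: pL].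
by rewrite -quotient_map_sum big_mkord -xE.
Qed.

Lemma graded_bounded_ideal (L : set A) : graded_bounded (quotient_grading (p := p) grA) ->
  (forall n x, L x -> L (prA n x)) -> (forall x y, L x -> L y -> L (x + y)) ->
  I `<=` L ->
  essential_left_ideal (q @` L) \/ essential_right_ideal (q @` L) ->
  exists J, [/\ gideal prA J, J `<=` L & ~ J `<=` I].
Proof.
move=> bnd pL aL IL ess.
have [J' [[lJ rJ] hJ nJ JL]] := bnd _ (quotient_image_homogeneous pL) ess.
pose J : set A := [set x | J' (q x)]; exists J.
have [sI' _] := gI; have [sI pI'] := sI'.
split.
- split; first split.
  + apply/submoduleP; split; first by rewrite /J /= quotient_map0; exact: submod0 lJ.
    move=> a x y Jx Jy; rewrite /J /= quotient_mapD [a *: x]/(a * x) quotient_mapM.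
    by apply: (submodD lJ) => //; exact: (submodZ (q a) lJ).
  + move=> n x Jx; have [s [c [Hc xE]]] := hJ _ Jx.
    have /choice[d Hd] i : exists d, grA i d /\ q d = c i.
      by have [[d ? ?] _] := Hc i; exists d.
    (* The homogeneous pieces given in the quotient are lifted one by one; x differs from their sum
       by an element of I, and I is graded, so the components of x are known modulo I. *)
    have : I (x - \sum_(i <- s) d i).
      apply/quotient_map_eq; rewrite xE quotient_map_sum.
      by apply: eq_bigr => i _; rewrite (Hd i).2.
    move=> /(pI' n); rewrite (prB gA) => /quotient_map_eq E.
    rewrite /J /= E.
    have -> : prA n (\sum_(i <- s) d i) = \sum_(i <- s) prA n (d i).
      exact: (pr_sum gA n s xpredT (d : nat -> A^o)).
    rewrite quotient_map_sum; apply: (@submod_sum _ (quotient_ring p)^o J' _ _ _ _ lJ) => i _.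
    rewrite (algebra_pr_hom grading_A n (Hd i).1); case: ifP => _.
      by rewrite (Hd i).2; case: (Hc i).
    by rewrite quotient_map0; exact: submod0 lJ.
  + move=> x a Jx; rewrite /J /= quotient_mapM.
    exact: (@submodZ _ _ _ (q a : (quotient_ring p)^c) _ rJ Jx).
- move=> x /JL [l Ll] /esym/quotient_map_eq Ixl; rewrite -(subrK l x).
  by apply: aL => //; exact: IL.
- move=> JI; apply: nJ; apply/seteqP; split=> [y|_ ->]; last exact: submod0 lJ.
  have [x ->] := quotient_map_surj y => Jx.
  exact/quotient_map_eq0/JI.
Qed.

Lemma enough_normal_normal_mod : enough_normal_elements grA ->
  (exists i x, [/\ (0 < i)%N, prA i x = x & ~ I x]) -> normal_mod prA I.
Proof.
move=> en [i [z [i0 zi nIz]]].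
(* z witnesses that the irrelevant ideal does not lie in p. *)
have [|n [a [n0 [x Ax <-] xn0 nx]]] := en p graded_prime_elt.
  move=> H; apply: nIz; apply: H; exists [:: i], (fun j => if j == i then z else 0).
  split; last by rewrite big_cons big_nil i0 eqxx addr0.
  move=> j; case: eqP => [->|_]; first by rewrite -zi; exact: algebra_pr_in.
  by have := algebra_pr_in grading_A j 0; rewrite (pr0 gA j : prA j 0 = 0).
have nxP (y : quotient_ring p) : (exists2 u, [set: quotient_ring p] u & q x * u = y) <->
    (exists2 u, [set: quotient_ring p] u & u * q x = y).
  by have := congr1 (fun S : set _ => S y) nx => /= ->.
exists n, x; split=> //.
- by rewrite (algebra_pr_hom grading_A n Ax) eqxx.
- by move=> /quotient_map_eq0 E; move: xn0; rewrite E eqxx.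
- move=> a0; have [u _ E] := (nxP (q x * q a0)).1 (ex_intro2 _ _ (q a0) Logic.I erefl).
  have [b uE] := quotient_map_surj u; exists b; apply/quotient_map_eq.
  by rewrite !quotient_mapM -uE E.
- move=> a0; have [u _ E] := (nxP (q a0 * q x)).2 (ex_intro2 _ _ (q a0) Logic.I erefl).
  have [b uE] := quotient_map_surj u; exists b; apply/quotient_map_eq.
  by rewrite !quotient_mapM -uE E.
Qed.

(** [graded_bounded] asks for essentiality against all left ideals, whereas [graded_essential_mod]
    tests homogeneous elements only; [graded_essential_mod_all] closes the gap. *)
Lemma graded_FBN_bounded_mod : graded_FBN grA -> bounded_mod prA I.
Proof.
move=> [_ fbn] L gL IL ess; have [sL pL] := gL.
apply: (graded_bounded_ideal (fbn p graded_prime_elt) pL) => //.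
  by move=> x y; exact: (submodD sL).
left; split.
  apply/submoduleP; split; first by exists 0; [exact: submod0 sL|exact: quotient_map0].
  move=> a _ _ [x Lx <-] [y Ly <-]; have [b ->] := quotient_map_surj a.
  exists (b * x + y); first by apply: (submodD sL) => //; exact: (submodZ b sL).
  by rewrite quotient_mapD quotient_mapM.
move=> N sN NL; apply/seteqP; split=> [y Ny|_ ->]; last exact: submod0 sN.
have [x yE] := quotient_map_surj y; apply: contrapT => /= ny.
have nIx : ~ I x by move=> /quotient_map_eq0; rewrite -yE.
have [a [Lax nIax]] := graded_essential_mod_all gA gI gL IL ess nIx.
apply/nIax/quotient_map_eq0.
suff : (N `&` (q @` L)) (q (a * x)) by rewrite NL.
split; last by exists (a * x).
by rewrite quotient_mapM -yE; exact: (submodZ (q a) sN).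
Qed.

(** Both projections come from proofs of the same proposition [direct_sum grA], which proof
    irrelevance identifies. *)
Lemma algebra_pr_converse :
  algebra_pr (algebra_grading_converse grading_A) = prA :> (nat -> A -> A).
Proof. by congr dsum_pr; exact: Prop_irrelevance. Qed.

Lemma graded_algebra_pr_converse : graded_algebra (A := A^c) prA.
Proof. by rewrite -algebra_pr_converse; exact: graded_algebra_pr. Qed.

(** Left ideals of [A^c] are right ideals of A, the other alternative in [graded_bounded]; the ideal
    found is two-sided and therefore serves [A^c] as well. *)
Lemma graded_FBN_bounded_mod_converse :
  graded_FBN grA -> bounded_mod (A := A^c) prA I.
Proof.
move=> [_ fbn] L gL IL ess; have [sL pL] := gL.
have gIc := (gideal_converse _ _).2 gI.
suff [J [gJ JL nJ]] : exists J, [/\ gideal prA J, J `<=` L & ~ J `<=` I].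
  by exists J; split=> //; exact/gideal_converse.
apply: (graded_bounded_ideal (fbn p graded_prime_elt) pL) => //.
  by move=> x y; exact: (submodD sL).
right; split.
  apply/submoduleP; split; first by exists 0; [exact: submod0 sL|exact: quotient_map0].
  move=> a _ _ [x Lx <-] [y Ly <-].
  have [b ->] := quotient_map_surj (a : quotient_ring p).
  exists (x * b + y : A); last by rewrite quotient_mapD quotient_mapM.
  by apply: (submodD sL) => //; exact: (submodZ (b : A^c) sL).
move=> N sN NL; apply/seteqP; split=> [y Ny|_ ->]; last exact: submod0 sN.
have [x yE] := quotient_map_surj (y : quotient_ring p); apply: contrapT => /= ny.
have nIx : ~ I x by move=> /quotient_map_eq0; rewrite -yE.
have [a [Lax nIax]] :=
  graded_essential_mod_all graded_algebra_pr_converse gIc gL IL ess nIx.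
apply/nIax/quotient_map_eq0.
suff : (N `&` (q @` L)) (q ((x : A) * (a : A))) by rewrite NL.
split; last by exists ((x : A) * (a : A)).
rewrite quotient_mapM -yE.
exact: (submodZ (q a : (quotient_ring p)^c) sN).
Qed.

Lemma normal_mod_converse : normal_mod prA I -> normal_mod (A := A^c) prA I.
Proof. by move=> [i [x [h1 h2 h3 h4 h5]]]; exists i, x; split. Qed.

End FrozenConditions.

Section OneSided.
Variables (R : realType) (k : fieldType) (A : algType k) (grA : nat -> set A).
Hypothesis grading_A : algebra_grading grA.
Hypothesis lf_A : locally_finite grA.
Hypothesis noeA : noetherian_module (A^o : lmodType A).
Local Notation prA := (algebra_pr grading_A).

Lemma deg_le_locally_finite n :
  exists s : seq A, deg_le (prA : nat -> A^o -> A^o) n `<=` lspan s.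
Proof.
have gA := graded_algebra_pr grading_A.
have [s Hs] : exists s : seq A, forall i, (i <= n)%N -> grA i `<=` lspan s.
  elim: n => [|n [s Hs]].
    have [s sE] := lf_A 0; exists s => i; rewrite leqn0 => /eqP ->.
    by rewrite sE.
  have [t tE] := lf_A n.+1; exists (s ++ t) => i.
  rewrite leq_eqVlt => /orP[/eqP ->|/Hs is_].
    by rewrite tE; apply: lspan_subset => x xt; rewrite mem_cat xt orbT.
  by move=> x /is_; apply: lspan_subset => y ys; rewrite mem_cat ys.
exists s => a Fa; rewrite -(trunc_id gA Fa).
apply: (@submod_sum k A) => [|i _]; first exact: lspan_sub.
apply: (Hs i); first by rewrite -ltnS ltn_ord.
exact: algebra_pr_in.
Qed.

(** The induction is used at the zero ideal, which annihilates every module. *)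
Lemma GKdim_Kdim_one_sided :
  (forall I, gideal prA I -> ~ I 1 -> prime_elt I ->
     (exists i x, [/\ (0 < i)%N, prA i x = x & ~ I x]) ->
     bounded_mod prA I \/ normal_mod prA I) ->
  forall (M : lmodType A) (grM : int -> set M),
    module_grading grA grM -> finitely_generated M -> nonzero_module M ->
    exists d : nat, GKdim R M = (d%:R)%:E /\ has_Kdim M d.
Proof.
move=> H M grM gradM fgM [m m0].
have gA := graded_algebra_pr grading_A.
have [pr gM] := graded_module_exists grading_A gradM fgM.
have noeM : noetherian_module M by exact: noetherian_fg.
have fM := fin_graded_fg gA deg_le_locally_finite gM fgM.
have fA : fin_graded (prA : nat -> A^o -> A^o).
  apply: (fin_graded_fg gA deg_le_locally_finite gA).
  exists [:: 1]; apply/seteqP; split=> // x _; exists (fun=> x).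
  by rewrite big_ord1 [_ *: _]mulr1.
have g0 := gsub0 gM; have gT := @gsubT _ _ _ pr.
have g0A : gideal prA [set 0].
  by split; [exact: (gsub0 gA)|move=> x a ->; rewrite /= mul0r].
have ann : annihilated [set 0] [set 0] [set: M].
  by move=> a x -> _; rewrite /= scale0r.
have [T0|[d [d1 d2 d3]]] :=
  all_gideals_good gA fA noeA H g0A gM fM noeM g0 gT (@subsetT _ _) ann.
  by have := T0 m Logic.I; move: m0 => /eqP.
exists d; split.
  exact: (GKdim_hilb_growth gA deg_le_locally_finite noeA gM R fgM noeM d1).
split=> //; apply: (gdev_lt_Kdim_lt gA gM g0 gT _ d2); exact: subsetT.
Qed.

End OneSided.

Theorem proposition0p9 (R : realType) (k : fieldType) (A : algType k)
    (grA : nat -> set A) (grading_A : algebra_grading grA)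
    (lf_A : locally_finite grA) (noeth_A : noetherian A)
    (fbn_or_normal : graded_FBN grA \/ enough_normal_elements grA) :
  (forall (M : lmodType A) (grM : int -> set M),
     module_grading grA grM -> finitely_generated M -> nonzero_module M ->
     exists d : nat, GKdim R M = (d%:R)%:E /\ has_Kdim M d) /\
  (forall (M : lmodType A^c) (grM : int -> set M),
     module_grading (A := A^c) grA grM -> finitely_generated M ->
     nonzero_module M ->
     exists d : nat, GKdim R M = (d%:R)%:E /\ has_Kdim M d).
Proof.
have [noel noer] := noeth_A; split.
  apply: (GKdim_Kdim_one_sided (grading_A := grading_A) R lf_A noel).
  move=> I gI nI1 pI pos; have [[sI _] rI] := gI.
  have [p pE] := proper2ideal_exists sI rI nI1; subst I.
  case: fbn_or_normal => H; [left|right].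
    exact: graded_FBN_bounded_mod.
  exact: enough_normal_normal_mod.
apply: (@GKdim_Kdim_one_sided R k A^c grA (algebra_grading_converse grading_A) lf_A noer).
rewrite algebra_pr_converse.
move=> I gIc nI1 pIc pos; have gI := (gideal_converse _ _).1 gIc.
have pI := prime_elt_converse pIc; have [[sI _] rI] := gI.
have [p pE] := proper2ideal_exists sI rI nI1; subst I.
case: fbn_or_normal => H; [left|right].
  exact: graded_FBN_bounded_mod_converse.
by apply: normal_mod_converse; exact: enough_normal_normal_mod.
Qed.
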